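(* Let $c\ge1$ and $0<\gamma c<0.25$. Let $G\sim G(n,p)$ and let $\mathcal{A}(G)$ be a rewiring of $G$ by a $\gamma$-omniscient adversary. The prune-then-mean and prune-then-median estimators (with parameters $\gamma,c$) prune $2c\gamma n$ nodes in total, and with probability $1-n^{-2}$ they estimate $p$ to accuracy $O\!\left(c\gamma^2+\frac{\log n}{n}\right)$ and $O\!\left(c\gamma+\sqrt{\frac{\log n}{n}}\right)$ respectively, where the $O(\cdot)$ hide universal constants.
   Context: $G(n,p)$ is the distribution over undirected graphs on $[n]$ with each edge present independently with probability $p$. A $\gamma$-omniscient adversary knows $p$, observes $G$, chooses $B\subseteq[n]$ with $|B|\le\gamma n$ and arbitrarily changes the status of any edge with at least one endpoint in $B$, producing $\mathcal{A}(G)$. The prune-then-mean/median algorithm: given $\mathcal{A}(G)$, $\gamma$ and $c$, remove the $c\gamma n$ nodes of largest degree and the $c\gamma n$ nodes of smallest degree (degrees in $\mathcal{A}(G)$); on the remaining induced graph $H$ with $m=(1-2c\gamma)n$ nodes, output either the mean estimate $(\text{number of edges of }H)/\binom m2$ or the median estimate $\mathrm{Median}\{\deg_H(v)\}/(m-1)$. *)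

(* Defs.v *)
From HB Require Import structures.
From mathcomp Require Import all_boot all_order all_algebra.
From mathcomp Require Import reals exp.

Set Implicit Arguments.
Unset Strict Implicit.
Unset Printing Implicit Defensive.

Import Order.TTheory GRing.Theory Num.Theory.
Local Open Scope ring_scope.

(* Undirected simple graphs on [n], with [n] rendered as 'I_n: an edge is a
   2-element set of vertices. *)
Record sgraph (n : nat) := SGraph {
  edges :> {set {set 'I_n}};
  edgesP : [forall e in edges, #|e| == 2] }.

HB.instance Definition _ n := [isSub for @edges n].
HB.instance Definition _ n := [Finite of sgraph n by <:].

Section Graphs.
Variable n : nat.
Implicit Types (E : {set {set 'I_n}}) (S T L : {set 'I_n}).

Definition deg E (v : 'I_n) : nat := #|[set e in E | v \in e]|.

Definition induced E S : {set {set 'I_n}} := [set e in E | e \subset S].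

(* T consists of k nodes of largest degree and L of k nodes of smallest degree
   (disjoint, so that 2k nodes are removed); ties may be broken in any way. *)
Definition is_pruning (k : nat) E T L : Prop :=
  [/\ #|T| = k, #|L| = k, [disjoint T & L],
      (forall u v, u \in T -> v \notin T -> (deg E v <= deg E u)%N) &
      (forall u v, u \in L -> v \notin L -> (deg E u <= deg E v)%N)].

End Graphs.

Section Estimation.
Variables (R : realType) (n : nat).
Implicit Types (p gamma c : R) (E : {set {set 'I_n}}) (S : {set 'I_n}).

Definition gnp p (G : sgraph n) : R :=
  \prod_(e : {set 'I_n} | #|e| == 2) (if e \in edges G then p else 1 - p).

Definition Pr_gnp p (event : pred (sgraph n)) : R :=
  \sum_(G : sgraph n | event G) gnp p G.

(* The corrupted set B may depend on the observed graph G. *)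
Definition omniscient_adversary gamma (A : sgraph n -> sgraph n) : Prop :=
  forall G : sgraph n, exists B : {set 'I_n},
    #|B|%:R <= gamma * n%:R /\
    forall e : {set 'I_n},
      [disjoint e & B] -> (e \in edges (A G)) = (e \in edges G).

(* The number c * gamma * n of nodes pruned at each end, rounded down. *)
Definition prune_size gamma c : nat := Num.truncn (c * gamma * n%:R).

Definition pruning_rule gamma c (T L : sgraph n -> {set 'I_n}) : Prop :=
  forall G : sgraph n, is_pruning (prune_size gamma c) (edges G) (T G) (L G).

(* For a sequence of even length, the average of the two middle values. *)
Definition median (s : seq nat) : R :=
  let t := sort leq s in
  ((nth 0%N t ((size t).-1 %/ 2))%:R + (nth 0%N t (size t %/ 2))%:R) / 2.

Definition mean_estimate E S : R :=
  #|induced E S|%:R / 'C(#|S|, 2)%:R.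

Definition median_estimate E S : R :=
  median [seq deg (induced E S) v | v <- enum S] / (#|S|.-1)%:R.

Definition pruned (T L : sgraph n -> {set 'I_n}) (G : sgraph n) : {set 'I_n} :=
  T G :|: L G.

Definition prune_then_mean (T L : sgraph n -> {set 'I_n}) (G : sgraph n) : R :=
  mean_estimate (edges G) (~: pruned T L G).

Definition prune_then_median (T L : sgraph n -> {set 'I_n}) (G : sgraph n) : R :=
  median_estimate (edges G) (~: pruned T L G).

End Estimation.

(* Main.v *)
(* Write [W] for the adjacency matrix centred by [p] off the diagonal, [d v] for
   its row sums, [U] for the pruned set and [S] for its complement, and put
   [w = gamma n], [k = c gamma n].  Up to [O(w sqrt(n log n) + k w)] the mean
   estimator has error [1_S W 1_S / |S|^2], and
   [1_S W 1_S = 1 W 1 - 2 sum_U d + 1_U W 1_U].  Since [c] is unbounded, the last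
   two terms are only small because the top and the bottom of the degree
   sequence cancel.

   - [sum_U d]: an exchange argument replaces the pruned sets by the true top and
     bottom [k] vertices at a cost [O(k w)]; a trimmed sum is controlled by the
     clipped sums [sum_v clip_t (d v)], which concentrate, and whose means are
     bounded because the binomial law is almost symmetric around its mode.
   - [1_U W 1_U]: a union bound over sets of size [2 k] suffices unless
     [k sigma rho >> n log n + k w], where [sigma^2 = n p (1 - p)] and
     [rho = (k / n)^(1/4)].  In that regime [U] is, off the corrupted vertices, a
     degree-determined core plus a subset of the few vertices whose degree is
     within [w] of the two thresholds.  For degree-determined [X, Y] the form is
     bounded through switchings [ac, bd <-> ad, bc], which preserve both the
     degrees and the law of the graph: averaging the signs of many commuting
     switchings gives an exponential moment bound for a quadrilinear statistic
     close to [p (1 - p) n^2] times the centred form of [X, Y].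

   The median estimator only needs that every surviving vertex has a corrupted
   degree within [O(sqrt(n log n)) + w] of [p (n - 1)]. *)

Require Import Defs.
From HB Require Import structures.
From mathcomp Require Import all_boot all_order all_algebra.
From mathcomp Require Import reals exp.
From mathcomp Require Import perm ring lra zify.

Set Implicit Arguments.
Unset Strict Implicit.
Unset Printing Implicit Defensive.

Import Order.TTheory GRing.Theory Num.Theory.
Local Open Scope ring_scope.

(** A set chosen through degrees depends on every edge, so its form is not a sum with fixed
    coefficients. Switchings supply signs that are symmetric given the degree sequence: once the
    degrees are fixed there are at most [n^2] cores to union over, instead of [C(n, 2 k)] sets. The
    power [rho] is a deliberate loss. The entropy of a set of size [2 k], of order [k log (n / k)],
    is replaced by a multiple of [k / rho^2], so the plain union bound costs [k sigma rho]. The same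
    [rho] serves in the other regime: a degree level near a threshold holds
    [O(k / (rho sigma) + log n)] vertices, so the [2 w + 1] levels around a threshold hold
    [z = O((w + 1) (k / (rho sigma) + log n))], and choosing a subset of them costs [sigma rho^2 z],
    which is [O(n log n + k (w + 1))]. The [w + 1] is there because a zone has at least one level
    even if [w = 0]; the extra [k] is absorbed by [n log n]. The moment bounds rest on
    [exp x <= 1 + x + x^2] for [|x| <= 1/3], whence the caps [1/3] and [1/6] on all tilting
    parameters. *)

Local Notation expR := sequences.expR.

(** * Elementary exponential inequalities *)

Section ExpBounds.
Variable R : realType.

(** Only [1 + y <= exp y] is needed: it gives [exp (x / 2) <= 1 / (1 - x / 2)], and squaring leaves
    a polynomial inequality whose slack is [x^2 / 4 * (1 - 3 x + x^2)]; hence the range [1/3]. *)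
Lemma expR_le_quad (x : R) : `|x| <= 1 / 3 -> expR x <= 1 + x + x ^+ 2.
Proof.
rewrite ler_norml => /andP[x1 x2].
have h : 1 - x / 2 <= expR (- (x / 2)) by have := expR_ge1Dx (- (x / 2)).
have h1 : 0 < expR (x / 2) by exact: expR_gt0.
have h2 : expR (x / 2) * expR (- (x / 2)) = 1 by rewrite -expRD subrr expR0.
have h3 : expR x = expR (x / 2) ^+ 2 by rewrite expr2 -expRD -splitr.
set E := expR (x / 2) in h1 h2 h3 *; set F := expR (- _) in h h2.
have h4 : E * (1 - x / 2) <= 1 by rewrite -[leRHS]h2 ler_pM2l.
have h5 : E ^+ 2 * (1 - x / 2) ^+ 2 <= 1.
  by rewrite -exprMn; apply: exprn_ile1 => //; nra.
have h6 : 1 <= (1 + x + x ^+ 2) * (1 - x / 2) ^+ 2.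
  have -> : (1 + x + x ^+ 2) * (1 - x / 2) ^+ 2
      = 1 + x ^+ 2 / 4 * ((1 - 3 * x) + x ^+ 2) by field.
  by rewrite lerDl mulr_ge0 ?divr_ge0 ?sqr_ge0 // addr_ge0 ?sqr_ge0 //; lra.
have h7 : 0 < (1 - x / 2) ^+ 2 by rewrite exprn_gt0 //; lra.
by rewrite h3 -(ler_pM2r h7); exact: le_trans h6.
Qed.

(** After centring, the linear terms cancel and the quadratic ones add up to [r (1 - r) (a - b)^2].
    Keeping the variance, unlike in Hoeffding's lemma, is what makes later bounds scale with
    [p (1 - p)]. *)
Lemma two_point_expR (r a b c : R) : 0 <= r <= 1 -> `|a - b| <= c -> c <= 1 / 3 ->
  r * expR a + (1 - r) * expR b
    <= expR (r * a + (1 - r) * b + r * (1 - r) * c ^+ 2).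
Proof.
move=> /andP[r0 r1] hab c1.
set m := r * a + (1 - r) * b.
have ea : a = m + (1 - r) * (a - b) by rewrite /m; ring.
have eb : b = m + - r * (a - b) by rewrite /m; ring.
clearbody m; rewrite {1}ea {2}eb !expRD.
have h1 : expR ((1 - r) * (a - b)) <= 1 + (1 - r) * (a - b) + ((1 - r) * (a - b)) ^+ 2.
  apply: expR_le_quad; rewrite normrM ger0_norm ?subr_ge0 //.
  apply: (@le_trans _ _ `|a - b|); last exact: le_trans hab c1.
  by rewrite ler_piMl ?normr_ge0 // gerBl.
have h2 : expR (- r * (a - b)) <= 1 + - r * (a - b) + (- r * (a - b)) ^+ 2.
  apply: expR_le_quad; rewrite normrM normrN (ger0_norm r0).
  apply: (@le_trans _ _ `|a - b|); last exact: le_trans hab c1.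
  by rewrite ler_piMl ?normr_ge0.
have h3 : 1 + r * (1 - r) * c ^+ 2 <= expR (r * (1 - r) * c ^+ 2) by exact: expR_ge1Dx.
have hc : (a - b) ^+ 2 <= c ^+ 2.
  by rewrite -(real_normK (num_real (a - b))) lerXn2r // nnegrE ?normr_ge0 //;
     apply: le_trans hab; rewrite normr_ge0.
have em := expR_ge0 m.
have h4 : r * expR ((1 - r) * (a - b)) + (1 - r) * expR (- r * (a - b))
    <= expR (r * (1 - r) * c ^+ 2).
  apply: le_trans h3; set X := expR _ in h1 *; set Y := expR _ in h2 *.
  have rr : 0 <= r * (1 - r) by nra.
  have r1' : 0 <= 1 - r by lra.
  have k1 := ler_wpM2l r0 h1; have k2 := ler_wpM2l r1' h2.
  have k3 := ler_wpM2l rr hc.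
  by apply: le_trans (lerD k1 k2) _; move: k3; rewrite -subr_ge0 => k3;
     rewrite -subr_ge0; apply: le_trans k3 _; rewrite le_eqVlt; apply/orP; left;
     apply/eqP; ring.
by rewrite mulrCA [X in _ + X]mulrCA -mulrDr ler_wpM2l.
Qed.

End ExpBounds.

(** * Product Bernoulli measures on the subsets of a finite type *)

Section Bernoulli.
Variables (R : realType) (I : finType) (p : I -> R).
Hypothesis p01 : forall i, 0 <= p i <= 1.
Implicit Types (f g : {set I} -> R) (w : {set I}) (s : seq I).

Definition bern w : R := \prod_i (if i \in w then p i else 1 - p i).

Definition Ex f : R := \sum_w bern w * f w.

(** Conditional expectation given every coordinate other than [i], seen as a function on the whole
    space. *)
Definition avg (i : I) f w : R := p i * f (i |: w) + (1 - p i) * f (w :\ i).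

Definition avgs s f : {set I} -> R := foldr avg f s.

Lemma bern_ge0 w : 0 <= bern w.
Proof.
apply: prodr_ge0 => i _; have /andP[h0 h1] := p01 i.
by case: ifP => // _; rewrite subr_ge0.
Qed.

Lemma Ex_le f g : (forall w, f w <= g w) -> Ex f <= Ex g.
Proof. by move=> h; apply: ler_sum => w _; rewrite ler_wpM2l ?bern_ge0. Qed.

Lemma Ex_eq f g : (forall w, f w = g w) -> Ex f = Ex g.
Proof. by move=> h; apply: eq_bigr => w _; rewrite h. Qed.

Lemma Ex_cst (c : R) : Ex (fun=> c) = c.
Proof.
rewrite /Ex -mulr_suml /bern.
have := @bigA_distr R 0 1 *%R +%R I p (fun i => 1 - p i); rewrite big1 => [/esym|i _].
  by under eq_bigl do rewrite inE; move=> ->; rewrite mul1r.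
by rewrite /=; ring.
Qed.

Lemma ExZl (c : R) f : Ex (fun w => c * f w) = c * Ex f.
Proof. by rewrite /Ex mulr_sumr; apply: eq_bigr => w _; rewrite mulrCA. Qed.

Lemma ExD f g : Ex (fun w => f w + g w) = Ex f + Ex g.
Proof. by rewrite /Ex -big_split; apply: eq_bigr => w _; rewrite mulrDr. Qed.

Lemma Ex_sum (J : finType) (P : pred J) (F : J -> {set I} -> R) :
  Ex (fun w => \sum_(j | P j) F j w) = \sum_(j | P j) Ex (F j).
Proof.
rewrite /Ex exchange_big; apply: eq_bigr => w _.
by rewrite mulr_sumr.
Qed.

Lemma sum_set_split (i : I) (F : {set I} -> R) :
  \sum_w F w = \sum_(w : {set I} | i \notin w) (F w + F (i |: w)).
Proof.
rewrite (bigID (fun w : {set I} => i \notin w)) big_split; congr (_ + _).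
rewrite (reindex_onto (fun w => i |: w) (fun w => w :\ i)); last first.
  by move=> w; rewrite negbK => iw; rewrite setD1K.
apply: eq_bigl => w; rewrite negbK setU11 /=.
apply/eqP/idP => [<-|iw]; first by rewrite setD11.
by rewrite setU1K.
Qed.

Lemma Ex_avg i f : Ex (avg i f) = Ex f.
Proof.
rewrite /Ex !(sum_set_split i); apply: eq_bigr => w iw.
have ew : w :\ i = w by apply/setDidPl; rewrite disjoint_sym disjoints1.
have e1 : bern w = (1 - p i) * \prod_(j | j != i) (if j \in w then p j else 1 - p j).
  by rewrite /bern (bigD1 i) //= (negbTE iw).
have e2 : bern (i |: w) =
    p i * \prod_(j | j != i) (if j \in w then p j else 1 - p j).
  rewrite /bern (bigD1 i) //= setU11; congr (_ * _).
  by apply: eq_bigr => j ji; rewrite in_setU1 (negbTE ji).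
rewrite /avg ew setU1K // setUA setUid e1 e2.
ring.
Qed.

Lemma Ex_avgs s f : Ex (avgs s f) = Ex f.
Proof. by elim: s => //= i s IH; rewrite Ex_avg. Qed.

Definition indep_of (i : I) f := forall w, f (i |: w) = f (w :\ i).

Lemma indep_of_id i f w : indep_of i f -> f (i |: w) = f w /\ f (w :\ i) = f w.
Proof.
move=> h; case: (boolP (i \in w)) => iw.
  have e : i |: w = w by apply/setUidPr; rewrite sub1set.
  by rewrite -h e.
have e : w :\ i = w by apply/setDidPl; rewrite disjoint_sym disjoints1.
by rewrite h e.
Qed.

Lemma indep_of_all_cst f w : (forall i, indep_of i f) -> f w = f set0.
Proof.
move=> h; have [m] := ubnP #|w|; elim: m w => // m IH w.
case: (set_0Vmem w) => [->//|[i iw]] hm.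
rewrite -(indep_of_id w (h i)).2; apply: IH.
by rewrite (cardsD1 i w) iw in hm.
Qed.

Lemma setU1U1 (i : I) w : i |: (i |: w) = i |: w.
Proof. by rewrite setUA setUid. Qed.

Lemma setU1D1 (i : I) w : i |: (w :\ i) = i |: w.
Proof. by apply/setP => k; rewrite !inE; case: eqP. Qed.

Lemma setD1U1 (i : I) w : (i |: w) :\ i = w :\ i.
Proof. by apply/setP => k; rewrite !inE; case: eqP. Qed.

Lemma setD1D1 (i : I) w : (w :\ i) :\ i = w :\ i.
Proof. by apply/setP => k; rewrite !inE; case: eqP. Qed.

Lemma setU1D1C (i j : I) w : i != j -> (i |: w) :\ j = i |: (w :\ j).
Proof.
move=> ij; apply/setP => k; rewrite !inE; case: (eqVneq k i) => [->|//].
by rewrite ij.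
Qed.

Lemma setD1C (i j : I) w : (w :\ i) :\ j = (w :\ j) :\ i.
Proof. by apply/setP => k; rewrite !inE andbCA. Qed.

Lemma avg_lip i j f w (c : R) :
    (forall w', `|f (i |: w') - f (w' :\ i)| <= c) ->
  `|avg j f (i |: w) - avg j f (w :\ i)| <= c.
Proof.
move=> h; have c0 : 0 <= c by apply: le_trans (h w).
rewrite /avg; case: (eqVneq i j) => [<-|ij].
  by rewrite setU1U1 setU1D1 setD1U1 setD1D1 subrr normr0.
rewrite setUCA (@setU1D1C i j) // -(@setU1D1C j i) 1?eq_sym // (@setD1C i j).
rewrite opprD addrACA -!mulrBr; have /andP[p0 p1] := p01 j.
apply: le_trans (ler_normD _ _) _; rewrite !normrM (ger0_norm p0).
rewrite (@ger0_norm _ (1 - p j)) ?subr_ge0 //.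
apply: (@le_trans _ _ (p j * c + (1 - p j) * c)); last by rewrite -mulrDl addrC subrK mul1r.
by rewrite lerD // ler_wpM2l ?subr_ge0.
Qed.

Lemma avgs_lip i s f w (c : R) :
    (forall w', `|f (i |: w') - f (w' :\ i)| <= c) ->
  `|avgs s f (i |: w) - avgs s f (w :\ i)| <= c.
Proof. by move=> h; elim: s w => [|j s IH] w //=; apply: avg_lip. Qed.

Lemma indep_of_avg i j f : indep_of i f -> indep_of i (avg j f).
Proof.
move=> h w; apply/eqP; rewrite -subr_eq0 -normr_le0; apply: avg_lip => w'.
by rewrite h subrr normr0.
Qed.

Lemma indep_of_avgs i s f : i \in s -> indep_of i (avgs s f).
Proof.
elim: s => //= j s IH; rewrite inE => /orP[/eqP <-|/IH]; last exact: indep_of_avg.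
by move=> w; rewrite /avg setU1U1 setU1D1 setD1U1 setD1D1.
Qed.

(** Once all coordinates are averaged the function depends on none of them, so it is constant and
    equal to its mean. *)
Lemma avgs_enum f w : avgs (enum I) f w = Ex f.
Proof.
rewrite -(Ex_avgs (enum I) f).
have h i : indep_of i (avgs (enum I) f) by apply: indep_of_avgs; rewrite mem_enum.
rewrite (indep_of_all_cst w h) -[LHS]Ex_cst.
by apply: Ex_eq => v; rewrite [RHS](indep_of_all_cst v h).
Qed.

Lemma avg_le i f g w : (forall w', f w' <= g w') -> avg i f w <= avg i g w.
Proof.
move=> h; have /andP[p0 p1] := p01 i.
by rewrite lerD // ler_wpM2l ?subr_ge0.
Qed.

(** A bounded-difference inequality with variances. Coordinates are integrated out one at a time;
    [two_point_expR] applies at each stage because the partial averages keep the Lipschitz constants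
    [c i] ([avgs_lip]). *)
Lemma Ex_expR_lip f (c : I -> R) :
    (forall i w, `|f (i |: w) - f (w :\ i)| <= c i) -> (forall i, c i <= 1 / 3) ->
  Ex (fun w => expR (f w)) <= expR (Ex f + \sum_i p i * (1 - p i) * c i ^+ 2).
Proof.
move=> hf hc.
have h s w : avgs s (fun w => expR (f w)) w
    <= expR (avgs s f w + \sum_(i <- s) p i * (1 - p i) * c i ^+ 2).
  elim: s w => [|j s IH] w /=; first by rewrite big_nil addr0.
  apply: le_trans (avg_le _ _ IH) _; rewrite /avg big_cons.
  set S := \sum_(i <- s) _.
  have h1 := two_point_expR (p01 j) (avgs_lip s w (hf j)) (hc j).
  set A := avgs s f _ in h1 *; set B := avgs s f _ in h1 *.
  set q := p j * _ * c j ^+ 2 in h1 *.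
  rewrite addrA (expRD (_ + _)) !(expRD _ S) !mulrA -mulrDl.
  by rewrite ler_wpM2r ?expR_ge0.
by have := h (enum I) set0; rewrite !avgs_enum big_enum.
Qed.
End Bernoulli.

(** * The binomial law and its near symmetry around the mode *)

Section Binomial.
Variable R : realType.
Implicit Types (p q t : R) (N i j : nat).

Definition bpmf N p i : R := 'C(N, i)%:R * p ^+ i * (1 - p) ^+ (N - i).

(** Expectation under the binomial law, by recursion on the trials: moment identities become
    inductions, and the recursion matches the averaging of edges one by one in [avgs_row]. The sum
    over [bpmf] is recovered by [binEE]. *)
Fixpoint binE N p (f : nat -> R) : R :=
  if N is N'.+1 then p * binE N' p (fun i => f i.+1) + (1 - p) * binE N' p f
  else f 0%N.

Lemma binE_ext N p f g : (forall i, f i = g i) -> binE N p f = binE N p g.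
Proof. by elim: N f g => //= N IH f g h; rewrite (IH f g) // (IH _ (fun i => g i.+1)). Qed.

Lemma bpmf_ge0 N p i : 0 <= p <= 1 -> 0 <= bpmf N p i.
Proof. by move=> /andP[p0 p1]; rewrite !mulr_ge0 ?ler0n ?exprn_ge0 // subr_ge0. Qed.

Lemma bpmf_gtn N p i : (N < i)%N -> bpmf N p i = 0.
Proof. by move=> h; rewrite /bpmf bin_small // !mul0r. Qed.

Lemma bpmfS N p i : bpmf N.+1 p i.+1 = p * bpmf N p i + (1 - p) * bpmf N p i.+1.
Proof.
rewrite /bpmf binS natrD subSS exprS.
case: (ltnP i N) => h; last first.
  by rewrite (@bin_small N i.+1) // add0r !mul0r mulr0 addr0; ring.
have -> : (N - i = (N - i.+1).+1)%N by lia.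
by rewrite exprS; ring.
Qed.

Lemma bpmfS0 N p : bpmf N.+1 p 0 = (1 - p) * bpmf N p 0.
Proof. by rewrite /bpmf !bin0 !subn0 exprS; ring. Qed.

Lemma binEE N p f m : (N < m)%N -> binE N p f = \sum_(i < m) bpmf N p i * f i.
Proof.
elim: N f m => [|N IH] f m hm.
  case: m hm => // m _; rewrite big_ord_recl big1 ?addr0 => [|i _].
    by rewrite /bpmf bin0 !expr0 !mul1r.
  by rewrite bpmf_gtn ?mul0r.
case: m hm => // m hm; rewrite /= (IH _ m) // (IH f m.+1); last by lia.
rewrite !big_ord_recl bpmfS0 mulrDr mulrA addrCA; congr (_ + _).
rewrite !mulr_sumr -big_split; apply: eq_bigr => i _ /=.
by rewrite bpmfS; ring.
Qed.

Lemma binE_mean N p f : (forall i, f i = i%:R) -> binE N p f = N%:R * p.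
Proof.
have h (c : R) : binE N p (fun i => c + i%:R) = c + N%:R * p.
  elim: N c => [|N IH] c /=; first by rewrite mul0r.
  rewrite IH (@binE_ext _ _ _ (fun i => (c + 1) + i%:R)) ?IH; last first.
    by move=> i; rewrite -natr1; ring.
  by rewrite -natr1; ring.
move=> hf; rewrite -[RHS]add0r -(h 0); apply: binE_ext => i.
by rewrite hf add0r.
Qed.

Lemma bpmf_ratio N p i : (i <= N)%N ->
  bpmf N p i.+1 * (i.+1%:R * (1 - p)) = bpmf N p i * ((N%:R - i%:R) * p).
Proof.
rewrite leq_eqVlt => /orP[/eqP->|h].
  by rewrite bpmf_gtn // mul0r subrr mul0r mulr0.
rewrite /bpmf -natrB 1?ltnW //.
have e1 : (i.+1%:R * 'C(N, i.+1)%:R = (N - i)%:R * 'C(N, i)%:R :> R).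
  by rewrite -!natrM mul_bin_left.
have em : (N - i = (N - i.+1).+1)%N by lia.
set M := (N - i)%:R in e1 *.
rewrite em exprS (exprS _ (N - _)).
transitivity ((i.+1%:R * 'C(N, i.+1)%:R) * (p * p ^+ i * (1 - p) ^+ (N - i.+1) * (1 - p))).
  by ring.
by rewrite e1; ring.
Qed.

Lemma bpmf_gt0 N p i : 0 < p < 1 -> (i <= N)%N -> 0 < bpmf N p i.
Proof.
move=> /andP[p0 p1] iN; rewrite !mulr_gt0 ?exprn_gt0 ?subr_gt0 //.
by rewrite ltr0n bin_gt0.
Qed.

Lemma binE_le N p f g : 0 <= p <= 1 -> (forall i, f i <= g i) ->
  binE N p f <= binE N p g.
Proof.
move=> /andP[p0 p1]; elim: N f g => //= N IH f g h.
by rewrite lerD // ler_wpM2l ?subr_ge0 ?IH.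
Qed.

Lemma binE_lin N p (c : R) f g :
  binE N p (fun i => c * f i + g i) = c * binE N p f + binE N p g.
Proof. by elim: N f g => //= N IH f g; rewrite !IH; ring. Qed.

Lemma binE_cst N p (c : R) : binE N p (fun=> c) = c.
Proof. by elim: N => //= N ->; ring. Qed.

Lemma binE_sq N p (c : R) :
  binE N p (fun i => (i%:R - c) ^+ 2) = N%:R * p * (1 - p) + (N%:R * p - c) ^+ 2.
Proof.
elim: N c => [|N IH] c /=; first by ring.
rewrite IH (@binE_ext _ _ _ (fun i => (i%:R - (c - 1)) ^+ 2)) ?IH; last first.
  by move=> i; rewrite -natr1; ring.
by rewrite -natr1; ring.
Qed.

(** By [bpmf_ratio], passing from [j] to [j + 1] multiplies the quotient of the masses at [m + j]
    and [m - j] by [num / den]. Up to terms in favour of the claim, [num - den] is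
    [(1 - 2 p) (j^2 + j - lam)], so only the first [sqrt lam] or so steps lose, each a factor
    [1 - 1 / lam]. The total loss is the minimum in the statement. *)
Lemma bpmf_reflect N p (m j : nat) : 0 < p -> p <= 1 / 2 ->
    m%:R <= N%:R * p -> 1 <= N%:R * p * (1 - p) -> (j <= m)%N ->
  (1 - Num.min j%:R (Num.sqrt (N%:R * p * (1 - p)) + 1) / (N%:R * p * (1 - p)))
    * bpmf N p (m - j) <= bpmf N p (m + j).
Proof.
move=> p0 p12 mN; set lam := N%:R * p * (1 - p) => lam1.
have lam0 : 0 < lam by lra.
have p01 : 0 <= p <= 1 by apply/andP; lra.
have p01' : 0 < p < 1 by apply/andP; lra.
have mN2 : (m + m <= N)%N.
  rewrite -(ler_nat R) natrD; have : 0 <= N%:R :> R by []. by move=> ?; nra.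
set s := Num.sqrt lam.
have s0 : 0 <= s by exact: sqrtr_ge0.
have s2 : s ^+ 2 = lam by rewrite sqr_sqrtr // ltW.
set kap := fun j : nat => Num.min (j%:R : R) (s + 1) / lam.
elim: j => [|j IH] jm.
  rewrite subn0 addn0 min_l ?mul0r ?subr0 ?mul1r //; lra.
have {}IH := IH (ltnW jm).
have kapS : kap j <= kap j.+1.
  rewrite /kap ler_pM2r ?invr_gt0 // le_min ge_min ge_min lexx orbT andbT.
  by rewrite ler_nat leqnSn.
set P := bpmf N p (m + j) in IH *; set Q := bpmf N p (m - j) in IH *.
set Q' := bpmf N p (m - j.+1); rewrite addnS; set P' := bpmf N p _.
have P0 : 0 <= P by exact: bpmf_ge0.
have P'0 : 0 <= P' by exact: bpmf_ge0.
have Q0 : 0 < Q by apply: bpmf_gt0; [exact: p01'|clear -mN2 jm; lia].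
have Q'0 : 0 < Q' by apply: bpmf_gt0; [exact: p01'|clear -mN2 jm; lia].
rewrite -/(kap j) -/(kap j.+1) in IH *.
have [neg|pos] := ltP (1 - kap j.+1) 0.
  by apply: le_trans P'0; rewrite nmulr_rle0 // ltW.
have e1 : P' * ((m%:R + j%:R + 1) * (1 - p)) = P * ((N%:R - m%:R - j%:R) * p).
  have := @bpmf_ratio N p (m + j); rewrite -/P -/P' -natr1 natrD => ->; last by clear -mN2 jm; lia.
  by ring.
have e2 : Q * ((m%:R - j%:R) * (1 - p)) = Q' * ((N%:R - m%:R + j%:R + 1) * p).
  have le1 : (m - j.+1 <= N)%N by clear -mN2 jm; lia.
  have := bpmf_ratio p le1.
  have -> : ((m - j.+1).+1 = m - j)%N by clear -jm; lia.
  rewrite -/Q -/Q' (natrB _ (ltnW jm)) (natrB _ jm) => ->.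
  by rewrite -natr1; ring.
set X := (m%:R : R) in e1 e2 mN *; pose n := (N%:R : R).
have lamE : lam = n * p * (1 - p) by [].
change (N%:R : R) with n in e1, e2, mN.
clearbody lam.
set y := (j%:R : R) in e1 e2 *.
have y0 : 0 <= y by rewrite /y.
have yX : y + 1 <= X by rewrite /y /X natr1 ler_nat.
have n0 : 0 <= n by rewrite /n.
pose num := (n - X - y) * (n - X + y + 1) * p ^+ 2.
pose den := (X + y + 1) * (X - y) * (1 - p) ^+ 2.
have den0 : 0 < den.
  by rewrite /den !mulr_gt0 ?exprn_gt0 //; clear -y0 yX p0 p12 n0; lra.
have key : P' * Q * den = P * Q' * num.
  transitivity ((P' * ((X + y + 1) * (1 - p))) * (Q * ((X - y) * (1 - p)))).
    by rewrite /den; ring.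
  by rewrite e1 e2 /num; ring.
have nden : den <= lam ^+ 2 + lam * (1 - p) - (1 - p) ^+ 2 * (y ^+ 2 + y).
  have a1 : X * (1 - p) <= lam by rewrite lamE; apply: ler_wpM2r; lra.
  have a0 : 0 <= X * (1 - p) by apply: mulr_ge0; lra.
  have -> : den = (X * (1 - p)) ^+ 2 + (X * (1 - p)) * (1 - p)
      - (1 - p) ^+ 2 * (y ^+ 2 + y) by rewrite /den; ring.
  rewrite lerD2r lerD //; first by rewrite lerXn2r ?nnegrE // ltW.
  by rewrite ler_wpM2r //; lra.
have nnum : lam ^+ 2 + lam * p - p ^+ 2 * (y ^+ 2 + y) <= num.
  have a1 : lam <= (n - X) * p.
    have -> : lam = (n * (1 - p)) * p by rewrite lamE; ring.
    by rewrite ler_wpM2r //; lra.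
  have -> : num = ((n - X) * p) ^+ 2 + ((n - X) * p) * p
      - p ^+ 2 * (y ^+ 2 + y) by rewrite /num; ring.
  have l0 := ltW lam0.
  rewrite lerD2r lerD //.
    by rewrite lerXn2r ?nnegrE //; apply: le_trans a1.
  by rewrite ler_wpM2r //; lra.
have step (c : R) : 0 <= 1 - kap j -> c * den <= num -> (1 - kap j) * c * Q' <= P'.
  move=> k0 hc.
  have h : (1 - kap j) * c * Q' * (Q * den) <= P' * (Q * den).
    rewrite mulrA key.
    have -> : (1 - kap j) * c * Q' * (Q * den) = ((1 - kap j) * Q) * (Q' * (c * den)) by ring.
    have -> : P * Q' * num = P * (Q' * num) by ring.
    apply: le_trans (_ : ((1 - kap j) * Q) * (Q' * num) <= _).
      by apply: ler_wpM2l; [exact: mulr_ge0 (ltW Q0)|rewrite ler_pM2l].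
    have num0 : 0 <= num.
      have hle : num = (n - X - y) * (n - X + y + 1) * p ^+ 2 by [].
      have : X + y <= n by rewrite /X /y /n -natrD ler_nat; clear -mN2 jm; lia.
      move=> hh; have nX : X <= n by apply: le_trans hh; rewrite lerDl.
      rewrite hle; apply: mulr_ge0 (sqr_ge0 _); apply: mulr_ge0.
        by rewrite -addrA -opprD subr_ge0.
      by apply: addr_ge0 => //; apply: addr_ge0 => //; rewrite subr_ge0.
    by apply: ler_wpM2r => //; exact: mulr_ge0 (ltW Q'0) num0.
  by move: h; rewrite ler_pM2r // mulr_gt0.
have k0 : 0 <= 1 - kap j by lra.
(* Beyond about one standard deviation [den <= num], and [p <= 1/2] makes the step free. *)
have [wl|wl] := ltP (y ^+ 2 + y) lam; last first.
  have h1 : 1 * den <= num.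
    rewrite mul1r; apply: le_trans nden _; apply: le_trans nnum.
    have : 0 <= (1 - 2 * p) * (y ^+ 2 + y - lam) by apply: mulr_ge0; lra.
    by nra.
  apply: le_trans (step 1 k0 h1); rewrite mulr1 ler_pM2r //; lra.
have h1 : (1 - 1 / lam) * den <= num.
  set DEN := lam ^+ 2 + _ - _ in nden.
  have c0 : 0 <= 1 - 1 / lam by rewrite subr_ge0 ler_pdivrMr // mul1r.
  apply: le_trans (ler_wpM2l c0 nden) _; apply: le_trans nnum.
  have w0 : 0 <= y ^+ 2 + y by rewrite addr_ge0 ?sqr_ge0.
  have D1 : lam ^+ 2 <= DEN.
    have : (1 - p) ^+ 2 * (y ^+ 2 + y) <= (1 - p) * lam.
      have -> : (1 - p) ^+ 2 * (y ^+ 2 + y) = (1 - p) * ((1 - p) * (y ^+ 2 + y)) by ring.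
      by apply: ler_wpM2l; [lra|nra].
    by rewrite /DEN; nra.
  have D2 : lam <= DEN / lam by rewrite ler_pdivlMr // -expr2.
  have -> : lam ^+ 2 + lam * p - p ^+ 2 * (y ^+ 2 + y)
      = DEN - (1 - 2 * p) * (lam - (y ^+ 2 + y)) by rewrite /DEN; ring.
  have D3 : (1 - 2 * p) * (lam - (y ^+ 2 + y)) <= lam by nra.
  have -> : (1 - 1 / lam) * DEN = DEN - DEN / lam by field; rewrite gt_eqF.
  clear -D2 D3; lra.
(* A losing step has index at most [s], so its cost is not yet cut off by the minimum in [kap]. *)
have ys : y <= s.
  rewrite -(@ler_pXn2r _ 2) ?nnegrE // s2; nra.
have ek : kap j = y / lam by rewrite /kap min_l // -/y; lra.
have ek' : kap j.+1 = (y + 1) / lam by rewrite /kap min_l -natr1 -/y //; lra.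
apply: le_trans (step _ k0 h1); rewrite ler_pM2r // ek ek'.
have : 0 <= (y / lam) * (1 / lam) by rewrite mulr_ge0 ?divr_ge0 // ltW.
rewrite mulrDl; set A := y / lam; set B := 1 / lam; nra.
Qed.

End Binomial.

(** * Means of clipped binomials, and the hazard rate *)

Section Binomial2.
Variable R : realType.
Implicit Types (p q t : R) (N i j : nat).

Lemma sum_nat_shift (m M : nat) (F : nat -> R) :
  \sum_(m <= i < m + M) F i = \sum_(0 <= i < M) F (i + m)%N.
Proof. by rewrite -{1}[m]add0n big_addn addKn. Qed.

(** Pairing [m - j] with [m + j] loses a factor [1 - 2 / s], [s] being the standard deviation, while
    the lower side is at most [E |i - N p| <= s]. The product of the two is the additive [2]. *)
Lemma binE_reflect N p (m : nat) (h : nat -> R) : 0 < p -> p <= 1 / 2 ->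
    m%:R <= N%:R * p -> 1 <= N%:R * p * (1 - p) ->
    (forall i, 0 <= h i) -> h 0%N = 0 -> (forall i, h i <= i%:R) ->
  binE N p (fun i => h (m - i)%N) - 2 <= binE N p (fun i => h (i - m)%N).
Proof.
move=> p0 p12 mN lam1 h0 h00 hi.
set lam := N%:R * p * (1 - p) in lam1 *.
have lam0 : 0 < lam by lra.
have p01 : 0 <= p <= 1 by apply/andP; lra.
set s := Num.sqrt lam.
have s2 : s ^+ 2 = lam by rewrite sqr_sqrtr // ltW.
have s1 : 1 <= s by rewrite -(@ler_pXn2r _ 2) ?nnegrE ?sqrtr_ge0 // s2 expr1n.
set c := 2 / s.
have hc (j : nat) : (j <= m)%N -> (1 - c) * bpmf N p (m - j) <= bpmf N p (m + j).
  move=> jm; apply: le_trans (bpmf_reflect p0 p12 mN lam1 jm).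
  apply: ler_wpM2r; first exact: bpmf_ge0.
  rewrite lerD2l lerN2 -/lam -/s /c.
  rewrite ler_pdivrMr // -s2 expr2 mulrA divfK ?gt_eqF //; last by lra.
  by rewrite ge_min; apply/orP; right; lra.
have lo : binE N p (fun i => h (m - i)%N) = \sum_(0 <= j < m.+1) bpmf N p (m - j) * h j.
  rewrite (@binEE _ _ _ _ (m.+1 + N)) ?addnS ?ltnS ?leq_addl // -(big_mkord xpredT (fun i => bpmf N p i * h (m - i)%N)).
  rewrite (@big_cat_nat _ _ _ m.+1) ?leq_addr //=.
  rewrite [X in _ + X]big_nat_cond [X in _ + X]big1 ?addr0; last first.
    move=> i /andP[/andP[h1 _] _]; have -> : (m - i = 0)%N by clear -h1; lia.
    by rewrite h00 mulr0.
  rewrite big_nat_rev /= add0n !big_nat; apply: eq_bigr => i im.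
  by rewrite subSS subKn //; clear -im; lia.
have hi2 : \sum_(0 <= j < m.+1) bpmf N p (m + j) * h j <= binE N p (fun i => h (i - m)%N).
  rewrite (@binEE _ _ _ _ (m + (N + m).+1)); last by clear; lia.
  rewrite -(big_mkord xpredT (fun i => bpmf N p i * h (i - m)%N)).
  rewrite [leRHS](@big_cat_nat _ _ _ m) ?leq_addr //=.
  rewrite [X in _ <= X + _]big_nat_cond [X in _ <= X + _]big1 ?add0r; last first.
    move=> i /andP[/andP[_ h1] _]; have -> : (i - m = 0)%N by clear -h1; lia.
    by rewrite h00 mulr0.
  rewrite [X in _ <= X]sum_nat_shift.
  rewrite [leRHS](@big_cat_nat _ _ _ m.+1) //=; last by clear; lia.
  rewrite -[leLHS]addr0; apply: lerD.
    by apply: ler_sum => i _; rewrite (addnC i m) addKn.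
  by apply: sumr_ge0 => i _; rewrite mulr_ge0 ?bpmf_ge0.
apply: le_trans hi2; rewrite lo.
have h1 : (1 - c) * \sum_(0 <= j < m.+1) bpmf N p (m - j) * h j
    <= \sum_(0 <= j < m.+1) bpmf N p (m + j) * h j.
  rewrite mulr_sumr !big_nat; apply: ler_sum => j jm.
  by rewrite mulrA; apply: ler_wpM2r => //; apply: hc; clear -jm; lia.
apply: le_trans h1; rewrite mulrBl mul1r lerD2l lerN2 -lo.
have h3 : binE N p (fun i => h (m - i)%N) <= s.
  (* The bound [|y| <= y^2 / (2 s) + s / 2] reduces the absolute deviation to the variance. *)
  apply: (@le_trans _ _ (binE N p (fun i => (2 * s)^-1 * (i%:R - N%:R * p) ^+ 2 + s / 2))).
    apply: binE_le => // i; apply: le_trans (hi _) _.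
    have sp : 0 < 2 * s by lra.
    have : 0 <= (`|i%:R - N%:R * p| - s) ^+ 2 by exact: sqr_ge0.
    rewrite sqrrB real_normK ?num_real // => h4.
    have h5 : (m - i)%:R <= `|i%:R - N%:R * p|.
      have [im|im] := leqP i m; last by rewrite (_ : (m - i = 0)%N) //; clear -im; lia.
      rewrite natrB // distrC; apply: le_trans (ler_norm _); lra.
    apply: le_trans h5 _; set X := (_ ^+ 2) in h4 *.
    rewrite -(ler_pM2l sp) mulrDr mulrA divff ?gt_eqF // mul1r.
    by nra.
  rewrite binE_lin binE_cst binE_sq subrr expr0n addr0 -/lam -s2.
  rewrite expr2 invfM mulrA -(mulrA _ s^-1) mulVf ?gt_eqF //; lra.
rewrite /c mulrAC ler_pdivrMr; lra.
Qed.

(** Soft thresholding of [i - m] at level [t], in truncated subtraction. If [t > m] the lower part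
    vanishes, as it should since [i - m >= - m]. *)
Definition clip (m t i : nat) : R := (i - (m + t))%:R - ((m - t) - i)%:R.

(** The bound does not depend on [t] or on the variance. If the variance is below [1], integrality
    gives [|clip| <= (i - m)^2] and a second moment suffices; otherwise the reflection bound is used
    on both sides. *)
Lemma binE_clip_half N p (m t : nat) : 0 <= p -> p <= 1 / 2 ->
    m%:R <= N%:R * p -> N%:R * p < m%:R + 1 ->
  `|binE N p (clip m t)| <= 3.
Proof.
move=> p0 p12 mN Nm; set lam := N%:R * p * (1 - p).
have p01 : 0 <= p <= 1 by apply/andP; lra.
have ec : binE N p (clip m t) = binE N p (fun i => (i - m - t)%:R)
    - binE N p (fun i => (m - i - t)%:R).
  transitivity (binE N p (fun i => -1 * (m - i - t)%:R + (i - m - t)%:R)).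
    by apply: binE_ext => i; rewrite /clip subnDA (subnAC m t i) mulN1r addrC.
  by rewrite binE_lin mulN1r addrC.
have [lam1|lam1] := leP 1 lam; last first.
  have h i : `|clip m t i| <= (i%:R - m%:R) ^+ 2.
    have -> : (i%:R - m%:R) ^+ 2 = ((i - m) ^ 2 + (m - i) ^ 2)%:R :> R.
      have [im|/ltnW im] := leqP i m.
        by rewrite (_ : (i - m = 0)%N) ?add0n ?natrX ?natrB //; [ring|clear -im; lia].
      by rewrite (_ : (m - i = 0)%N) ?addn0 ?natrX ?natrB //; clear -im; lia.
    rewrite /clip; apply: le_trans (ler_normB _ _) _.
    rewrite !normr_nat -natrD ler_nat; clear; nia.
  rewrite ler_norml; apply/andP; split.
    apply: (@le_trans _ _ (binE N p (fun i => -1 * (i%:R - m%:R) ^+ 2 + 0))).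
      rewrite binE_lin binE_sq binE_cst -/lam.
      have : (N%:R * p - m%:R) ^+ 2 <= 1 by rewrite expr2; nra.
      lra.
    by apply: binE_le => // i; have := h i; rewrite ler_norml; lra.
  apply: (@le_trans _ _ (binE N p (fun i => (i%:R - m%:R) ^+ 2))).
    by apply: binE_le => // i; have := h i; rewrite ler_norml; lra.
  rewrite binE_sq -/lam.
  have : (N%:R * p - m%:R) ^+ 2 <= 1 by rewrite expr2; nra.
  lra.
have pp : 0 < p.
  rewrite lt_neqAle p0 andbT; apply/eqP => pe.
  by move: lam1; rewrite /lam -pe mulr0 mul0r; lra.
(* Reflecting [(j - t)^+] bounds the mean from below by [-2]. Reflecting the complement [min (j, t)]
   bounds it from above, since the two together make up [i - m], whose mean lies in [[0, 1)]. *)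
have h1 := @binE_reflect N p m (fun j => (j - t)%:R) pp p12 mN lam1.
have h2 := @binE_reflect N p m (fun j => j%:R - (j - t)%:R) pp p12 mN lam1.
have {}h1 : binE N p (fun i => (m - i - t)%:R) - 2 <= binE N p (fun i => (i - m - t)%:R).
  by apply: h1 => // i; rewrite ?ler0n // ler_nat leq_subr.
have {}h2 : binE N p (fun i => (m - i)%:R - (m - i - t)%:R) - 2
    <= binE N p (fun i => (i - m)%:R - (i - m - t)%:R).
  apply: h2 => [i||i]; first by rewrite subr_ge0 ler_nat leq_subr.
    by rewrite subrr.
  by rewrite gerBl.
have sub (f g : nat -> R) : binE N p (fun i => f i - g i) = binE N p f - binE N p g.
  rewrite (@binE_ext _ _ _ _ (fun i => -1 * g i + f i)); last by move=> i; ring.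
  by rewrite binE_lin; ring.
have e0 : binE N p (fun i => (i - m)%:R) - binE N p (fun i => (m - i)%:R)
    = N%:R * p - m%:R.
  rewrite -sub (@binE_ext _ _ _ _ (fun i => i%:R - m%:R)); last first.
    move=> i; have [im|/ltnW im] := leqP i m.
      by rewrite (_ : (i - m = 0)%N) ?natrB //; [ring|clear -im; lia].
    by rewrite (_ : (m - i = 0)%N) ?natrB //; [ring|clear -im; lia].
  by rewrite sub binE_cst (@binE_mean _ N p (fun i => i%:R)).
move: h2; rewrite ec ler_norml !sub.
set A := binE _ _ _ in h1 *; set B := binE _ _ _ in h1 *.
by move=> h2; apply/andP; lra.
Qed.

Lemma binE_ext_le N p f g : (forall i, (i <= N)%N -> f i = g i) ->
  binE N p f = binE N p g.
Proof.
elim: N f g => [|N IH] f g h /=; first exact: h.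
rewrite (IH f g); last by move=> i iN; apply: h; exact: leqW.
by rewrite (IH _ (fun i => g i.+1)) // => i iN; exact: h.
Qed.

Lemma binE_rev N p f : binE N p f = binE N (1 - p) (fun i => f (N - i)%N).
Proof.
elim: N f => [|N IH] f //=; rewrite subKr addrC; congr (_ * _ + _ * _).
  by rewrite IH; apply: binE_ext => i; rewrite subSS.
rewrite IH; apply: binE_ext_le => i iN; congr f; lia.
Qed.

Lemma clip_shift (m t i : nat) : `|clip m.+1 t i - clip m t i| <= 2.
Proof.
rewrite /clip ler_norml.
have h1 : (i - (m.+1 + t) + (m - t - i) <= i - (m + t) + (m.+1 - t - i))%N by lia.
have h2 : (i - (m + t) + (m.+1 - t - i) <= i - (m.+1 + t) + (m - t - i) + 2)%N by lia.
move: h1 h2; rewrite -2!(ler_nat R) !natrD => h1 h2; apply/andP; lra.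
Qed.

(** For [p > 1/2] the law is reversed by [i -> N - i]. The integer centre may then exceed the mean;
    moving it down by one changes the clip by at most [2], which accounts for [5 = 3 + 2]. *)
Lemma binE_clip N p (m t : nat) : 0 <= p <= 1 ->
    m%:R <= N%:R * p -> N%:R * p < m%:R + 1 ->
  `|binE N p (clip m t)| <= 5.
Proof.
move=> p01 mN Nm; have /andP[p0 p1] := p01.
have [p12|p12] := leP p (1 / 2).
  by apply: le_trans (binE_clip_half t p0 p12 mN Nm) _; lra.
have mleN : (m <= N)%N.
  rewrite -(ler_nat R); apply: le_trans mN _; have : 0 <= N%:R :> R by [].
  by move=> ?; nra.
have q01 : 0 <= 1 - p <= 1 by apply/andP; lra.
have e1 : binE N p (clip m t) = - binE N (1 - p) (clip (N - m) t).
  rewrite binE_rev; transitivity (binE N (1 - p) (fun i => -1 * clip (N - m) t i + 0)).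
    apply: binE_ext_le => i iN; rewrite addr0 mulN1r /clip opprB.
    by congr (_%:R - _%:R); clear -iN mleN; lia.
  by rewrite binE_lin binE_cst addr0 mulN1r.
rewrite e1 normrN.
have q0 : 0 <= 1 - p by lra. have q12 : 1 - p <= 1 / 2 by lra.
have eN : N%:R = (N - m)%:R + m%:R :> R by rewrite -natrD subnK.
have [h|h] := ltP (N%:R * (1 - p)) (N - m)%:R; last first.
  have h' : N%:R * (1 - p) < (N - m)%:R + 1 by move: mN eN; lra.
  by apply: le_trans (binE_clip_half t q0 q12 h h') _; lra.
have [d hd] : exists d, (N - m = d.+1)%N.
  case E : (N - m)%N => [|d]; last by exists d.
  move: h; rewrite E => h; have := mulr_ge0 (ler0n R N) q0; lra.
move: eN h; rewrite hd -natr1 => eN h.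
have h1 : d%:R <= N%:R * (1 - p) by lra.
have := binE_clip_half t q0 q12 h1 h.
set A := binE _ _ (clip d t) => hA.
have : `|binE N (1 - p) (clip d.+1 t) - A| <= 2.
  have -> : binE N (1 - p) (clip d.+1 t) - A
      = binE N (1 - p) (fun i => clip d.+1 t i - clip d t i).
    rewrite -[RHS](_ : binE N (1 - p) (fun i => -1 * clip d t i + clip d.+1 t i) = _).
      by rewrite binE_lin mulN1r [RHS]addrC.
    by apply: binE_ext => i; ring.
  rewrite ler_norml; apply/andP; split.
    rewrite -[leLHS](binE_cst N (1 - p)); apply: binE_le => // i.
    by have := clip_shift d t i; rewrite ler_norml => /andP[].
  rewrite -[leRHS](binE_cst N (1 - p)); apply: binE_le => // i.
  by have := clip_shift d t i; rewrite ler_norml => /andP[].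
move: hA; rewrite !ler_norml => /andP[a1 a2] /andP[a3 a4]; apply/andP; lra.
Qed.

Definition btail N p i : R := binE N p (fun l => (i <= l)%N%:R).

(** Hazard rate bound. During the [M] steps after [i], with [M] about [s^2 / (2 (u + s))],
    successive masses lose at most a factor [1 - d] with [M d <= 1/2]. So [M + 1] masses of the tail
    are at least half the mass at [i]. *)
Lemma bpmf_btail N p i (u s : R) : 0 < p < 1 -> 0 < s ->
    s ^+ 2 = N%:R * p * (1 - p) -> 0 <= u -> i%:R - N%:R * p <= u ->
  bpmf N p i * s ^+ 2 <= 4 * (u + s) * btail N p i.
Proof.
move=> p01 s0 s2 u0 hu; have /andP[p0 p1] := p01.
have p01w : 0 <= p <= 1 by apply/andP; lra.
set y := s ^+ 2 / (2 * (u + s)).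
have us0 : 0 < 2 * (u + s) by lra.
have y0 : 0 <= y by rewrite divr_ge0 ?sqr_ge0 // ltW.
have yE : y * (2 * (u + s)) = s ^+ 2 by rewrite divfK // gt_eqF.
have /andP[My yM] := truncn_itv y0; set M := Num.truncn y in My yM.
set d := (u + M%:R) / s ^+ 2.
have ss0 : 0 < s ^+ 2 by rewrite exprn_gt0.
have M0 : 0 <= M%:R :> R by [].
have d0 : 0 <= d by rewrite divr_ge0 ?addr_ge0 // ltW.
have Md : M%:R * d <= 1 / 2.
  rewrite /d mulrA ler_pdivrMr //.
  have y1 : y <= s / 2.
    rewrite /y ler_pdivrMr // expr2; have := mulr_ge0 (ltW s0) u0; nra.
  have : M%:R * (u + M%:R) <= y * (u + s / 2).
    by apply: ler_pM => //; [exact: addr_ge0|rewrite lerD2l; exact: le_trans My y1].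
  have := mulr_ge0 y0 (ltW s0); nra.
have pm0 l : 0 <= bpmf N p l by exact: bpmf_ge0.
have step j : (j < M)%N -> (1 - d) * bpmf N p (i + j) <= bpmf N p (i + j).+1.
  move=> jM; have [lN|lN] := ltnP N (i + j); first by rewrite (bpmf_gtn _ lN) mulr0.
  have rat := @bpmf_ratio _ N p (i + j) lN.
  set l := (i + j)%N in lN rat *.
  have l0 : 0 < l.+1%:R * (1 - p) by rewrite mulr_gt0 ?ltr0n // subr_gt0.
  rewrite -(ler_pM2r l0) rat mulrAC mulrC ler_wpM2l //.
  have lE : l.+1%:R = i%:R + j%:R + 1 :> R by rewrite /l -natr1 natrD.
  have jM' : j%:R + 1 <= M%:R :> R by rewrite natr1 ler_nat.
  have lR : l%:R = i%:R + j%:R :> R by rewrite natrD.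
  suff h : l%:R - N%:R * p + (1 - p) <= d * (l.+1%:R * (1 - p)).
    move: h; rewrite lE lR; nra.
  have [neg|pos] := leP (l%:R - N%:R * p + (1 - p)) 0.
    by apply: le_trans neg _; rewrite mulr_ge0 // ltW.
  have h1 : s ^+ 2 <= l.+1%:R * (1 - p).
    rewrite s2; apply: ler_wpM2r; first lra.
    by move: pos; rewrite lE lR; lra.
  apply: le_trans (ler_wpM2l d0 h1); rewrite /d divfK ?gt_eqF //.
  by rewrite lR; lra.
have pw j : (j <= M)%N -> (1 - j%:R * d) * bpmf N p i <= bpmf N p (i + j).
  elim: j => [|j IH] jM; first by rewrite mul0r subr0 mul1r addn0.
  rewrite addnS; apply: le_trans (step j jM).
  have jM' : j%:R + 1 <= M%:R :> R by rewrite natr1 ler_nat.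
  have j0 : 0 <= j%:R :> R by [].
  have d1 : 0 <= 1 - d by have := ler_wpM2r d0 jM'; have := mulr_ge0 j0 d0; lra.
  apply: le_trans (ler_wpM2l d1 (IH (ltnW jM))).
  move: (bpmf N p i) (pm0 i) => b b0.
  rewrite [leRHS]mulrA; apply: (ler_wpM2r b0); rewrite -natr1.
  have := mulr_ge0 j0 (sqr_ge0 d); clear; lra.
have tl : (M.+1%:R / 2) * bpmf N p i <= btail N p i.
  rewrite /btail (@binEE _ _ _ _ (i + (M.+1 + N))); last by clear; lia.
  rewrite -(big_mkord xpredT (fun l => bpmf N p l * (i <= l)%N%:R)).
  rewrite (@big_cat_nat _ _ _ i) ?leq_addr //=.
  rewrite -[leLHS]add0r; apply: lerD.
    by apply: sumr_ge0 => l _; rewrite mulr_ge0.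
  rewrite sum_nat_shift (@big_cat_nat _ _ _ M.+1) ?leq_addr //=.
  rewrite -[leLHS]addr0; apply: lerD; last by apply: sumr_ge0 => l _; rewrite mulr_ge0.
  have -> : M.+1%:R / 2 * bpmf N p i = \sum_(0 <= l < M.+1) (bpmf N p i / 2).
    by rewrite sumr_const_nat subn0 -mulr_natl; ring.
  rewrite !big_nat; apply: ler_sum => l /andP[_ lM].
  rewrite leq_addl mulr1 addnC; apply: le_trans (pw l lM).
  have lM' : l%:R <= M%:R :> R by rewrite ler_nat.
  rewrite mulrC; apply: ler_wpM2r => //.
  have := ler_wpM2r d0 lM'; lra.
have t0 : 0 <= btail N p i by rewrite -(binE_cst N p 0); apply: binE_le.
have h1 : y / 2 * bpmf N p i <= btail N p i.
  apply: le_trans tl; apply: ler_wpM2r => //; apply: ler_wpM2r; [lra|exact: ltW].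
rewrite -yE; have := ler_wpM2l (ltW us0) h1; nra.
Qed.

End Binomial2.

(** * Binomial tails and exponential moments of a single level *)

Section Binomial3.
Variable R : realType.
Implicit Types (p q t : R) (N i j : nat).

Lemma binE_expR N p (l : R) : 0 <= p <= 1 -> 0 <= l <= 1 / 3 ->
  binE N p (fun i => expR (l * (i%:R - N%:R * p))) <= expR (l ^+ 2 * (N%:R * p * (1 - p))).
Proof.
move=> p01 /andP[l0 l1]; have /andP[p0 p1] := p01.
have h (c : R) : binE N p (fun i => expR (l * i%:R + c))
    <= expR (l * (N%:R * p) + c + l ^+ 2 * (N%:R * p * (1 - p))).
  elim: N c => [|N IH] c /=; first by rewrite ler_expR; lra.
  rewrite (@binE_ext _ _ _ _ (fun i => expR (l * i%:R + (c + l)))); last first.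
    by move=> i; congr expR; rewrite -natr1; ring.
  apply: (@le_trans _ _ (expR (l * (N%:R * p) + l ^+ 2 * (N%:R * p * (1 - p))) *
      (p * expR (c + l) + (1 - p) * expR c))).
    rewrite mulrDr; apply: lerD; rewrite mulrCA -expRD; apply: ler_wpM2l; rewrite ?subr_ge0 //.
      by apply: le_trans (IH _) _; rewrite ler_expR; lra.
    by apply: le_trans (IH _) _; rewrite ler_expR; lra.
  have h2 := @two_point_expR R p (c + l) c l p01.
  apply: le_trans (ler_wpM2l (expR_ge0 _) (h2 _ l1)) _.
    by rewrite addrAC subrr add0r ger0_norm.
  rewrite -expRD ler_expR -natr1; lra.
apply: le_trans (_ : binE N p (fun i => expR (l * i%:R + - (l * (N%:R * p)))) <= _).
  by apply: binE_le => // i; rewrite mulrBr.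
by apply: le_trans (h _) _; rewrite ler_expR; lra.
Qed.

(** Chernoff's bound at the fixed tilt [1 / (3 s)]. Exponential rather than Gaussian decay is
    enough, as only a fourth power is extracted from it. *)
Lemma btail_expR N p i (s : R) : 0 <= p <= 1 -> 1 <= s ->
    s ^+ 2 = N%:R * p * (1 - p) ->
  btail N p i <= 2 * expR (- ((i%:R - N%:R * p) / s / 3)).
Proof.
move=> p01 s1 s2; set l := (3 * s)^-1.
have s0 : 0 < s by lra.
have l01 : 0 <= l <= 1 / 3.
  apply/andP; split; first by rewrite invr_ge0; lra.
  by rewrite /l -[1 / 3]invrK lef_pV2 ?posrE; lra.
apply: (@le_trans _ _ (binE N p (fun j => expR (- (l * (i%:R - N%:R * p))) *
    expR (l * (j%:R - N%:R * p)) + 0))).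
  apply: binE_le => // j; rewrite addr0 -expRD; case: leqP => ij; last exact: expR_ge0.
  rewrite -[leLHS]expR0 ler_expR -mulrN -mulrDr mulr_ge0 //; first by case/andP: l01.
  have : i%:R <= j%:R :> R by rewrite ler_nat.
  lra.
rewrite binE_lin binE_cst addr0 mulrC.
have -> : l * (i%:R - N%:R * p) = (i%:R - N%:R * p) / s / 3 by rewrite /l invfM; ring.
apply: ler_wpM2r; first exact: expR_ge0.
apply: le_trans (binE_expR _ p01 l01) _; rewrite -s2 -exprMn.
have -> : l * s = 1 / 3 by rewrite /l invfM -mulrA mulVf ?gt_eqF //; lra.
apply: le_trans (expR_le_quad _) _; last by lra.
by rewrite ger0_norm; lra.
Qed.

Lemma expRN_le_pow4 (t : R) : 0 < t -> t ^+ 4 * expR (- (t / 3)) <= 12 ^+ 4.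
Proof.
move=> t0; have h : t / 12 <= expR (t / 12).
  by apply: le_trans (expR_ge1Dx _); lra.
have e : expR (t / 3) = expR (t / 12) ^+ 4.
  by rewrite -expRM_natr; congr expR; lra.
have h4 : (t / 12) ^+ 4 <= expR (t / 3).
  by rewrite e lerXn2r // nnegrE ?expR_ge0 //; lra.
have t12 : t = 12 * (t / 12) by lra.
rewrite expRN ler_pdivrMr ?expR_gt0 // {1}t12 exprMn ler_pM2l //.
by rewrite exprn_gt0.
Qed.

(* The factor [r] trades the Gaussian correction [z] of the hazard rate against
   a polynomially small additive error. *)
Lemma bpmf_le_tail N p i (K r s : R) : 16 * 12 ^+ 4 <= K -> 0 < p < 1 -> 1 <= s ->
    s ^+ 2 = N%:R * p * (1 - p) -> 1 <= r ->
  bpmf N p i <= K / s * (r * btail N p i + (r ^+ 3)^-1).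
Proof.
move=> hK p01 s1 s2 r1; have s0 : 0 < s by lra.
have zg : 16 <= K.
  by apply: le_trans hK; rewrite ler_peMr // exprn_ege1 //; lra.
have p01w : 0 <= p <= 1 by case/andP: p01 => ? ?; apply/andP; lra.
have t0 : 0 <= btail N p i by rewrite -(binE_cst N p 0); apply: binE_le.
have ss0 : 0 < s ^+ 2 by rewrite exprn_gt0.
have ri : 0 <= (r ^+ 3)^-1 by rewrite invr_ge0 exprn_ge0 //; lra.
have rt : 0 <= r * btail N p i by rewrite mulr_ge0 //; lra.
(* Up to [r] deviations the hazard rate is at most [8 r / s]. At [t >= r] deviations it is at most
   [8 t / s], and the tail turns [t * t^3] into the constant [12^4], leaving [r^-3]. *)
have [h|h] := leP (i%:R - N%:R * p) (r * s).
  have rs0 : 0 <= r * s by rewrite mulr_ge0 //; lra.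
  have := bpmf_btail p01 s0 s2 rs0 h.
  rewrite -ler_pdivlMr // => /le_trans; apply.
  rewrite ler_pdivrMr //.
  have e (x : R) : K / s * x * s ^+ 2 = K * (s * x) by field; rewrite gt_eqF.
  rewrite e {e}.
  have : (r * s + s) * btail N p i <= 2 * (r * btail N p i) * s.
    have r10 : 0 <= r - 1 by lra.
    have := mulr_ge0 (mulr_ge0 r10 (ltW s0)) t0; clear; lra.
  set A := r * btail N p i in rt *; set B := btail N p i in t0 *.
  have : 0 <= A * s by rewrite mulr_ge0 // ltW.
  have : 0 <= (r ^+ 3)^-1 * s by rewrite mulr_ge0 // ltW.
  have : 0 <= (K - 16) * (A * s) by apply: mulr_ge0; rewrite ?subr_ge0 // mulr_ge0 // ltW.
  have : 0 <= K * ((r ^+ 3)^-1 * s).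
    by apply: mulr_ge0; [clear -zg; lra|rewrite mulr_ge0 // ltW].
  set V := (r ^+ 3)^-1; move=> h1 h2 h3 h4 h5.
  rewrite -mulrA; apply: (@le_trans _ _ (4 * (2 * A * s))); first by rewrite ler_pM2l.
  have -> : K * (s * (A + V)) = K * (A * s) + K * (V * s) by ring.
  clear -h1 h2 h4; lra.
set u := i%:R - N%:R * p in h *.
have u0 : 0 <= u by apply: le_trans (ltW h); rewrite mulr_ge0; lra.
have := bpmf_btail p01 s0 s2 u0 (lexx _).
rewrite -ler_pdivlMr // => /le_trans; apply.
have hu : s <= u by apply: le_trans (ltW h); rewrite ler_peMl //; lra.
set t := u / s; have ut : u = t * s by rewrite /t divfK // gt_eqF.
have rt' : r <= t by rewrite /t ler_pdivlMr // ltW.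
have tt0 : 0 < t by lra.
have hb := btail_expR i p01w s1 s2; rewrite -/u -/t in hb.
have h4 := expRN_le_pow4 tt0; set E := expR _ in hb h4.
apply: (@le_trans _ _ (8 * u * btail N p i / s ^+ 2)).
  by rewrite ler_pM2r ?invr_gt0 // ler_wpM2r //; lra.
apply: (@le_trans _ _ (K / s * (r ^+ 3)^-1)); last first.
  by rewrite ler_wpM2l ?lerDr // divr_ge0 //; lra.
have -> : 8 * u * btail N p i / s ^+ 2 = (8 * t * btail N p i) / s.
  by rewrite ut; field; rewrite gt_eqF.
rewrite [leRHS]mulrAC ler_pM2r ?invr_gt0 //.
have r3 : 0 < r ^+ 3 by rewrite exprn_gt0 //; lra.
rewrite ler_pdivlMr //.
have r3t : r ^+ 3 <= t ^+ 3 by rewrite lerXn2r // nnegrE; lra.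
have tb0 : 0 <= 8 * t * btail N p i.
  by apply: mulr_ge0 => //; apply: mulr_ge0 => //; exact: ltW.
apply: le_trans (ler_wpM2l tb0 r3t) _.
have -> : 8 * t * btail N p i * t ^+ 3 = 8 * t ^+ 4 * btail N p i by ring.
have t4 : 0 <= 8 * t ^+ 4 by apply: mulr_ge0 => //; apply: exprn_ge0; exact: ltW.
apply: le_trans (ler_wpM2l t4 hb) _.
have -> : 8 * t ^+ 4 * (2 * E) = 16 * (t ^+ 4 * E) by ring.
by apply: le_trans hK; rewrite ler_pM2l.
Qed.

Lemma expR1_lt4 : expR (1 : R) <= 7 / 2.
Proof.
have -> : expR (1 : R) = expR (1 / 3) ^+ 3 by rewrite -expRM_natr; congr expR; lra.
have h : expR (1 / 3 : R) <= 13 / 9.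
  by apply: le_trans (expR_le_quad _) _; [rewrite ger0_norm; lra|lra].
have := lerXn2r 3 (_ : expR (1 / 3 : R) \is Num.nneg) (_ : 13 / 9 \is Num.nneg) h.
rewrite !nnegrE => /(_ (expR_ge0 _)) h3; apply: le_trans (h3 _) _; lra.
Qed.

Lemma bpmfE N p i : bpmf N p i = binE N p (fun l => (l == i)%:R).
Proof.
rewrite (@binEE _ _ _ _ (N.+1 + i.+1)); last by lia.
have hi : (i < N.+1 + i.+1)%N by lia.
rewrite (bigD1 (Ordinal hi)) //= eqxx mulr1 big1 ?addr0 // => j /eqP hj.
case: eqP => [e|]; last by rewrite mulr0.
by case: hj; apply: val_inj.
Qed.

(** Meant for a vertex of degree [m + l] of which [m] is already known: occupying level [j] is paid
    for by [k] per vertex at or above it, plus [k']. Linearising gives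
    [exp (- k') (1 + 3 bpmf - (k / 2) btail)], and [k / 2 = 3 K r / s], [k' = 3 K r^-3 / s] are
    three times the coefficients of [bpmf_le_tail]. *)
Lemma binE_zone_up N p (K r s k k' : R) (m j : nat) : 16 * 12 ^+ 4 <= K -> 0 < p < 1 -> 1 <= s ->
    s ^+ 2 = N%:R * p * (1 - p) -> 1 <= r ->
    k = 6 * K * r / s -> k' = 3 * K * (r ^+ 3)^-1 / s -> k <= 1 / 3 ->
  binE N p (fun l => expR ((m + l == j)%N%:R - k * (j <= m + l)%N%:R - k')) <= 1.
Proof.
move=> hK p01 s1 s2 r1 ek ek' k3.
have K0 : 0 <= K by apply: le_trans hK; rewrite mulr_ge0 // exprn_ge0.
have p01w : 0 <= p <= 1 by case/andP: p01 => ? ?; apply/andP; lra.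
have s0 : 0 < s by lra.
have k0 : 0 <= k by rewrite ek divr_ge0 ?mulr_ge0 //; clear -s0 r1; lra.
have k'0 : 0 <= k'.
  by rewrite ek' divr_ge0 ?mulr_ge0 ?invr_ge0 ?exprn_ge0 //; clear -s0 r1; lra.
have [mj|mj] := ltnP j m.
  rewrite -[leRHS](binE_cst N p 1); apply: binE_le => // l.
  have e1 : (m + l == j)%N = false by clear -mj; lia.
  have e2 : (j <= m + l)%N = true by clear -mj; lia.
  rewrite e1 e2.
  by rewrite -[leRHS]expR0 ler_expR /=; lra.
set i := (j - m)%N.
apply: (@le_trans _ _ (binE N p (fun l => expR (- k') *
   (3 * (l == i)%:R + (- (k / 2) * (i <= l)%N%:R + 1)) + 0))).
  apply: binE_le => // l; rewrite addr0 addrC expRD; apply: ler_wpM2l; first exact: expR_ge0.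
  have -> : (m + l == j)%N = (l == i) by rewrite /i; clear -mj; apply/eqP/eqP; lia.
  have -> : (j <= m + l)%N = (i <= l)%N by rewrite /i; clear -mj; apply/idP/idP; lia.
  (* On the level itself [e <= 7/2] stays below [4 - k / 2]; above it [exp (- k) <= 1 - k / 2]. *)
  case: eqP => [->|_].
    rewrite leqnn /= !mulr1; apply: (@le_trans _ _ (expR 1)); first by rewrite ler_expR; lra.
    by apply: le_trans expR1_lt4 _; lra.
  case: leqP => _ /=; last by rewrite !mulr0 subr0 expR0; lra.
  rewrite mulr0 !mulr1 !add0r; apply: le_trans (expR_le_quad _) _.
    by rewrite normrN ger0_norm.
  by nra.
rewrite binE_lin binE_cst addr0 binE_lin binE_lin binE_cst -bpmfE -/(btail N p i).
have h := bpmf_le_tail i hK p01 s1 s2 r1.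
have h2 : 3 * bpmf N p i + (- (k / 2) * btail N p i + 1) <= 1 + k'.
  rewrite ek ek'; move: h; set B := bpmf _ _ _; set T := btail _ _ _.
  set v := (r ^+ 3)^-1 => h.
  have -> : 6 * K * r / s / 2 = 3 * (K / s * r) by field; rewrite gt_eqF.
  have -> : 3 * K * v / s = 3 * (K / s * v) by field; rewrite gt_eqF.
  move: h; rewrite mulrDr mulrA; lra.
apply: le_trans (ler_wpM2l (expR_ge0 _) h2) _.
apply: le_trans (ler_wpM2l (expR_ge0 _) (expR_ge1Dx _)) _.
by rewrite -expRD addNr expR0.
Qed.

(** Reversing [l -> N - l] exchanges the tails. Levels outside [[m, N + m]] are treated apart,
    because [N + m - j] is a truncated subtraction. *)
Lemma binE_zone_down N p (K r s k k' : R) (m j : nat) : 16 * 12 ^+ 4 <= K -> 0 < p < 1 -> 1 <= s ->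
    s ^+ 2 = N%:R * p * (1 - p) -> 1 <= r ->
    k = 6 * K * r / s -> k' = 3 * K * (r ^+ 3)^-1 / s -> k <= 1 / 3 ->
  binE N p (fun l => expR ((m + l == j)%N%:R - k * (m + l <= j)%N%:R - k')) <= 1.
Proof.
move=> hK p01 s1 s2 r1 ek ek' k3.
have K0 : 0 <= K by apply: le_trans hK; rewrite mulr_ge0 // exprn_ge0.
have p01w : 0 <= p <= 1 by case/andP: p01 => ? ?; apply/andP; lra.
have q01 : 0 < 1 - p < 1 by case/andP: p01 => ? ?; apply/andP; lra.
have s0 : 0 < s by lra.
have k0 : 0 <= k by rewrite ek divr_ge0 ?mulr_ge0 //; clear -s0 r1; lra.
have k'0 : 0 <= k'.
  by rewrite ek' divr_ge0 ?mulr_ge0 ?invr_ge0 ?exprn_ge0 //; clear -s0 r1; lra.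
have [mj|mj] := leqP m j; last first.
  rewrite -[leRHS](binE_cst N p 1); apply: binE_le => // l.
  have e1 : (m + l == j)%N = false by clear -mj; lia.
  have e2 : (m + l <= j)%N = false by clear -mj; lia.
  rewrite e1 e2.
  by rewrite -[leRHS]expR0 ler_expR /=; lra.
have [jN|jN] := ltnP (N + m) j.
  rewrite (@binE_ext_le _ _ _ _ (fun l => expR (- k - k'))); last first.
    move=> l lN; have e1 : (m + l == j)%N = false by clear -jN lN; lia.
    have e2 : (m + l <= j)%N = true by clear -jN lN; lia.
    rewrite e1 e2.
    by rewrite /= mulr1 sub0r.
  by rewrite binE_cst -[leRHS]expR0 ler_expR; lra.
have s2' : s ^+ 2 = N%:R * (1 - p) * (1 - (1 - p)) by rewrite s2; ring.
rewrite binE_rev; apply: le_trans (binE_zone_up 0 (N + m - j) hK q01 s1 s2' r1 ek ek' k3).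
rewrite le_eqVlt; apply/orP; left; apply/eqP; apply: binE_ext_le => l lN.
have e1 : (m + (N - l) == j)%N = (0 + l == N + m - j)%N.
  by clear -mj jN lN; apply/eqP/eqP; lia.
have e2 : (m + (N - l) <= j)%N = (N + m - j <= 0 + l)%N.
  by clear -mj jN lN; apply/idP/idP; lia.
by rewrite e1 e2.
Qed.

End Binomial3.

(** * Degrees in simple graphs *)

Section GraphDegrees.
Variable n : nat.
Implicit Types (E : {set {set 'I_n}}) (S : {set 'I_n}) (u v : 'I_n).

Lemma set2_inj u v v' : v != u -> v' != u -> [set u; v] = [set u; v'] -> v = v'.
Proof.
move=> vu v'u /setP /(_ v); rewrite !inE eqxx orbT (negbTE vu) /=.
by move/esym/eqP.
Qed.

Lemma degE E v : [forall e in E, #|e| == 2] ->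
  deg E v = #|[set u | (u != v) && ([set v; u] \in E)]|.
Proof.
move=> /forall_inP h2; rewrite /deg.
rewrite -(@card_in_imset _ _ (fun u => [set v; u])); last first.
  move=> u u'; rewrite !inE => /andP[h _] /andP[h' _]; exact: set2_inj.
apply: eq_card => e; rewrite inE; apply/andP/imsetP => [[eE ve]|[u]].
  have /eqP e2 := h2 e eE.
  have /cards2P[x [y [xy exy]]] : #|e| == 2 by rewrite e2.
  move: ve; rewrite exy !inE => /orP[/eqP vx|/eqP vy].
    by exists y; rewrite ?inE vx // eq_sym xy -exy.
  by exists x; rewrite ?inE vy ?xy setUC // -exy.
by rewrite inE => /andP[uv uE] ->; rewrite uE !inE eqxx.
Qed.

Lemma sum_deg E : [forall e in E, #|e| == 2] -> (\sum_v deg E v = 2 * #|E|)%N.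
Proof.
move=> /forall_inP h2; rewrite /deg.
under eq_bigr => v _ do rewrite -sum1_card.
under eq_bigr => v _ do under eq_bigl => e do rewrite inE.
rewrite (exchange_big_dep (mem E)) /=; last by move=> v e _ /andP[].
rewrite mulnC -sum_nat_const; apply: eq_bigr => e eE.
under eq_bigl => v do rewrite eE.
by rewrite sum1_card; apply/eqP; exact: h2.
Qed.

Lemma induced_all2 E S : [forall e in E, #|e| == 2] ->
  [forall e in induced E S, #|e| == 2].
Proof.
move=> /forall_inP h2; apply/forall_inP => e; rewrite inE => /andP[eE _]; exact: h2.
Qed.

End GraphDegrees.

(** * The random graph as a product measure on vertex pairs *)

Section Coordinates.
Variables (R : realType) (n : nat) (p : R).
Hypothesis p01 : 0 <= p <= 1.
Local Notation I := ('I_n * 'I_n)%type.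
Implicit Types (w : {set I}) (i : I) (u v : 'I_n).

(* The pair [(x, y)] with [x < y] is the coordinate of the edge [{x, y}]; the
   other pairs are never sampled. *)
Definition pe (i : I) : R := if (i.1 < i.2)%N then p else 0.

Definition eix u v : I := if (u < v)%N then (u, v) else (v, u).

Definition adj w u v := (u != v) && (eix u v \in w).

Definition dg w v : nat := \sum_u adj w v u.

Definition W w u v : R := if u == v then 0 else (adj w u v)%:R - p.

Definition enc (G : sgraph n) : {set I} :=
  [set i : I | (i.1 < i.2)%N && ([set i.1; i.2] \in edges G)].

Lemma pe01 i : 0 <= pe i <= 1.
Proof. by rewrite /pe; case: ifP => // _; rewrite lexx ler01. Qed.

Lemma eixC u v : u != v -> eix u v = eix v u.
Proof.
rewrite /eix => uv; case: ltngtP => // /val_inj e.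
by rewrite e eqxx in uv.
Qed.

Lemma eix_lt u v : u != v -> ((eix u v).1 < (eix u v).2)%N.
Proof.
rewrite /eix => uv; case: (ltnP u v) => h //=.
by rewrite ltn_neqAle h andbT; apply: contra_neq uv => /val_inj.
Qed.

Lemma adjC w u v : adj w u v = adj w v u.
Proof.
rewrite /adj eq_sym; case: (eqVneq v u) => //= vu.
by rewrite (eixC vu).
Qed.

Lemma WC w u v : W w u v = W w v u.
Proof. by rewrite /W eq_sym adjC. Qed.

Lemma adj_enc G u v : adj (enc G) u v = (u != v) && ([set u; v] \in edges G).
Proof.
rewrite /adj; case: eqVneq => //= uv; rewrite inE eix_lt //=.
by rewrite /eix; case: ifP => //= _; rewrite setUC.
Qed.

Lemma dg_enc G v : dg (enc G) v = deg (edges G) v.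
Proof.
rewrite degE; last exact: edgesP.
rewrite /dg -sum1_card big_mkcond [RHS]big_mkcond; apply: eq_bigr => u _ /=.
by rewrite inE adj_enc eq_sym; case: ifP; case: (_ && _).
Qed.

Lemma edge_coordP (e : {set 'I_n}) : #|e| == 2 ->
  exists2 i : I, (i.1 < i.2)%N & e = [set i.1; i.2].
Proof.
move=> /cards2P[x [y [xy ->]]]; exists (eix x y); first exact: eix_lt.
by rewrite /eix; case: ifP => //= _; rewrite setUC.
Qed.

Lemma bern_enc G : bern pe (enc G) = gnp p G.
Proof.
rewrite /bern /gnp (bigID (fun i : I => (i.1 < i.2)%N)) /=.
rewrite [X in _ * X]big1 ?mulr1; last first.
  by move=> i hi; rewrite inE (negbTE hi) /= /pe (negbTE hi) subr0.
pose D := [set i : I | (i.1 < i.2)%N].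
have injh : {in D &, injective (fun i : I => [set i.1; i.2])}.
  move=> [x y] [x' y']; rewrite !inE /= => xy xy' e.
  have hx : x \in [set x'; y'] by rewrite -e !inE eqxx.
  have hy : y \in [set x'; y'] by rewrite -e !inE eqxx orbT.
  move: hx hy xy; rewrite !inE => /orP[/eqP->|/eqP->] /orP[/eqP->|/eqP->] //.
  - by rewrite ltnn.
  - by move/ltn_trans => /(_ _ xy'); rewrite ltnn.
  - by rewrite ltnn.
transitivity (\prod_(e in [set [set i.1; i.2] | i in D])
   (if e \in edges G then p else 1 - p)).
  rewrite big_imset //=; apply: eq_big => i; first by rewrite inE.
  by move=> hi; rewrite inE hi /= /pe hi.
apply: eq_bigl => e; apply/imsetP/idP => [[i]|].
  rewrite inE => hi ->; rewrite cards2.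
  by rewrite (_ : i.1 != i.2) //; apply/eqP => ee; rewrite ee ltnn in hi.
by case/edge_coordP => i hi ->; exists i; rewrite ?inE.
Qed.

Lemma enc_inj : injective enc.
Proof.
move=> G G' h; apply: val_inj; apply/setP => e /=.
case: (boolP (#|e| == 2)) => he.
  have [i hi ->] := edge_coordP he.
  by have /setP /(_ i) := h; rewrite !inE hi.
have no (H : sgraph n) : (e \in edges H) = false.
  apply/negbTE/negP => eH; have /forall_inP /(_ e eH) := edgesP H.
  by rewrite (negbTE he).
by rewrite !no.
Qed.

Lemma dec_all2 w : [forall e in [set [set i.1; i.2] | i : I in w & (i.1 < i.2)%N], #|e| == 2].
Proof.
apply/forall_inP => e /imsetP[i]; rewrite inE => /andP[_ hi] ->; rewrite cards2.
by rewrite (_ : i.1 != i.2) //; apply/eqP => ee; rewrite ee ltnn in hi.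
Qed.

Definition dec w : sgraph n := SGraph (dec_all2 w).

Lemma enc_dec w : (forall i, i \in w -> (i.1 < i.2)%N) -> enc (dec w) = w.
Proof.
move=> h; apply/setP => i; rewrite inE; apply/andP/idP => [[hi]|iw].
  case/imsetP => j; rewrite inE => /andP[jw hj] e.
  have hx : i.1 \in [set j.1; j.2] by rewrite -e !inE eqxx.
  have hy : i.2 \in [set j.1; j.2] by rewrite -e !inE eqxx orbT.
  suff -> : i = j by [].
  case: i j hi jw hj e hx hy => [x y] [x' y'] /= hi jw hj _.
  rewrite !inE => /orP[/eqP ex|/eqP ex] /orP[/eqP ey|/eqP ey]; subst => //.
  - by rewrite ltnn in hi.
  - by have := ltn_trans hi hj; rewrite ltnn.
  - by rewrite ltnn in hi.
split; first exact: h.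
by apply/imsetP; exists i; rewrite // inE iw h.
Qed.

(** The expectation runs over all sets of pairs; those outside the image of [enc] contain some
    [(x, y)] with [y <= x], which has probability [0]. *)
Lemma Ex_gnp (f : {set I} -> R) : Ex pe f = \sum_(G : sgraph n) gnp p G * f (enc G).
Proof.
rewrite /Ex (bigID (mem (enc @: setT))) /= [X in _ + X]big1 ?addr0.
  rewrite big_imset /=; last by move=> x y _ _; exact: enc_inj.
  by apply: eq_big => G; rewrite ?inE // => _; rewrite bern_enc.
move=> w hw; have [i iw hi] : exists2 i, i \in w & ~~ (i.1 < i.2)%N.
  case: (boolP [exists i in w, ~~ (i.1 < i.2)%N]) => [/exists_inP //|].
  rewrite negb_exists_in => /forall_inP h; case/negP: hw.
  apply/imsetP; exists (dec w) => //; rewrite enc_dec // => i iw.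
  by have := h i iw; rewrite negbK.
by rewrite /bern (bigD1 i) //= iw /pe (negbTE hi) !mul0r.
Qed.

Lemma adjU i w u v : adj (i |: w) u v = ((u != v) && (eix u v == i)) || adj w u v.
Proof. by rewrite /adj in_setU1; case: (u != v). Qed.

Lemma adjD i w u v : adj (w :\ i) u v = adj w u v && (eix u v != i).
Proof. by rewrite /adj in_setD1; case: (u != v) => //=; rewrite andbC. Qed.

Lemma W_toggle i w u v :
  W (i |: w) u v - W (w :\ i) u v = ((u != v) && (eix u v == i))%:R.
Proof.
rewrite /W; case: eqVneq => [_|uv] /=; first by rewrite subr0.
rewrite adjU adjD uv /=; case: eqVneq => [_|_] /=; first by rewrite andbF /= mulr0n mulr1n; ring.
by rewrite andbT /= mulr0n; ring.
Qed.

Lemma eix_eq (u v x y : 'I_n) : u != v -> (x < y)%N ->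
  (eix u v == (x, y)) = ((u, v) == (x, y)) || ((u, v) == (y, x)).
Proof.
move=> uv xy; rewrite /eix; case: ltnP => h; rewrite !xpair_eqE.
  have -> : (u == y) && (v == x) = false; last by rewrite orbF.
  by apply/negbTE/negP => /andP[/eqP uy /eqP vx]; move: h; rewrite uy vx ltnNge ltnW.
have -> : (u == x) && (v == y) = false; last by rewrite orFb andbC.
by apply/negbTE/negP => /andP[/eqP ux /eqP vy]; move: h; rewrite ux vy leqNgt xy.
Qed.

Lemma Ex_adj u v : u != v -> Ex pe (fun w => (adj w u v)%:R) = p.
Proof.
move=> uv; rewrite -(Ex_avg pe (eix u v)) -[RHS](Ex_cst pe).
apply: Ex_eq => w; rewrite /avg adjU adjD eqxx uv /= andbF mulr1 mulr0 addr0.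
by rewrite /pe eix_lt.
Qed.

Lemma Ex_W u v : Ex pe (fun w => W w u v) = 0.
Proof.
rewrite /W; case: eqVneq => [_|uv]; first exact: Ex_cst.
by rewrite ExD Ex_adj // Ex_cst subrr.
Qed.

Definition lin (c : 'I_n -> 'I_n -> R) w : R := \sum_u \sum_v c u v * W w u v.

Lemma Ex_lin c : Ex pe (lin c) = 0.
Proof.
rewrite /lin Ex_sum big1 // => u _; rewrite Ex_sum big1 // => v _.
by rewrite ExZl Ex_W mulr0.
Qed.

Lemma lin_toggle c i w : lin c (i |: w) - lin c (w :\ i)
  = if (i.1 < i.2)%N then c i.1 i.2 + c i.2 i.1 else 0.
Proof.
rewrite /lin -sumrB; under eq_bigr => u _ do rewrite -sumrB.
under eq_bigr => u _ do under eq_bigr => v _ do rewrite -mulrBr W_toggle.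
rewrite pair_big /=; case: ifP => hi; last first.
  rewrite big1 // => -[u v] _ /=; case: (eqVneq u v) => uv; first by rewrite mulr0.
  case: eqP => [e|]; last by rewrite mulr0.
  by have := eix_lt uv; rewrite e hi.
case: i hi => x y /= xy; have xny : x != y by apply/eqP => e; rewrite e ltnn in xy.
rewrite (bigD1 (x, y)) //= (bigD1 (y, x)) /=; last by rewrite xpair_eqE negb_and eq_sym xny.
rewrite xny eix_eq // eqxx mulr1 eq_sym xny eix_eq 1?eq_sym // eqxx orbT mulr1.
rewrite big1 ?addr0 // => -[u v] /andP[h1 h2] /=; case: (eqVneq u v) => uv; first by rewrite mulr0.
by rewrite eix_eq // (negbTE h1) (negbTE h2) mulr0.
Qed.

(** Toggling [{u, v}] moves the statistic by [c u v + c v u], and [(a + b)^2 <= 2 (a^2 + b^2)] is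
    the origin of the factor [2]. *)
Lemma Ex_expR_lin c : (forall u v, `|c u v + c v u| <= 1 / 3) ->
  Ex pe (fun w => expR (lin c w))
    <= expR (2 * (p * (1 - p)) * \sum_u \sum_v c u v ^+ 2).
Proof.
move=> hc; have /andP[p0 p1] := p01.
pose b (i : I) : R := if (i.1 < i.2)%N then `|c i.1 i.2 + c i.2 i.1| else 0.
apply: le_trans (@Ex_expR_lip R _ pe pe01 (lin c) b _ _) _.
- by move=> i w; rewrite lin_toggle /b; case: ifP => // _; rewrite normr0.
- by move=> i; rewrite /b; case: ifP => // _; rewrite divr_ge0.
rewrite Ex_lin add0r ler_expR.
have pq : 0 <= p * (1 - p) by rewrite mulr_ge0 // subr_ge0.
pose S1 := \sum_(i : I) (if (i.1 < i.2)%N then c i.1 i.2 ^+ 2 else 0).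
pose S2 := \sum_(i : I) (if (i.1 < i.2)%N then c i.2 i.1 ^+ 2 else 0).
apply: (@le_trans _ _ (2 * (p * (1 - p)) * (S1 + S2))).
  rewrite /S1 /S2 -big_split mulr_sumr; apply: ler_sum => i _ /=.
  rewrite /b /pe; case: ifP => _; last by rewrite mul0r mul0r addr0 mulr0.
  rewrite real_normK ?num_real //.
  have : 0 <= p * (1 - p) * (c i.1 i.2 - c i.2 i.1) ^+ 2 by rewrite mulr_ge0 ?sqr_ge0.
  by rewrite -subr_ge0 => h; rewrite -subr_ge0; apply: le_trans h _; rewrite le_eqVlt;
     apply/orP; left; apply/eqP; ring.
apply: ler_wpM2l; first by rewrite mulr_ge0.
have -> : S2 = \sum_(i : I) (if (i.2 < i.1)%N then c i.1 i.2 ^+ 2 else 0).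
  rewrite /S2 (reindex_inj (inv_inj (f := fun i : I => (i.2, i.1)) _)) //.
  by case.
rewrite pair_big /S1 -big_split /=; apply: ler_sum => i _.
have := sqr_ge0 (c i.1 i.2).
by case: ltngtP => _ /=; rewrite ?addr0 ?add0r.
Qed.

End Coordinates.

(** * Commuting switchings that preserve the degrees and the measure *)

Section Swap.
Variables (R : realType) (n : nat) (p : R).
Hypothesis p01 : 0 <= p <= 1.
Local Notation I := ('I_n * 'I_n)%type.
Local Notation pe := (@pe R n p).
Implicit Types (w : {set I}) (u v a b c d : 'I_n).

(** If exactly one of [x], [y] is present, toggling both amounts to applying their transposition,
    under which equal marginals are invariant. *)
Lemma bern_toggle2 w (x y : I) : pe x = pe y -> (x \in w) != (y \in w) ->
  bern pe [set i | (i \in w) (+) ((i == x) || (i == y))] = bern pe w.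
Proof.
move=> exy hxy.
have e i : (i \in w) (+) ((i == x) || (i == y)) = (tperm x y i \in w).
  case: tpermP => [->|->|/eqP hx /eqP hy].
  - by rewrite eqxx addbT; move: hxy; case: (x \in w); case: (y \in w).
  - by rewrite eqxx orbT addbT; move: hxy; case: (x \in w); case: (y \in w).
  - by rewrite (negbTE hx) (negbTE hy) addbF.
rewrite /bern [RHS](reindex_inj (@perm_inj _ (tperm x y))) /=.
apply: eq_bigr => i _; rewrite inE e; case: tpermP => // ->; by rewrite exy.
Qed.

Lemma eix_eq2 u v x y : u != v -> x != y ->
  (eix u v == eix x y) = ((u, v) == (x, y)) || ((u, v) == (y, x)).
Proof.
move=> uv xy; have h := eix_lt xy.
case E : (eix x y) h => [x' y'] /= h; rewrite eix_eq //.
move: E; rewrite /eix; case: ifP => _ [<- <-] //; by rewrite orbC.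
Qed.

Lemma sum_toggle2 (f : 'I_n -> bool) (c d : 'I_n) : f c != f d ->
  (\sum_u (f u (+) ((u == c) || (u == d))) = \sum_u f u)%N.
Proof.
move=> hcd; rewrite [RHS](reindex_inj (@perm_inj _ (tperm c d))) /=.
apply: eq_bigr => u _; congr nat_of_bool.
case: tpermP => [->|->|/eqP hx /eqP hy].
- by rewrite eqxx addbT; move: hcd; case: (f c); case: (f d).
- by rewrite eqxx orbT addbT; move: hcd; case: (f c); case: (f d).
- by rewrite (negbTE hx) (negbTE hy) addbF.
Qed.

(** The degree sequence as a finite function, so that a degree-determined quantity is literally a
    function of [dgf w]. *)
Definition dgf w : {ffun 'I_n -> nat} := [ffun v => dg w v].

Section Blocks.
Variables (chi : {set 'I_n}) (h M g : nat).

(* A block is a pair of rows [a < b] in [chi] matched by [a + b = h] modulo [n]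
   and a pair of columns [c < d] outside [chi] on which the two rows disagree,
   matched by the condition that their ranks sum to [g] modulo [M].  All these
   data are unchanged by the switching of any active block. *)
Definition blk := (('I_n * 'I_n) * ('I_n * 'I_n))%type.

Definition Dset w (a b : 'I_n) :=
  [set c | (c \notin chi) && (adj w a c != adj w b c)].

Definition rk w (a b c : 'I_n) := #|[set c' in Dset w a b | (c' < c)%N]|.

Definition elig (a b c d : 'I_n) :=
  [&& (a < b)%N, a \in chi, b \in chi, (c < d)%N & (a + b) %% n == h]%N.

Definition act w (x : blk) :=
  let: ((a, b), (c, d)) := x in
  [&& elig a b c d, c \in Dset w a b, d \in Dset w a b, (#|Dset w a b| <= M)%N,
      (rk w a b c + rk w a b d) %% M == g & adj w a c != adj w a d]%N.

(** An active block is in one of two alternating states, [ac], [bd] present or [ad], [bc] present;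
    the sign tells which. *)
Definition sgn w (x : blk) : R :=
  if act w x then (if adj w x.1.1 x.2.1 then 1 else -1) else 0.

Definition quad (x : blk) : {set I} :=
  [set i | [|| i == eix x.1.1 x.2.1, i == eix x.1.2 x.2.1,
               i == eix x.1.1 x.2.2 | i == eix x.1.2 x.2.2]].

Definition flip (x : blk) w : {set I} :=
  [set i | (i \in w) (+) (act w x && (i \in quad x))].

Lemma rk_lt w a b c : c \in Dset w a b -> (rk w a b c < #|Dset w a b|)%N.
Proof.
move=> cD; apply: proper_card; apply/properP; split.
  by apply/subsetP => x; rewrite inE => /andP[].
by exists c => //; rewrite inE ltnn andbF.
Qed.

Lemma rk_mono w a b c d : c \in Dset w a b -> (c < d)%N -> (rk w a b c < rk w a b d)%N.
Proof.
move=> cD cd; apply: proper_card; apply/properP; split.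
  apply/subsetP => x; rewrite !(inE, in_setI) => /andP[-> xc] /=; exact: ltn_trans xc cd.
by exists c; rewrite !inE ?ltnn ?andbF //; move: cD; rewrite inE => ->.
Qed.

Lemma rk_inj w a b c d : c \in Dset w a b -> d \in Dset w a b ->
  rk w a b c = rk w a b d -> c = d.
Proof.
move=> cD dD e; apply: val_inj; case: (ltngtP c d) => // lt.
  by have := rk_mono cD lt; rewrite e ltnn.
by have := rk_mono dD lt; rewrite e ltnn.
Qed.

(** Ranks are below [M], so a rank sum modulo [M] determines the partner of a column. Hence blocks
    on the same two rows have equal or disjoint column pairs. *)
Lemma rk_match w a b c d d' : (#|Dset w a b| <= M)%N ->
    c \in Dset w a b -> d \in Dset w a b -> d' \in Dset w a b ->
    ((rk w a b c + rk w a b d) %% M == g)%N -> ((rk w a b c + rk w a b d') %% M == g)%N ->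
  d = d'.
Proof.
move=> hM cD dD d'D /eqP <- /eqP e.
have l1 := leq_trans (rk_lt dD) hM; have l2 := leq_trans (rk_lt d'D) hM.
apply: rk_inj dD d'D _.
move/eqP: e; by rewrite eqn_modDl !modn_small // => /eqP.
Qed.

Lemma row_match (a b b' : 'I_n) : ((a + b) %% n == h)%N -> ((a + b') %% n == h)%N -> b = b'.
Proof.
move=> /eqP <- /eqP e; apply: val_inj; move/eqP: e.
by rewrite eqn_modDl !modn_small // => /eqP.
Qed.

Section Flip.
Variables (w : {set I}) (a b c d : 'I_n).
Let x : blk := ((a, b), (c, d)).
Hypothesis ax : act w x.

Let eab : elig a b c d. Proof. by case/and5P: ax. Qed.
Let ab : (a < b)%N. Proof. by case/and5P: eab. Qed.
Let aX : a \in chi. Proof. by case/and5P: eab. Qed.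
Let bX : b \in chi. Proof. by case/and5P: eab. Qed.
Let cd : (c < d)%N. Proof. by case/and5P: eab. Qed.
Let mab : ((a + b) %% n == h)%N. Proof. by case/and5P: eab. Qed.
Let cD : c \in Dset w a b. Proof. by case/and5P: ax. Qed.
Let dD : d \in Dset w a b. Proof. by case/and5P: ax. Qed.
Let hM : (#|Dset w a b| <= M)%N. Proof. by case/and5P: ax. Qed.
Let rkg : ((rk w a b c + rk w a b d) %% M == g)%N.
Proof. by case/and5P: ax => _ _ _ _ /andP[]. Qed.
Let acd : adj w a c != adj w a d.
Proof. by case/and5P: ax => _ _ _ _ /andP[]. Qed.
Let cX : c \notin chi. Proof. by move: cD; rewrite inE => /andP[]. Qed.
Let dX : d \notin chi. Proof. by move: dD; rewrite inE => /andP[]. Qed.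
Let abc : adj w a c != adj w b c. Proof. by move: cD; rewrite inE => /andP[]. Qed.
Let abd : adj w a d != adj w b d. Proof. by move: dD; rewrite inE => /andP[]. Qed.

Let neq (s t : 'I_n) : s \in chi -> t \notin chi -> s != t.
Proof. by move=> hs; apply: contraNneq => <-. Qed.
Let neq' (s t : 'I_n) : s \in chi -> t \notin chi -> (t == s) = false.
Proof. by move=> hs ht; rewrite eq_sym; apply/negbTE/neq. Qed.
Let neqf (s t : 'I_n) : s \in chi -> t \notin chi -> (s == t) = false.
Proof. by move=> hs ht; apply/negbTE/neq. Qed.

Definition Qp u v := ((u == a) || (u == b)) && ((v == c) || (v == d))
                  || ((v == a) || (v == b)) && ((u == c) || (u == d)).

Lemma quadE u v : u != v -> (eix u v \in quad x) = Qp u v.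
Proof.
move=> uv; rewrite inE /= !eix_eq2 // ?neq // !xpair_eqE /Qp.
case: (u == a); case: (u == b); case: (u == c); case: (u == d);
by case: (v == a); case: (v == b); case: (v == c); case: (v == d).
Qed.

Lemma adj_flip u v : adj (flip x w) u v = adj w u v (+) Qp u v.
Proof.
rewrite /adj; case: (eqVneq u v) => [<-|uv] /=; last by rewrite inE ax quadE.
rewrite /Qp /=.
case: (eqVneq u a) => [->|_] /=; first by rewrite !neqf ?andbF.
case: (eqVneq u b) => [->|_] //=; first by rewrite !neqf ?andbF.
Qed.

Lemma adj_flip_row u v : u \in chi -> v \notin chi ->
  adj (flip x w) u v = adj w u v (+) (((u == a) || (u == b)) && ((v == c) || (v == d))).
Proof.
move=> uX vX; rewrite adj_flip /Qp; congr (_ (+) _).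
by rewrite [X in _ || X](_ : _ = false) ?orbF // !(neq' _ vX).
Qed.

(** The switching is two transpositions: of [ac] with [bc], then of [ad] with [bd]. Both apply
    because the rows [a] and [b] disagree in columns [c] and [d]. *)
Lemma bern_flip : bern pe (flip x w) = bern pe w.
Proof.
have peE (s t : 'I_n) : s \in chi -> t \notin chi -> pe (eix s t) = p.
  by move=> hs ht; rewrite /pe eix_lt // neq.
have mem (s t : 'I_n) : s \in chi -> t \notin chi -> (eix s t \in w) = adj w s t.
  by move=> hs ht; rewrite /adj neq.
have ba : b == a = false by apply/negbTE/eqP => e; move: ab; rewrite e ltnn.
have dc : d == c = false by apply/negbTE/eqP => e; move: cd; rewrite e ltnn.
have x13 : eix a c == eix a d = false.
  by rewrite eix_eq2 ?neq // !xpair_eqE (eq_sym c d) dc andbF (neqf aX dX).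
have x14 : eix a c == eix b d = false.
  by rewrite eix_eq2 ?neq // !xpair_eqE (eq_sym a b) ba (neqf aX dX).
have x23 : eix b c == eix a d = false.
  by rewrite eix_eq2 ?neq // !xpair_eqE ba (neqf bX dX).
have x24 : eix b c == eix b d = false.
  by rewrite eix_eq2 ?neq // !xpair_eqE (eq_sym c d) dc andbF (neqf bX dX).
pose w1 := [set i | (i \in w) (+) ((i == eix a c) || (i == eix b c))].
have -> : flip x w = [set i | (i \in w1) (+) ((i == eix a d) || (i == eix b d))].
  apply/setP => i; rewrite !inE ax /= -addbA; congr (_ (+) _).
  case: (eqVneq i (eix a c)) => [->|_] /=; first by rewrite x13 x14.
  by case: (eqVneq i (eix b c)) => [->|_] //=; rewrite x23 x24.
rewrite !bern_toggle2 ?peE // ?inE ?mem //.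
by rewrite (eq_sym (eix a d)) x13 (eq_sym (eix a d)) x23 (eq_sym (eix b d)) x14
  (eq_sym (eix b d)) x24 !addbF.
Qed.

Lemma dg_flip v : dg (flip x w) v = dg w v.
Proof.
rewrite /dg; under eq_bigr => u _ do rewrite adj_flip.
have cdf : d == c = false by apply/negbTE/eqP => e; move: cd; rewrite e ltnn.
have [va|va] := boolP ((v == a) || (v == b)).
  have vX : v \in chi by case/orP: va => /eqP ->.
  under eq_bigr => u _ do rewrite /Qp va (neqf vX cX) (neqf vX dX) andbF orbF andTb.
  by apply: sum_toggle2; case/orP: va => /eqP ->; rewrite // -(inj_eq negb_inj);
    move: acd abc abd; do 4 case: (adj _ _ _).
have [vc|vc] := boolP ((v == c) || (v == d)).
  have vX : v \notin chi by case/orP: vc => /eqP ->.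
  under eq_bigr => u _ do rewrite /Qp (negbTE va) vc andFb andbT orFb.
  by apply: sum_toggle2; case/orP: vc => /eqP ->; rewrite !(adjC _ _ a) !(adjC _ _ b).
by apply: eq_bigr => u _; rewrite /Qp (negbTE va) (negbTE vc) andbF addbF.
Qed.

Lemma row_pair (a' b' : 'I_n) : (a' < b')%N -> ((a' + b') %% n == h)%N ->
  ((a' == a) || (a' == b) = ((b' == a) || (b' == b))) /\
  ((a' == a) || (a' == b) -> a' = a /\ b' = b).
Proof.
move=> ab' m'.
have k1 : a' = a -> b' = b.
  by move=> e; move: m'; rewrite e => m'; exact: (row_match m' mab).
have k2 : a' != b.
  apply/eqP => e; move: m'; rewrite e addnC => m'.
  have m2 : ((b + a) %% n == h)%N by rewrite addnC.
  have e2 : b' = a by apply: (row_match _ m2); rewrite addnC.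
  by move: ab'; rewrite e e2 ltnNge ltnW.
have k3 : b' = b -> a' = a.
  move=> e; move: m'; rewrite e addnC => m'.
  have m2 : ((b + a) %% n == h)%N by rewrite addnC.
  exact: (row_match m' m2).
have k4 : b' != a.
  apply/eqP => e; move: m'; rewrite e addnC => m'.
  have e2 : a' = b by exact: (row_match m' mab).
  by rewrite e2 eqxx in k2.
rewrite (negbTE k2) (negbTE k4) orbF /=; split.
  by apply/eqP/eqP => [/k1|/k3].
by move=> /eqP e; split => //; exact: k1.
Qed.

(** A matched pair of rows is either the switched pair or disjoint from it, so both rows are toggled
    in the same columns and their disagreements persist. *)
Lemma Dset_flip (a' b' : 'I_n) : (a' < b')%N -> a' \in chi -> b' \in chi ->
  ((a' + b') %% n == h)%N -> Dset (flip x w) a' b' = Dset w a' b'.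
Proof.
move=> ab' a'X b'X m'; apply/setP => y; rewrite !inE.
case: (boolP (y \in chi)) => //= yX; rewrite !adj_flip_row // (row_pair ab' m').1.
by case: (_ && _); case: (adj w a' y); case: (adj w b' y).
Qed.

Lemma act_match y : act w y -> (y.1.1 == a) || (y.1.1 == b) ->
  (y.2.1 == c) || (y.2.1 == d) = ((y.2.2 == c) || (y.2.2 == d)) /\
  ((y.2.1 == c) || (y.2.1 == d) -> y = x).
Proof.
case: y => [[a' b'] [c' d']] /and5P[/and5P[ab' _ _ cd' m'] c'D d'D _ /andP[rg _]] /= ra.
have [ea eb] := (row_pair ab' m').2 ra; subst a' b'.
have rg2 : ((rk w a b d + rk w a b c) %% M == g)%N by rewrite addnC.
have rg' : ((rk w a b d' + rk w a b c') %% M == g)%N by rewrite addnC.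
have k1 : c' = c -> d' = d by move=> e; subst c'; exact: (rk_match hM cD d'D dD rg rkg).
have k2 : c' != d.
  apply/eqP => e; subst c'; have e2 := rk_match hM dD d'D cD rg rg2.
  by move: cd'; rewrite e2 ltnNge ltnW.
have k3 : d' = d -> c' = c by move=> e; subst d'; exact: (rk_match hM dD c'D cD rg' rg2).
have k4 : d' != c.
  apply/eqP => e; subst d'; have e2 := rk_match hM cD c'D dD rg' rkg.
  by rewrite e2 eqxx in k2.
rewrite (negbTE k2) (negbTE k4) orbF /=; split; first by apply/eqP/eqP => [/k1|/k3].
by move=> /eqP e; rewrite /x (k1 e) e.
Qed.

(** Switching toggles matched rows together and matched columns together, so every condition in
    [act], a comparison of two such entries or a rank, is unaffected. The set of active blocks is
    thus constant along switchings, and these commute. *)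
Lemma act_flip y : act (flip x w) y = act w y.
Proof.
case: y => [[a' b'] [c' d']]; rewrite /act.
case: (boolP (elig a' b' c' d')) => //= /and5P[ab' a'X b'X cd' m'].
rewrite /rk (Dset_flip ab' a'X b'X m').
case: (boolP (c' \in _)) => //= c'D; case: (boolP (d' \in _)) => //= d'D.
case: (boolP (_ <= M)%N) => //= hM'; case: (boolP (_ == g)) => //= rg'.
have c'X : c' \notin chi by move: c'D; rewrite inE => /andP[].
have d'X : d' \notin chi by move: d'D; rewrite inE => /andP[].
rewrite !adj_flip_row //.
have [ra|ra] := boolP ((a' == a) || (a' == b)); last by rewrite /= !addbF.
have [ea eb] := (row_pair ab' m').2 ra; subst a' b'.
have rg2 : ((rk w a b d + rk w a b c) %% M == g)%N by rewrite addnC.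
have rg3 : ((rk w a b d' + rk w a b c') %% M == g)%N by rewrite addnC.
have k1 : c' = c -> d' = d by move=> e; subst c'; exact: (rk_match hM cD d'D dD rg' rkg).
have k2 : c' != d.
  apply/eqP => e; subst c'; have e2 := rk_match hM dD d'D cD rg' rg2.
  by move: cd'; rewrite e2 ltnNge ltnW.
have k3 : d' = d -> c' = c by move=> e; subst d'; exact: (rk_match hM dD c'D cD rg3 rg2).
have k4 : d' != c.
  apply/eqP => e; subst d'; have e2 := rk_match hM cD c'D dD rg3 rkg.
  by rewrite e2 eqxx in k2.
rewrite (negbTE k2) (negbTE k4) orbF /=.
have -> : (c' == c) = (d' == d) by apply/eqP/eqP => [/k1|/k3].
by case: (d' == d); case: (adj w a c'); case: (adj w a d').
Qed.

Lemma sgn_flip y : sgn (flip x w) y = if y == x then - sgn w x else sgn w y.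
Proof.
rewrite /sgn act_flip ax; case: (boolP (act w y)) => ay; last first.
  case: eqP => // e; by move: ay; rewrite e ax.
have := act_match ay.
case: y ay => [[a' b'] [c' d']] /= /and5P[/and5P[ab' a'X _ _ _] c'D _ _ _] hm.
have c'X : c' \notin chi by move: c'D; rewrite inE => /andP[].
rewrite adj_flip_row //.
have [e|ne] := eqVneq ((a', b'), (c', d')) x.
  case: e => e1 e2 e3 e4; rewrite e1 e3 !eqxx /= addbT.
  by case: (adj w a c); rewrite /= ?opprK.
case: (boolP ((a' == a) || (a' == b))) hm => ra hm; last by rewrite /= addbF.
case: (boolP ((c' == c) || (c' == d))) hm => rc hm; last by rewrite /= addbF.
by case/eqP: ne; case: (hm isT) => _; apply.
Qed.

Lemma flipK_act : flip x (flip x w) = w.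
Proof.
by apply/setP => i; rewrite !inE act_flip ax /= -addbA addbb addbF.
Qed.

End Flip.

Lemma flip_inact x w : ~~ act w x -> flip x w = w.
Proof. by move=> na; apply/setP => i; rewrite inE (negbTE na) addbF. Qed.

Lemma flipK x : involutive (flip x).
Proof.
move=> w; case: (boolP (act w x)) => ax; last by rewrite !flip_inact.
by case: x ax => [[a b] [c d]] ax; exact: flipK_act.
Qed.

Lemma Ex_flip x (F : {set I} -> R) : Ex pe (fun w => F (flip x w)) = Ex pe F.
Proof.
rewrite /Ex [RHS](reindex_inj (inv_inj (flipK x))) /=; apply: eq_bigr => w _.
congr (_ * _); case: (boolP (act w x)) => ax; last by rewrite flip_inact.
by case: x ax => [[a b] [c d]] ax; rewrite bern_flip.
Qed.

Lemma dgf_flip x w : dgf (flip x w) = dgf w.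
Proof.
apply/ffunP => v; rewrite !ffunE; case: (boolP (act w x)) => ax; last by rewrite flip_inact.
by case: x ax => [[a b] [c d]] ax; rewrite dg_flip.
Qed.

Lemma sgn_flip_neq x y w : y != x -> sgn (flip x w) y = sgn w y.
Proof.
move=> yx; case: (boolP (act w x)) => ax; last by rewrite flip_inact.
by case: x ax yx => [[a b] [c d]] ax yx; rewrite sgn_flip // (negbTE yx).
Qed.

Lemma sgn_flip_eq x w : sgn (flip x w) x = - sgn w x.
Proof.
case: (boolP (act w x)) => ax; last by rewrite flip_inact // /sgn (negbTE ax) oppr0.
by case: x ax => [[a b] [c d]] ax; rewrite sgn_flip // eqxx.
Qed.

Lemma cosh_le (t : R) : `|t| <= 1 / 3 -> expR t + expR (- t) <= 2 * expR (t ^+ 2).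
Proof.
move=> ht; have h1 := expR_le_quad ht.
have h2 : expR (- t) <= 1 + - t + (- t) ^+ 2 by apply: expR_le_quad; rewrite normrN.
have h3 := expR_ge1Dx (t ^+ 2); rewrite sqrrN in h2.
apply: le_trans (lerD h1 h2) _.
have : 2 * (1 + t ^+ 2) <= 2 * expR (t ^+ 2) by rewrite ler_pM2l.
lra.
Qed.

Lemma sgn_le1 w x : `|sgn w x| <= 1.
Proof. by rewrite /sgn; case: ifP => _; [case: ifP => _|]; rewrite ?normrN ?normr1 ?normr0. Qed.

(** Given the degrees, the signs behave like independent symmetric ones. Averaging over the
    switching of [x] fixes all other factors and replaces [exp y] by [cosh y <= exp (y^2)], which
    the subtracted square compensates. *)
Lemma swap_seq (s : seq blk) (H : {ffun 'I_n -> nat} -> R)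
    (t : blk -> {ffun 'I_n -> nat} -> R) : uniq s ->
    (forall f, 0 <= H f) -> (forall x f, `|t x f| <= 1 / 3) ->
  Ex pe (fun w => H (dgf w) * expR (\sum_(x <- s)
     (t x (dgf w) * sgn w x - (t x (dgf w) * sgn w x) ^+ 2))) <= Ex pe (fun w => H (dgf w)).
Proof.
move=> us H0 ht; elim: s us => [|x s IH] /=.
  by move=> _; apply: Ex_le; [exact: pe01|] => w; rewrite big_nil expR0 mulr1.
move=> /andP[xs us]; apply: le_trans (IH us).
set F := fun w => H (dgf w) * expR (\sum_(y <- s)
     (t y (dgf w) * sgn w y - (t y (dgf w) * sgn w y) ^+ 2)).
pose y w := t x (dgf w) * sgn w x.
have F0 w : 0 <= F w by rewrite mulr_ge0 ?expR_ge0.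
have -> : Ex pe (fun w => H (dgf w) * expR (\sum_(x <- x :: s)
     (t x (dgf w) * sgn w x - (t x (dgf w) * sgn w x) ^+ 2)))
   = Ex pe (fun w => F w * expR (y w - y w ^+ 2)).
  apply: Ex_eq => w; rewrite big_cons addrC expRD /F mulrA -/(y w).
  by [].
have Ff w : F (flip x w) = F w.
  rewrite /F dgf_flip; congr (_ * expR _); apply: eq_big_seq => z zs.
  by rewrite sgn_flip_neq //; apply: contraNneq xs => <-.
have yf w : y (flip x w) = - y w by rewrite /y dgf_flip sgn_flip_eq mulrN.
set G := fun w => F w * expR (y w - y w ^+ 2).
have e : Ex pe G = Ex pe (fun w => F w * expR (- y w - y w ^+ 2)).
  by rewrite -(Ex_flip x); apply: Ex_eq => w; rewrite /G Ff yf sqrrN.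
have -> : Ex pe G = 2^-1 * (Ex pe G + Ex pe (fun w => F w * expR (- y w - y w ^+ 2))).
  by rewrite -e; lra.
rewrite -ExD -ExZl; apply: Ex_le; first exact: pe01.
move=> w; rewrite /G -mulrDr mulrCA -[leRHS]mulr1; apply: ler_wpM2l => //.
rewrite !expRD -mulrDl (expRN (y w ^+ 2)).
have hy : `|y w| <= 1 / 3.
  rewrite /y normrM; apply: le_trans (ler_piMr _ (sgn_le1 _ _)) (ht _ _).
  exact: normr_ge0.
have := cosh_le hy; have ep := expR_gt0 (y w ^+ 2).
rewrite -ler_pdivrMr // => h1.
rewrite mulrC -ler_pdivlMr ?invr_gt0 // invrK mul1r.
by [].
Qed.

End Blocks.
End Swap.

(** * Summing the switching indicator over all quadruples *)

Section SwitchPolynomial.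
Variables (R : realType) (n : nat) (p : R).
Hypothesis p01 : 0 <= p <= 1.
Implicit Types (w : 'I_n -> 'I_n -> R) (f g : 'I_n -> R).

Lemma sum_ord_cst (x : R) : \sum_(i < n) x = n%:R * x.
Proof. by rewrite sumr_const card_ord mulr_natl. Qed.

Section Matrix.
Variable w : 'I_n -> 'I_n -> R.
Hypothesis wC : forall u v, w u v = w v u.

Definition mulv f (a : 'I_n) : R := \sum_c w a c * f c.
Definition form f g : R := \sum_a \sum_c f a * g c * w a c.
Definition one : 'I_n -> R := fun=> 1.

Lemma formE f g : form f g = \sum_a f a * mulv g a.
Proof.
apply: eq_bigr => a _; rewrite /mulv mulr_sumr; apply: eq_bigr => c _; ring.
Qed.

(** The bilinear form at [f] and [g] with their means subtracted, expanded. *)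
Definition cform f g : R := form f g - (\sum_c g c) / n%:R * form f one
  - (\sum_c f c) / n%:R * form g one
  + (\sum_c f c) * (\sum_c g c) / n%:R ^+ 2 * form one one.

(** With [w = adj - p], the difference of the indicators of the two alternating states. As a
    polynomial it can be summed over all quadruples, coincident ones included. *)
Definition swp (a b c d : 'I_n) : R :=
  (p + w a c) * (p + w b d) * (1 - p - w a d) * (1 - p - w b c)
  - (p + w a d) * (p + w b c) * (1 - p - w a c) * (1 - p - w b d).

Definition sum4 (F : 'I_n -> 'I_n -> 'I_n -> 'I_n -> R) : R :=
  \sum_a \sum_b \sum_c \sum_d F a b c d.

Lemma sum4D F G : sum4 (fun a b c d => F a b c d + G a b c d) = sum4 F + sum4 G.
Proof.
rewrite /sum4 -big_split; apply: eq_bigr => a _ /=; rewrite -big_split.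
apply: eq_bigr => b _ /=; rewrite -big_split; apply: eq_bigr => c _ /=.
by rewrite big_split.
Qed.

Lemma sum4Z (k : R) F : sum4 (fun a b c d => k * F a b c d) = k * sum4 F.
Proof.
rewrite /sum4 mulr_sumr; apply: eq_bigr => a _; rewrite mulr_sumr.
apply: eq_bigr => b _; rewrite mulr_sumr; apply: eq_bigr => c _.
by rewrite mulr_sumr.
Qed.

Lemma eq_sum4 F G : (forall a b c d, F a b c d = G a b c d) -> sum4 F = sum4 G.
Proof.
move=> h; apply: eq_bigr => a _; apply: eq_bigr => b _; apply: eq_bigr => c _.
by apply: eq_bigr => d _.
Qed.

(** The quartic terms cancel; the linear part is the one that carries the signal [p (1 - p)]. *)
Lemma swpE a b c d : swp a b c d =
  p * (1 - p) * (w a c + w b d - w a d - w b c)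
  + ((1 - 2 * p) * (w a c * w b d - w a d * w b c)
  + (- (w a c * w b d * w a d) - w a c * w b d * w b c
     + w a d * w b c * w a c + w a d * w b c * w b d)).
Proof. by rewrite /swp; ring. Qed.

Variable Lam : R.
Hypothesis Lam0 : 0 <= Lam.

Definition l1bound f := \sum_a `|mulv f a| <= Lam.

Lemma form_le f g : (forall a, `|f a| <= 1) -> l1bound g -> `|form f g| <= Lam.
Proof.
move=> hf hg; rewrite formE; apply: le_trans (ler_norm_sum _ _ _) _.
apply: le_trans hg; apply: ler_sum => a _; rewrite normrM.
by apply: ler_piMl.
Qed.

Lemma mulv_mulv_le f (a : 'I_n) : (forall u v, `|w u v| <= 1) -> l1bound f ->
  `|mulv (mulv f) a| <= Lam.
Proof.
move=> hw hf; apply: le_trans (ler_norm_sum _ _ _) _; apply: le_trans hf.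
by apply: ler_sum => c _; rewrite normrM; apply: ler_piMl.
Qed.

Variables f g : 'I_n -> R.
Hypotheses (hw : forall u v, `|w u v| <= 1)
  (hf : forall a, `|f a| <= 1) (hg : forall a, `|g a| <= 1)
  (Lf : l1bound f) (Lg : l1bound g) (L1 : l1bound one).

Let one1 (a : 'I_n) : `|one a| <= 1. Proof. by rewrite /one normr1. Qed.

Lemma sum4_lin : sum4 (fun a b c d => f a * g c * (w a c + w b d - w a d - w b c))
  = n%:R ^+ 2 * cform f g.
Proof.
case: (posnP n) => [n0|npos].
  rewrite /sum4 big1 => [|a _]; last by have := ltn_ord a; rewrite {2}n0.
  by rewrite n0 expr0n mul0r.
have nn : n%:R != 0 :> R by rewrite pnatr_eq0 -lt0n.
have e : n%:R ^+ 2 * cform f g = n%:R ^+ 2 * form f g - n%:R * (\sum_c g c) * form f one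
    - n%:R * (\sum_c f c) * form g one + (\sum_c f c) * (\sum_c g c) * form one one.
  by rewrite /cform; field.
rewrite e; pose F1 (a b c d : 'I_n) := f a * g c * w a c.
pose F2 (a b c d : 'I_n) := f a * g c * w b d.
pose F3 (a b c d : 'I_n) := f a * g c * w a d.
pose F4 (a b c d : 'I_n) := f a * g c * w b c.
have e1 : sum4 F1 = n%:R ^+ 2 * form f g.
  rewrite /sum4 /F1 /form mulr_sumr; apply: eq_bigr => a _.
  under eq_bigr => b _ do under eq_bigr => c _ do rewrite sum_ord_cst.
  rewrite sum_ord_cst -mulr_sumr; ring.
have e2 : sum4 F2 = (\sum_c f c) * (\sum_c g c) * form one one.
  rewrite /sum4 /F2 -mulrA mulr_suml; apply: eq_bigr => a _.
  rewrite /form mulr_sumr mulr_sumr; apply: eq_bigr => b _.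
  rewrite mulr_suml mulr_sumr; apply: eq_bigr => c _.
  rewrite !mulr_sumr; apply: eq_bigr => d _; rewrite /one; ring.
have e3 : sum4 F3 = n%:R * (\sum_c g c) * form f one.
  rewrite /sum4 /F3 /form mulr_sumr; apply: eq_bigr => a _.
  rewrite sum_ord_cst -mulrA; congr (_ * _).
  rewrite mulr_suml; apply: eq_bigr => c _.
  rewrite mulr_sumr; apply: eq_bigr => d _; rewrite /one; ring.
have e4 : sum4 F4 = n%:R * (\sum_c f c) * form g one.
  rewrite /sum4 /F4 -mulrA mulr_suml mulr_sumr; apply: eq_bigr => a _.
  rewrite exchange_big /= /form !mulr_sumr; apply: eq_bigr => c _.
  rewrite !mulr_sumr; apply: eq_bigr => b _.
  rewrite sum_ord_cst (wC b c) /one; ring.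
have -> : sum4 (fun a b c d => f a * g c * (w a c + w b d - w a d - w b c))
    = sum4 (fun a b c d => (F1 a b c d + F2 a b c d) + (-1 * F3 a b c d + -1 * F4 a b c d)).
  by apply: eq_sum4 => a b c d; rewrite /F1 /F2 /F3 /F4; ring.
by rewrite !sum4D !sum4Z e1 e2 e3 e4; ring.
Qed.

(** Each quadratic or cubic term factors through images [W f], [W g], [W 1], whose [l1] norms are at
    most [Lam]; a second application of [W] is bounded entrywise by the [l1] norm. So every term is
    at most [Lam^2], and there are six. *)
Lemma sum4_nonlin_le :
  `|sum4 (fun a b c d => f a * g c * ((1 - 2 * p) * (w a c * w b d - w a d * w b c)
    + (- (w a c * w b d * w a d) - w a c * w b d * w b c
       + w a d * w b c * w a c + w a d * w b c * w b d)))| <= 6 * Lam ^+ 2.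
Proof.
pose d1 := mulv one.
pose Q1 (a b c d : 'I_n) := f a * g c * (w a c * w b d).
pose Q2 (a b c d : 'I_n) := f a * g c * (w a d * w b c).
pose C1 (a b c d : 'I_n) := f a * g c * (w a c * w b d * w a d).
pose C2 (a b c d : 'I_n) := f a * g c * (w a c * w b d * w b c).
pose C3 (a b c d : 'I_n) := f a * g c * (w a d * w b c * w a c).
pose C4 (a b c d : 'I_n) := f a * g c * (w a d * w b c * w b d).
have sq (x y : R) : `|x| <= Lam -> `|y| <= Lam -> `|x * y| <= Lam ^+ 2.
  by move=> hx hy; rewrite normrM expr2; apply: ler_pM.
have q1 : `|sum4 Q1| <= Lam ^+ 2.
  have -> : sum4 Q1 = form f g * form one one.
    rewrite /sum4 /Q1 {1}/form mulr_suml; apply: eq_bigr => a _.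
    rewrite exchange_big mulr_suml; apply: eq_bigr => c _.
    rewrite /form mulr_sumr; apply: eq_bigr => b _.
    rewrite mulr_sumr; apply: eq_bigr => d _; rewrite /one; ring.
  by apply: sq; apply: form_le.
have q2 : `|sum4 Q2| <= Lam ^+ 2.
  have -> : sum4 Q2 = form f one * form g one.
    rewrite /sum4 /Q2 {1}/form mulr_suml; apply: eq_bigr => a _.
    rewrite exchange_big /= mulrC /form mulr_suml; apply: eq_bigr => c _.
    rewrite mulr_suml; apply: eq_bigr => b _.
    rewrite mulr_sumr; apply: eq_bigr => d _; rewrite (wC b c) /one; ring.
  by apply: sq; apply: form_le.
have c1 : `|sum4 C1| <= Lam ^+ 2.
  have -> : sum4 C1 = \sum_a f a * mulv g a * mulv d1 a.
    rewrite /sum4 /C1; apply: eq_bigr => a _.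
    rewrite exchange_big /= {1}/mulv -mulrA mulr_suml mulr_sumr; apply: eq_bigr => c _.
    rewrite exchange_big /= {1}/mulv !mulr_sumr; apply: eq_bigr => d _.
    rewrite /d1 /mulv !mulr_sumr; apply: eq_bigr => b _.
    by rewrite (wC b d) /one; ring.
  apply: le_trans (ler_norm_sum _ _ _) _.
  apply: (@le_trans _ _ (\sum_a `|mulv g a| * Lam)).
    apply: ler_sum => a _; rewrite !normrM; apply: ler_pM => //; first by rewrite mulr_ge0.
      by apply: ler_piMl.
    exact: mulv_mulv_le.
  by rewrite -mulr_suml expr2; apply: ler_wpM2r.
have c2 : `|sum4 C2| <= Lam ^+ 2.
  have -> : sum4 C2 = \sum_c g c * mulv f c * mulv d1 c.
    rewrite /sum4 /C2; under eq_bigr => a _ do rewrite exchange_big /=.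
    rewrite exchange_big /=; apply: eq_bigr => c _.
    rewrite {1}/mulv mulr_sumr mulr_suml; apply: eq_bigr => a _.
    rewrite {1}/mulv mulr_sumr; apply: eq_bigr => b _.
    rewrite /d1 /mulv !mulr_sumr; apply: eq_bigr => d _.
    by rewrite (wC b c) (wC a c) /one; ring.
  apply: le_trans (ler_norm_sum _ _ _) _.
  apply: (@le_trans _ _ (\sum_a `|mulv f a| * Lam)).
    apply: ler_sum => a _; rewrite !normrM; apply: ler_pM => //; first by rewrite mulr_ge0.
      by apply: ler_piMl.
    exact: mulv_mulv_le.
  by rewrite -mulr_suml expr2; apply: ler_wpM2r.
have c3 : `|sum4 C3| <= Lam ^+ 2.
  have -> : sum4 C3 = \sum_a \sum_c f a * g c * w a c * (d1 a * d1 c).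
    rewrite /sum4 /C3; apply: eq_bigr => a _; rewrite exchange_big /=.
    apply: eq_bigr => c _; rewrite /d1 /mulv mulr_sumr mulr_sumr; apply: eq_bigr => b _.
    rewrite mulr_suml mulr_sumr; apply: eq_bigr => d _; rewrite (wC b c) /one; ring.
  apply: le_trans (ler_norm_sum _ _ _) _.
  apply: (@le_trans _ _ (\sum_a `|d1 a| * (\sum_c `|d1 c|))).
    apply: ler_sum => a _; apply: le_trans (ler_norm_sum _ _ _) _.
    rewrite mulr_sumr; apply: ler_sum => c _; rewrite !normrM.
    rewrite -[leRHS]mul1r; apply: ler_pM; rewrite ?mulr_ge0 //.
    by rewrite -[leRHS]mulr1; apply: ler_pM; rewrite ?mulr_ge0 // mulr_ile1.
  rewrite -mulr_suml expr2; apply: ler_pM => //; apply: sumr_ge0 => a _; exact: normr_ge0.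
have c4 : `|sum4 C4| <= Lam ^+ 2.
  have -> : sum4 C4 = \sum_b mulv g b * mulv (mulv f) b.
    rewrite /sum4 /C4 exchange_big /=; apply: eq_bigr => b _.
    rewrite exchange_big /= {1}/mulv mulr_suml; apply: eq_bigr => c _.
    rewrite mulr_sumr exchange_big /=; apply: eq_bigr => d _.
    rewrite /mulv !mulr_sumr; apply: eq_bigr => a _; rewrite (wC a d); ring.
  apply: le_trans (ler_norm_sum _ _ _) _.
  apply: (@le_trans _ _ (\sum_a `|mulv g a| * Lam)).
    apply: ler_sum => a _; rewrite normrM; apply: ler_wpM2l => //.
    exact: mulv_mulv_le.
  by rewrite -mulr_suml expr2; apply: ler_wpM2r.
have -> : sum4 (fun a b c d => f a * g c * ((1 - 2 * p) * (w a c * w b d - w a d * w b c)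
    + (- (w a c * w b d * w a d) - w a c * w b d * w b c
       + w a d * w b c * w a c + w a d * w b c * w b d)))
  = sum4 (fun a b c d => ((1 - 2 * p) * Q1 a b c d + - (1 - 2 * p) * Q2 a b c d)
     + ((-1 * C1 a b c d + -1 * C2 a b c d) + (C3 a b c d + C4 a b c d))).
  by apply: eq_sum4 => a b c d; rewrite /Q1 /Q2 /C1 /C2 /C3 /C4; ring.
rewrite !sum4D !sum4Z.
have r1 : `|1 - 2 * p| <= 1 by case/andP: p01 => ? ?; rewrite ler_norml; apply/andP; lra.
have t1 : `|(1 - 2 * p) * sum4 Q1| <= Lam ^+ 2 by rewrite normrM; apply: le_trans q1; exact: ler_piMl.
have t2 : `|- (1 - 2 * p) * sum4 Q2| <= Lam ^+ 2.
  by rewrite normrM normrN; apply: le_trans q2; exact: ler_piMl.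
rewrite !ler_norml in c1 c2 c3 c4 t1 t2 *.
move: c1 c2 c3 c4 t1 t2 => /andP[? ?] /andP[? ?] /andP[? ?] /andP[? ?] /andP[? ?] /andP[? ?].
apply/andP; split; lra.
Qed.

Lemma sum4_swp_le :
  `|sum4 (fun a b c d => f a * g c * swp a b c d)
    - p * (1 - p) * n%:R ^+ 2 * cform f g| <= 6 * Lam ^+ 2.
Proof.
apply: le_trans sum4_nonlin_le.
rewrite -mulrA -sum4_lin -sum4Z.
rewrite (_ : sum4 _ = sum4 (fun a b c d =>
   p * (1 - p) * (f a * g c * (w a c + w b d - w a d - w b c))
   + f a * g c * ((1 - 2 * p) * (w a c * w b d - w a d * w b c)
    + (- (w a c * w b d * w a d) - w a c * w b d * w b c
       + w a d * w b c * w a c + w a d * w b c * w b d)))).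
  by rewrite sum4D addrC addKr.
by apply: eq_sum4 => a b c d; rewrite swpE; ring.
Qed.

Hypothesis w01 : forall u v, 0 <= p + w u v <= 1.

Lemma sum3_mixed_le : \sum_d (\sum_b (p + w b d)) * (\sum_a (1 - p - w a d))
  <= n%:R ^+ 3 * (p * (1 - p)) + n%:R * Lam.
Proof.
have e d : (\sum_b (p + w b d)) * (\sum_a (1 - p - w a d))
    = (n%:R * p + mulv one d) * (n%:R * (1 - p) - mulv one d).
  rewrite big_split /= sumrB !sum_ord_cst.
  by have -> : \sum_i w i d = mulv one d by apply: eq_bigr => i _; rewrite wC mulr1.
under eq_bigr => d _ do rewrite e.
apply: (@le_trans _ _ (\sum_(d < n) (n%:R ^+ 2 * (p * (1 - p)) + n%:R * `|mulv one d|))).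
  apply: ler_sum => d _.
  have h : n%:R * (1 - 2 * p) * mulv one d <= n%:R * `|mulv one d|.
    rewrite -mulrA; apply: ler_wpM2l => //; apply: le_trans (ler_norm _) _; rewrite normrM.
    apply: ler_piMl => //; case/andP: p01 => ? ?; rewrite ler_norml; apply/andP; lra.
  have := sqr_ge0 (mulv one d); lra.
rewrite big_split /= sum_ord_cst -mulr_sumr.
rewrite (_ : n%:R * (_ * _) = n%:R ^+ 3 * (p * (1 - p))); last by ring.
by rewrite lerD2l; apply: ler_wpM2l.
Qed.

Definition coinc (a b c d : 'I_n) := [|| a == c, a == d, b == c | b == d].

Let A u v := p + w u v.
Let B u v := 1 - p - w u v.
Let A01 u v : 0 <= A u v <= 1. Proof. exact: w01. Qed.
Let B01 u v : 0 <= B u v <= 1.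
Proof. by rewrite /B; have /andP[? ?] := w01 u v; apply/andP; split; lra. Qed.

Lemma le_mid4 (x y z t : R) : 0 <= x <= 1 -> 0 <= y -> 0 <= z -> 0 <= t <= 1 ->
  x * (y * z) * t <= y * z.
Proof.
move=> /andP[x0 x1] y0 z0 /andP[t0 t1].
apply: (@le_trans _ _ (x * (y * z))); first by rewrite ler_piMr // !mulr_ge0.
by rewrite ler_piMl // mulr_ge0.
Qed.

Let T3 := \sum_d (\sum_b A b d) * (\sum_a B a d).

Lemma T3E : \sum_d \sum_b \sum_a A b d * B a d = T3.
Proof.
apply: eq_bigr => d _; rewrite mulr_suml; apply: eq_bigr => b _.
by rewrite mulr_sumr.
Qed.

Lemma swp_abs a b c d : `|swp a b c d| <=
  A a c * A b d * B a d * B b c + A a d * A b c * B a c * B b d.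
Proof.
have A0 u v : 0 <= A u v by case/andP: (A01 u v).
have B0 u v : 0 <= B u v by case/andP: (B01 u v).
rewrite /swp -/(A a c) -/(A b d) -/(A a d) -/(A b c) -/(B a c) -/(B b d) -/(B a d) -/(B b c).
by apply: le_trans (ler_normB _ _) _; rewrite !ger0_norm ?mulr_ge0.
Qed.

(** A coincidence leaves three free vertices. To keep the factor [p (1 - p)] rather than count all
    [n^3] triples, each product is dominated by an edge and a non-edge with a common end, summed by
    [sum3_mixed_le]. *)
Lemma sum_coinc_le : sum4 (fun a b c d => (coinc a b c d)%:R * `|swp a b c d|)
  <= 8 * (n%:R ^+ 3 * (p * (1 - p)) + n%:R * Lam).
Proof.
have A0 u v : 0 <= A u v by case/andP: (A01 u v).
have B0 u v : 0 <= B u v by case/andP: (B01 u v).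
have AC u v : A u v = A v u by rewrite /A wC.
have BC u v : B u v = B v u by rewrite /B wC.
have t3 : T3 <= n%:R ^+ 3 * (p * (1 - p)) + n%:R * Lam by exact: sum3_mixed_le.
suff h : sum4 (fun a b c d => (coinc a b c d)%:R * `|swp a b c d|) <= 8 * T3.
  by apply: le_trans h _; rewrite ler_pM2l.
pose E1 a b c d : R := (a == c)%:R * `|swp a b c d|.
pose E2 a b c d : R := (a == d)%:R * `|swp a b c d|.
pose E3 a b c d : R := (b == c)%:R * `|swp a b c d|.
pose E4 a b c d : R := (b == d)%:R * `|swp a b c d|.
have col (i : 'I_n) (F : 'I_n -> R) : \sum_j (i == j)%:R * F j = F i.
  rewrite (bigD1 i) //= eqxx mul1r big1 ?addr0 // => j ji.
  by rewrite eq_sym (negbTE ji) mul0r.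
have t3' : \sum_d \sum_b \sum_a A a d * B b d = T3.
  by rewrite -T3E; apply: eq_bigr => d _; rewrite exchange_big.
have e1 : sum4 E1 <= 2 * T3.
  have -> : sum4 E1 = \sum_d \sum_b \sum_a `|swp a b a d|.
    rewrite /sum4 exchange_big /=; rewrite [RHS]exchange_big /=; apply: eq_bigr => b _.
    rewrite [RHS]exchange_big /=; apply: eq_bigr => a _; rewrite /E1.
    by rewrite exchange_big /=; apply: eq_bigr => d _; rewrite (col a).
  rewrite mulrDl mul1r -{1}T3E -t3' -big_split; apply: ler_sum => d _ /=.
  rewrite -big_split; apply: ler_sum => b _ /=; rewrite -big_split; apply: ler_sum => a _ /=.
  apply: le_trans (swp_abs _ _ _ _) _; apply: lerD.
    by rewrite -(mulrA (A a a)); exact: le_mid4.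
  rewrite (_ : _ * _ * _ * _ = A b a * (A a d * B b d) * B a a); last by ring.
  exact: le_mid4.
have e2 : sum4 E2 <= 2 * T3.
  have -> : sum4 E2 = \sum_b \sum_a \sum_c `|swp a b c a|.
    rewrite /sum4 exchange_big /=; apply: eq_bigr => b _; apply: eq_bigr => a _.
    by apply: eq_bigr => c _; rewrite (col a).
  rewrite mulrDl mul1r -{1}T3E -t3' -big_split; apply: ler_sum => b _ /=.
  rewrite -big_split; apply: ler_sum => a _ /=; rewrite -big_split; apply: ler_sum => c _ /=.
  apply: le_trans (swp_abs _ _ _ _) _; apply: lerD.
    rewrite (AC b a) (BC b c) (_ : _ * _ * _ * _ = A a c * (A a b * B c b) * B a a); last by ring.
    exact: le_mid4.
  rewrite (AC b c) (BC b a) (_ : _ * _ * _ * _ = A a a * (A c b * B a b) * B a c); last by ring.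
  exact: le_mid4.
have e3 : sum4 E3 <= 2 * T3.
  have -> : sum4 E3 = \sum_a \sum_b \sum_d `|swp a b b d|.
    rewrite /sum4; apply: eq_bigr => a _; apply: eq_bigr => b _.
    by rewrite exchange_big /=; apply: eq_bigr => d _; rewrite (col b).
  rewrite mulrDl mul1r -{1}T3E -t3' -big_split; apply: ler_sum => a _ /=.
  rewrite -big_split; apply: ler_sum => b _ /=; rewrite -big_split; apply: ler_sum => d _ /=.
  apply: le_trans (swp_abs _ _ _ _) _; apply: lerD.
    rewrite (AC a b) (BC a d) (_ : _ * _ * _ * _ = A b d * (A b a * B d a) * B b b); last by ring.
    exact: le_mid4.
  rewrite (AC a d) (BC a b) (_ : _ * _ * _ * _ = A b b * (A d a * B b a) * B b d); last by ring.
  exact: le_mid4.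
have e4 : sum4 E4 <= 2 * T3.
  have -> : sum4 E4 = \sum_c \sum_a \sum_b `|swp a b c b|.
    rewrite /sum4 [RHS]exchange_big /=; apply: eq_bigr => a _.
    rewrite [RHS]exchange_big /=; apply: eq_bigr => b _.
    by apply: eq_bigr => c _; rewrite (col b).
  rewrite mulrDl mul1r -{1}T3E -t3' -big_split; apply: ler_sum => c _ /=.
  rewrite -big_split; apply: ler_sum => a _ /=; rewrite -big_split; apply: ler_sum => b _ /=.
  apply: le_trans (swp_abs _ _ _ _) _; apply: lerD.
    rewrite (_ : _ * _ * _ * _ = A b b * (A a c * B b c) * B a b); last by ring.
    exact: le_mid4.
  rewrite (_ : _ * _ * _ * _ = A a b * (A b c * B a c) * B b b); last by ring.
  exact: le_mid4.
have h : sum4 (fun a b c d => (coinc a b c d)%:R * `|swp a b c d|)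
    <= sum4 (fun a b c d => (E1 a b c d + E2 a b c d) + (E3 a b c d + E4 a b c d)).
  rewrite /sum4; do 4 (apply: ler_sum => ? _); rewrite /E1 /E2 /E3 /E4 -!mulrDl.
  apply: ler_wpM2r => //; rewrite /coinc.
  by do 4 case: (_ == _); rewrite /= ?mulr1n ?mulr0n; lra.
apply: le_trans h _; rewrite !sum4D; lra.
Qed.

Lemma sum4_nc_le :
  `|sum4 (fun a b c d => (~~ coinc a b c d)%:R * (f a * g c * swp a b c d))
    - p * (1 - p) * n%:R ^+ 2 * cform f g|
  <= 6 * Lam ^+ 2 + 8 * (n%:R ^+ 3 * (p * (1 - p)) + n%:R * Lam).
Proof.
have h1 := sum4_swp_le; have h2 := sum_coinc_le.
set F := sum4 (fun a b c d => f a * g c * swp a b c d) in h1.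
set G := sum4 (fun a b c d => (~~ coinc a b c d)%:R * _).
have e : G = F + sum4 (fun a b c d => -1 * ((coinc a b c d)%:R * (f a * g c * swp a b c d))).
  rewrite -sum4D; apply: eq_sum4 => a b c d.
  by case: (coinc a b c d); rewrite /= ?mulr1n ?mulr0n; ring.
have h3 : `|sum4 (fun a b c d => -1 * ((coinc a b c d)%:R * (f a * g c * swp a b c d)))|
    <= 8 * (n%:R ^+ 3 * (p * (1 - p)) + n%:R * Lam).
  apply: le_trans h2; rewrite /sum4.
  do 3 (apply: le_trans (ler_norm_sum _ _ _) _; apply: ler_sum => ? _).
  apply: le_trans (ler_norm_sum _ _ _) _; apply: ler_sum => d _.
  rewrite mulN1r normrN normrM ger0_norm //; apply: ler_wpM2l => //.
  rewrite normrM; apply: ler_piMl => //; rewrite normrM; exact: mulr_ile1.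
rewrite e addrAC; apply: le_trans (ler_normD _ _) _; exact: lerD.
Qed.

End Matrix.
End SwitchPolynomial.

(** * Averaging over all families of commuting switchings *)

Section SwapAverage.
Variables (R : realType) (n : nat) (p : R).
Hypothesis p01 : 0 <= p <= 1.
Local Notation I := ('I_n * 'I_n)%type.
Local Notation pe := (@pe R n p).
Local Notation blk := (blk n).
Implicit Types (w : {set I}) (u v a b c d : 'I_n).

Definition sw0 w a b c d : R :=
  if [&& adj w a c, adj w b d, ~~ adj w a d & ~~ adj w b c] then 1
  else if [&& adj w a d, adj w b c, ~~ adj w a c & ~~ adj w b d] then -1 else 0.

(** Jensen's inequality, from the tangent line of [exp] at the mean. *)
Lemma expR_avg (K : finType) (x : K -> R) : (0 < #|K|)%N ->
  expR ((\sum_k x k) / #|K|%:R) <= (\sum_k expR (x k)) / #|K|%:R.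
Proof.
move=> K0; have K0' : 0 < #|K|%:R :> R by rewrite ltr0n.
set m := (\sum_k x k) / #|K|%:R.
rewrite ler_pdivlMr //.
have -> : expR m * #|K|%:R = \sum_(k : K) (expR m * (1 + (x k - m))).
  rewrite -mulr_sumr big_split /= sumrB !sumr_const mulr_natr -mulr_natr.
  rewrite /m -(mulr_natr (_ / _)) divfK ?gt_eqF // subrr addr0.
  by rewrite -mulr_natr mul1r.
apply: ler_sum => k _; rewrite -[X in _ <= expR X](subrK m) expRD mulrC.
by apply: ler_wpM2r; [exact: expR_ge0|exact: expR_ge1Dx].
Qed.

Lemma sum_antisym (u : 'I_n -> R) (F : 'I_n -> 'I_n -> R) :
    (forall x y, F x y = - F y x) ->
  \sum_(x < n) \sum_(y < n | (x < y)%N) (u x - u y) * F x y = \sum_(x < n) \sum_(y < n) u x * F x y.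
Proof.
move=> h.
have F0 x : F x x = 0 by have := h x x; lra.
have -> : \sum_(x < n) \sum_(y < n) u x * F x y = \sum_(x < n) \sum_(y < n | (x < y)%N) u x * F x y
    + \sum_(x < n) \sum_(y < n | (y < x)%N) u x * F x y.
  rewrite -big_split; apply: eq_bigr => x _ /=.
  rewrite (bigID (fun y : 'I_n => (x < y)%N)) /=; congr (_ + _).
  rewrite big_mkcond [RHS]big_mkcond; apply: eq_bigr => y _.
  case: (ltngtP x y) => //= /val_inj ->; by rewrite F0 mulr0.
rewrite [X in _ = _ + X](exchange_big_dep xpredT) //= -big_split.
apply: eq_bigr => x _ /=; rewrite -big_split; apply: eq_bigr => y _ /=.
by rewrite (h y x); ring.
Qed.

Lemma sum_sym_le (u : 'I_n -> R) (F : 'I_n -> 'I_n -> R) :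
    (forall x, u x = 0 \/ u x = 1) ->
    (forall x y, F x y = F y x) -> (forall x y, 0 <= F x y) ->
  \sum_(x < n) \sum_(y < n | (x < y)%N) (u x - u y) ^+ 2 * F x y <= \sum_(x < n) \sum_(y < n) u x * F x y.
Proof.
move=> u01 h F0.
apply: (@le_trans _ _ (\sum_(x < n) \sum_(y < n | (x < y)%N) u x * F x y
    + \sum_(x < n) \sum_(y < n | (y < x)%N) u x * F x y)).
  rewrite [X in _ <= _ + X](exchange_big_dep xpredT) //= -big_split.
  apply: ler_sum => x _ /=; rewrite -big_split; apply: ler_sum => y _ /=.
  rewrite (h y x) -mulrDl; apply: ler_wpM2r => //.
  by case: (u01 x) => ->; case: (u01 y) => ->; lra.
rewrite -big_split; apply: ler_sum => x _ /=.
rewrite [leRHS](bigID (fun y : 'I_n => (x < y)%N)) /=; apply: lerD => //.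
have u0 : 0 <= u x by case: (u01 x) => ->.
rewrite big_mkcond [leRHS]big_mkcond; apply: ler_sum => y _.
by case: (ltngtP x y) => //= _; rewrite mulr_ge0.
Qed.

(** Counting subsets is integrating against the uniform Bernoulli measure, where averaging four
    distinct coordinates gives [1/16]. *)
Lemma sum_chi a b c d : a != b -> c != d ->
  \sum_(chi : {set 'I_n}) ([&& a \in chi, b \in chi, c \notin chi & d \notin chi])%:R
    = (~~ coinc a b c d)%:R * 2 ^+ n / 16 :> R.
Proof.
move=> ab cd.
pose F (chi : {set 'I_n}) : R := ([&& a \in chi, b \in chi, c \notin chi & d \notin chi])%:R.
change (\sum_chi F chi = (~~ coinc a b c d)%:R * 2 ^+ n / 16).
case: (boolP (coinc a b c d)) => /= hc.
  rewrite mul0r mul0r big1 // => chi _; rewrite /F.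
  by move: hc; rewrite /coinc => /or4P[] /eqP ->;
    case: (c \in chi); case: (d \in chi); rewrite /= ?andbF.
have [ac ad bc bd] : [/\ a != c, a != d, b != c & b != d].
  by move: hc; rewrite /coinc !negb_or => /and4P[].
pose h : 'I_n -> R := fun=> 1 / 2.
have h01 i : 0 <= h i <= 1 by rewrite /h; apply/andP; lra.
have eE (f : {set 'I_n} -> R) : \sum_chi f chi = 2 ^+ n * Ex h f.
  have bE chi : bern h chi = 2 ^- n.
    rewrite /bern (eq_bigr (fun=> 2^-1)) ?prodr_const ?card_ord ?exprVn // => i _.
    by case: ifP => _; rewrite /h; lra.
  rewrite /Ex mulr_sumr; apply: eq_bigr => chi _.
  by rewrite bE mulrA divff ?mul1r // expf_neq0 // pnatr_eq0.
rewrite mul1r eE; congr (_ * _).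
rewrite -(Ex_avg h a) -(Ex_avg h b) -(Ex_avg h c) -(Ex_avg h d).
rewrite -[RHS](Ex_cst h); apply: Ex_eq => chi; rewrite /avg /F !inE !eqxx.
rewrite (negbTE ab) (negbTE cd) (negbTE ac) (negbTE ad) (negbTE bc) (negbTE bd).
rewrite (eq_sym b a) (eq_sym d c) (eq_sym c a) (eq_sym d a) (eq_sym c b) (eq_sym d b).
rewrite (negbTE ab) (negbTE cd) (negbTE ac) (negbTE ad) (negbTE bc) (negbTE bd) /=.
rewrite /h /= ?mulr1n ?mulr0n; lra.
Qed.

Variables (M : nat) (H lam : {ffun 'I_n -> nat} -> R)
  (X Y : {ffun 'I_n -> nat} -> {set 'I_n}).
Hypotheses (n0 : (0 < n)%N) (M0 : (0 < M)%N) (H0 : forall f, 0 <= H f)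
  (lam3 : forall f, `|lam f| <= 1 / 3).

Local Notation K := ({set 'I_n} * 'I_n * 'I_M)%type.

Definition ind (S : {set 'I_n}) a : R := (a \in S)%:R.

(** Blocks are ordered, [a < b] and [c < d], while the sign is antisymmetric in each pair; the
    differences of indicators make the ordered sum equal to the full sum weighted by [a] in [X] and
    [c] in [Y] ([sum_antisym]). *)
Definition coef (x : blk) f : R :=
  lam f * (ind (X f) x.1.1 - ind (X f) x.1.2) * (ind (Y f) x.2.1 - ind (Y f) x.2.2).

Lemma ind_diff S a b : `|ind S a - ind S b| <= 1.
Proof.
rewrite /ind; case: (a \in S); case: (b \in S);
by rewrite /= ?mulr1n ?mulr0n ?subrr ?subr0 ?sub0r ?normrN ?normr1 ?normr0.
Qed.

Lemma coef_le x f : `|coef x f| <= 1 / 3.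
Proof.
rewrite /coef 2!normrM; apply: le_trans (lam3 f).
apply: le_trans (_ : `|lam f| * `|ind (X f) x.1.1 - ind (X f) x.1.2| <= _).
  by apply: ler_piMr; rewrite ?mulr_ge0 // ind_diff.
by apply: ler_piMr; rewrite ?ind_diff.
Qed.

Definition Zk (k : K) w : R := \sum_(x : blk) coef x (dgf w) * sgn R k.1.1 k.1.2 M k.2 w x.
Definition Vk (k : K) w : R :=
  \sum_(x : blk) (coef x (dgf w) * sgn R k.1.1 k.1.2 M k.2 w x) ^+ 2.

(** For fixed parameters the switchings commute but reach few quadruples; the average over the
    parameters reaches all of them, and by convexity of [exp] inherits the moment bound. *)
Definition swPhi w : R := (\sum_k (Zk k w - Vk k w)) / #|{: K}|%:R.

Lemma cardK : #|{: K}|%:R = 2 ^+ n * n%:R * M%:R :> R.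
Proof.
have e : #|{set 'I_n}| = (2 ^ n)%N by rewrite -cardsT -powersetT card_powerset cardsT card_ord.
by rewrite !card_prod !card_ord e !natrM natrX.
Qed.

Let cardK0 : (0 < #|{: K}|)%N.
Proof. by rewrite -(ltr_nat R) cardK !mulr_gt0 ?exprn_gt0 // ltr0n. Qed.

Lemma swap_exp : Ex pe (fun w => H (dgf w) * expR (swPhi w)) <= Ex pe (fun w => H (dgf w)).
Proof.
have K0' : 0 < #|{: K}|%:R :> R by rewrite ltr0n.
apply: (@le_trans _ _ (Ex pe (fun w => \sum_(k : K)
     #|{: K}|%:R^-1 * (H (dgf w) * expR (Zk k w - Vk k w))))).
  apply: Ex_le; first exact: pe01.
  move=> w; rewrite -mulr_sumr -mulr_sumr mulrCA; apply: ler_wpM2l => //.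
  by rewrite mulrC; exact: expR_avg.
rewrite Ex_sum; apply: (@le_trans _ _ (\sum_(k : K) #|{: K}|%:R^-1 * Ex pe (fun w => H (dgf w)))).
  apply: ler_sum => k _; rewrite ExZl; apply: ler_wpM2l; first by rewrite invr_ge0 ltW.
  have := @swap_seq R n p p01 k.1.1 k.1.2 M k.2 (index_enum blk) H coef
    (index_enum_uniq _) H0 coef_le.
  by under Ex_eq => w do rewrite sumrB.
by rewrite sumr_const -[X in X <= _]mulr_natl mulrA divff ?gt_eqF // mul1r.
Qed.

Section Evaluate.
Variable w : {set I}.
Hypothesis small : forall a b, (#|[set c | adj w a c != adj w b c]| <= M)%N.

Let esel (k : K) a b c d : bool :=
  [&& (a < b)%N, (c < d)%N, [&& a \in k.1.1, b \in k.1.1, c \notin k.1.1 & d \notin k.1.1],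
      (a + b) %% n == k.1.2
    & (rk k.1.1 w a b c + rk k.1.1 w a b d) %% M == k.2]%N.

Lemma sgnE (k : K) a b c d : sgn R k.1.1 k.1.2 M k.2 w ((a, b), (c, d))
  = (esel k a b c d)%:R * sw0 w a b c d.
Proof.
have hD : (#|Dset k.1.1 w a b| <= M)%N.
  apply: leq_trans (small a b); apply: subset_leq_card; apply/subsetP => y.
  by rewrite !inE => /andP[].
rewrite /sgn /act /esel /elig hD /= !inE.
case: (a < b)%N; rewrite /= ?mul0r //.
case: (a \in _); rewrite /= ?andbF ?mul0r //.
case: (b \in _); rewrite /= ?andbF ?mul0r //.
case: (c < d)%N; rewrite /= ?andbF ?mul0r //.
case: (c \in _); rewrite /= ?andbF ?mul0r //.
case: (d \in _); rewrite /= ?andbF ?mul0r //.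
case: (_ == _ :> nat); rewrite /= ?andbF ?mul0r //.
case: (_ == _ :> nat); rewrite /= ?andbF ?mul0r // mul1r /sw0.
by case: (adj w a c); case: (adj w b c); case: (adj w a d); case: (adj w b d).
Qed.

(** Given a separating [chi], the quadruple determines [h] and [g]. So every admissible quadruple is
    selected equally often, by [2^n / 16] of the [2^n n M] parameters; hence the factor [16 n M] in
    [swPhi_ge]. *)
Lemma sum_esel a b c d : \sum_(k : K) (esel k a b c d)%:R
  = (((a < b) && (c < d))%N && ~~ coinc a b c d)%:R * (2 ^+ n / 16) :> R.
Proof.
case: (boolP ((a < b) && (c < d))%N) => /= [/andP[ab cd]|hn]; last first.
  rewrite mul0r big1 // => k _; rewrite /esel; move: hn; rewrite negb_and.
  by case: (a < b)%N => //= /negbTE ->.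
have anb : a != b by apply/eqP => e; rewrite e ltnn in ab.
have cnd : c != d by apply/eqP => e; rewrite e ltnn in cd.
rewrite mulrA -sum_chi //.
pose G (xh : {set 'I_n} * 'I_n) (g : 'I_M) : R := (esel (xh, g) a b c d)%:R.
transitivity (\sum_xh \sum_g G xh g).
  by rewrite [RHS]pair_bigA; apply: eq_bigr => -[xh g] _.
pose G1 (chi : {set 'I_n}) (h : 'I_n) : R := \sum_g G (chi, h) g.
transitivity (\sum_chi \sum_h G1 chi h).
  by rewrite [RHS]pair_bigA; apply: eq_bigr => -[chi h] _.
apply: eq_bigr => chi _; rewrite /G1 /G /esel /= ab cd /=.
case: [&& _, _, _ & _]; last by rewrite big1 // => h _; rewrite big1.
rewrite /= (bigD1 (Ordinal (ltn_pmod (a + b) n0))) //= eqxx.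
rewrite (bigD1 (Ordinal (ltn_pmod (rk chi w a b c + rk chi w a b d) M0))) //= eqxx.
rewrite big1 ?addr0 => [|g]; last first.
  by rewrite -val_eqE /= eq_sym => /negbTE ->.
rewrite big1 ?addr0 // => h; rewrite -val_eqE /= eq_sym => /negbTE he.
by rewrite big1 // => g _; rewrite he.
Qed.

Lemma sum_blk (F : 'I_n -> 'I_n -> 'I_n -> 'I_n -> R) :
  \sum_(x : blk) F x.1.1 x.1.2 x.2.1 x.2.2 = sum4 F.
Proof.
rewrite /sum4 pair_bigA /=.
under [RHS]eq_bigr => x _ do rewrite pair_bigA /=.
by rewrite pair_bigA.
Qed.

Let f0 := dgf w.

Definition Zd : R := sum4 (fun a b c d =>
  (~~ coinc a b c d)%:R * (ind (X (dgf w)) a * ind (Y (dgf w)) c * sw0 w a b c d)).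
Definition Vd : R := sum4 (fun a b c d =>
  (~~ coinc a b c d)%:R * (ind (X (dgf w)) a * ind (Y (dgf w)) c * sw0 w a b c d ^+ 2)).

Lemma coinc_swap_row a b c d : coinc b a c d = coinc a b c d.
Proof.
by rewrite /coinc; case: (a == c); case: (a == d); case: (b == c); case: (b == d).
Qed.

Lemma coinc_swap_col a b c d : coinc a b d c = coinc a b c d.
Proof.
by rewrite /coinc; case: (a == c); case: (a == d); case: (b == c); case: (b == d).
Qed.

Lemma sw0_swap_row a b c d : sw0 w b a c d = - sw0 w a b c d.
Proof.
rewrite /sw0; case: (adj w a c); case: (adj w b d); case: (adj w a d); case: (adj w b c);
by rewrite /= ?opprK ?oppr0.
Qed.

Lemma sw0_swap_col a b c d : sw0 w a b d c = - sw0 w a b c d.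
Proof.
rewrite /sw0; case: (adj w a c); case: (adj w b d); case: (adj w a d); case: (adj w b c);
by rewrite /= ?opprK ?oppr0.
Qed.

Let sel a b c d (F : R) : R := if ((a < b) && (c < d))%N then F else 0.

Lemma sum4_sel (F : 'I_n -> 'I_n -> 'I_n -> 'I_n -> R) :
  sum4 (fun a b c d => sel a b c d (F a b c d))
  = \sum_(a < n) \sum_(b < n | (a < b)%N) \sum_(c < n) \sum_(d < n | (c < d)%N) F a b c d.
Proof.
apply: eq_bigr => a _; rewrite [RHS]big_mkcond; apply: eq_bigr => b _.
case: ifP => ab; last first.
  by rewrite big1 // => c _; rewrite big1 // => d _; rewrite /sel ab.
apply: eq_bigr => c _; rewrite [RHS]big_mkcond; apply: eq_bigr => d _.
by rewrite /sel ab.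
Qed.

Lemma sum_Zk : \sum_(k : K) Zk k w = lam f0 * Zd * (2 ^+ n / 16).
Proof.
rewrite /Zk exchange_big /=.
pose T a b c d : R := (~~ coinc a b c d)%:R * sw0 w a b c d.
pose F a b c d : R := lam f0 * ((ind (X f0) a - ind (X f0) b) * ((ind (Y f0) c - ind (Y f0) d) * T a b c d)).
transitivity (\sum_(x : blk) sel x.1.1 x.1.2 x.2.1 x.2.2 (F x.1.1 x.1.2 x.2.1 x.2.2) * (2 ^+ n / 16)).
  apply: eq_bigr => -[[a b] [c d]] _ /=.
  under eq_bigr => k _ do rewrite sgnE mulrCA -mulrA.
  rewrite -mulr_suml sum_esel /sel /F /T /coef -/f0 /=.
  by case: ((a < b)%N && (c < d)%N) => /=; rewrite ?mul0r //; case: (coinc _ _ _ _); rewrite /= ?mulr1n ?mulr0n; ring.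
rewrite -mulr_suml (sum_blk (fun a b c d => sel a b c d (F a b c d))) sum4_sel; congr (_ * _).
rewrite /F; under eq_bigr => a _ do under eq_bigr => b _ do
  (under eq_bigr => c _ do rewrite -mulr_sumr -mulr_sumr; rewrite -mulr_sumr -mulr_sumr).
under eq_bigr => a _ do rewrite -mulr_sumr.
rewrite -mulr_sumr; congr (_ * _).
pose G a b : R := \sum_(c < n) \sum_(d < n) ind (Y f0) c * T a b c d.
have eG a b : \sum_(c < n) \sum_(d < n | (c < d)%N) (ind (Y f0) c - ind (Y f0) d) * T a b c d = G a b.
  apply: (sum_antisym (ind (Y f0))) => c d.
  by rewrite /T (coinc_swap_col a b c d) (sw0_swap_col a b c d) mulrN opprK.
under eq_bigr => a _ do under eq_bigr => b _ do rewrite eG.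
rewrite (sum_antisym (ind (X f0))); last first.
  move=> a b; rewrite /G -sumrN; apply: eq_bigr => c _; rewrite -sumrN; apply: eq_bigr => d _.
  by rewrite /T (coinc_swap_row a b c d) (sw0_swap_row a b c d) !mulrN opprK.
rewrite /Zd /sum4; apply: eq_bigr => a _; apply: eq_bigr => b _; rewrite /G mulr_sumr.
apply: eq_bigr => c _; rewrite mulr_sumr; apply: eq_bigr => d _; rewrite /T -/f0; ring.
Qed.

Lemma sum_Vk : \sum_(k : K) Vk k w <= lam f0 ^+ 2 * Vd * (2 ^+ n / 16).
Proof.
rewrite /Vk exchange_big /=.
pose T a b c d : R := (~~ coinc a b c d)%:R * sw0 w a b c d ^+ 2.
have T0 a b c d : 0 <= T a b c d by rewrite mulr_ge0 ?sqr_ge0.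
have ind01 S a : ind S a = 0 \/ ind S a = 1.
  by rewrite /ind; case: (_ \in _); [right|left].
pose F a b c d : R := lam f0 ^+ 2 * ((ind (X f0) a - ind (X f0) b) ^+ 2 * ((ind (Y f0) c - ind (Y f0) d) ^+ 2 * T a b c d)).
have -> : \sum_(x : blk) \sum_(k : K) (coef x (dgf w) * sgn R k.1.1 k.1.2 M k.2 w x) ^+ 2
   = \sum_(x : blk) sel x.1.1 x.1.2 x.2.1 x.2.2 (F x.1.1 x.1.2 x.2.1 x.2.2) * (2 ^+ n / 16).
  apply: eq_bigr => -[[a b] [c d]] _ /=.
  have sq (e : bool) (x y : R) : (x * (e%:R * y)) ^+ 2 = e%:R * (x ^+ 2 * y ^+ 2).
    by case: e; rewrite /= ?mulr1n ?mulr0n; ring.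
  under eq_bigr => k _ do rewrite sgnE sq.
  rewrite -mulr_suml sum_esel /sel /F /T /coef -/f0 /=.
  by case: ((a < b)%N && (c < d)%N) => /=; rewrite ?mul0r //; case: (coinc _ _ _ _); rewrite /= ?mulr1n ?mulr0n; ring.
rewrite -mulr_suml (sum_blk (fun a b c d => sel a b c d (F a b c d))) sum4_sel.
apply: ler_wpM2r; first by rewrite divr_ge0 ?exprn_ge0.
rewrite /F; under eq_bigr => a _ do under eq_bigr => b _ do
  (under eq_bigr => c _ do rewrite -mulr_sumr -mulr_sumr; rewrite -mulr_sumr -mulr_sumr).
under eq_bigr => a _ do rewrite -mulr_sumr.
rewrite -mulr_sumr; apply: ler_wpM2l; first exact: sqr_ge0.
pose G a b : R := \sum_(c < n) \sum_(d < n) ind (Y f0) c * T a b c d.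
have eG a b : \sum_(c < n) \sum_(d < n | (c < d)%N) (ind (Y f0) c - ind (Y f0) d) ^+ 2 * T a b c d <= G a b.
  apply: sum_sym_le => // c d.
  by rewrite /T (coinc_swap_col a b c d) (sw0_swap_col a b c d) sqrrN.
apply: (@le_trans _ _ (\sum_(a < n) \sum_(b < n | (a < b)%N) (ind (X f0) a - ind (X f0) b) ^+ 2 * G a b)).
  by apply: ler_sum => a _; apply: ler_sum => b _; apply: ler_wpM2l; rewrite ?sqr_ge0.
apply: le_trans (sum_sym_le _ _ _) _ => //.
- move=> a b; rewrite /G; apply: eq_bigr => c _; apply: eq_bigr => d _.
  by rewrite /T (coinc_swap_row a b c d) (sw0_swap_row a b c d) sqrrN.
- move=> a b; rewrite /G; apply: sumr_ge0 => c _; apply: sumr_ge0 => d _.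
  by rewrite mulr_ge0 // /ind.
rewrite le_eqVlt; apply/orP; left; apply/eqP.
rewrite /Vd /sum4; apply: eq_bigr => a _; apply: eq_bigr => b _; rewrite /G mulr_sumr.
apply: eq_bigr => c _; rewrite mulr_sumr; apply: eq_bigr => d _; rewrite /T -/f0; ring.
Qed.

Lemma swPhi_ge : (lam f0 * Zd - lam f0 ^+ 2 * Vd) / (16 * n%:R * M%:R) <= swPhi w.
Proof.
rewrite /swPhi sumrB sum_Zk cardK.
have n0' : 0 < n%:R :> R by rewrite ltr0n.
have M0' : 0 < M%:R :> R by rewrite ltr0n.
have t0 : 0 < 2 ^+ n :> R by rewrite exprn_gt0.
have := sum_Vk; set V := \sum_k _ => hV.
rewrite -mulrA ler_pdivrMr ?mulr_gt0 //.
have -> : (lam f0 * Zd * (2 ^+ n / 16) - V) / (2 ^+ n * n%:R * M%:R) * (16 * (n%:R * M%:R))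
  = lam f0 * Zd - V * 16 / 2 ^+ n.
  by field; rewrite !gt_eqF.
rewrite lerD2l lerN2 ler_pdivrMr // -ler_pdivlMr //.
by apply: le_trans hV _; rewrite mulrA.
Qed.

End Evaluate.
End SwapAverage.

(** * Integrating out the edges between a vertex set and its complement *)

Section RowAverage.
Variables (R : realType) (n : nat) (p : R).
Hypothesis p01 : 0 <= p <= 1.
Local Notation I := ('I_n * 'I_n)%type.
Local Notation pe := (@pe R n p).
Implicit Types (w : {set I}) (u v : 'I_n) (s : seq 'I_n).

Definition indep_fun (A : Type) (m : {set I} -> A) (e : I) :=
  forall w, m (e |: w) = m w /\ m (w :\ e) = m w.

Lemma adj_indep (e : I) u v : (u != v -> eix u v != e) ->
  indep_fun (fun w => adj w u v) e.
Proof.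
move=> h w; rewrite adjU adjD; case: (eqVneq u v) h => [<-|uv] h.
  by rewrite /adj eqxx.
by rewrite (negbTE (h isT)) andbT.
Qed.

(** [m] carries whatever else the integrand depends on; in the induction the edge just exposed is
    appended to it, which is why its type is arbitrary. *)
Lemma avgs_row (A : Type) (v : 'I_n) (m : {set I} -> A) (Phi : A -> nat -> R) s w :
    v \notin s -> uniq s -> (forall u, u \in s -> indep_fun m (eix v u)) ->
  avgs pe [seq eix v u | u <- s] (fun w => Phi (m w) (\sum_(u <- s) adj w v u)%N) w
    = binE (size s) p (Phi (m w)).
Proof.
elim: s A m Phi w => [|u s IH] A m Phi w /=; first by rewrite big_nil.
rewrite inE negb_or => /andP[vu vs] /andP[us uns] hm.
have e1 w' : avgs pe [seq eix v x | x <- s]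
     (fun w => Phi (m w) (\sum_(x <- u :: s) adj w v x)%N) w'
   = binE (size s) p (fun i => Phi (m w') (adj w' v u + i)%N).
  have := IH (A * bool)%type (fun w => (m w, adj w v u))
    (fun x i => Phi x.1 (x.2 + i)%N) w' vs uns.
  move=> <- /=.
    by congr (avgs _ _ _ _); apply: boolp.funext => w2; rewrite big_cons.
  move=> x xs w2; have [h1 h2] := hm x (mem_behead (s := u :: s) xs) w2.
  have xu : u != x by apply: contraNneq us => ->.
  have vx : v != x by apply: contraNneq vs => ->.
  have hi : indep_fun (fun w => adj w v u) (eix v x).
    apply: adj_indep => _; rewrite eix_eq2 // !xpair_eqE eqxx (negbTE xu) /=.
    by rewrite (negbTE vx).
  have [h3 h4] := hi w2.
  by rewrite h1 h2 h3 h4.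
rewrite /avg !e1; have [h1 h2] := hm u (mem_head _ _) w.
rewrite h1 h2 adjU adjD eqxx vu /= andbF /pe eix_lt //.
Qed.

Variable V1 : {set 'I_n}.

Definition d1 w v : nat := (\sum_(u in V1) adj w v u)%N.
Definition d2 w v : nat := (\sum_(u in ~: V1) adj w v u)%N.

Lemma dg_split w v : dg w v = (d1 w v + d2 w v)%N.
Proof.
rewrite /dg (bigID (mem V1)) /=; congr (_ + _)%N.
by apply: eq_bigl => u; rewrite inE.
Qed.

(** Given the edges inside [V1], the degrees from distinct vertices of [V1] into the complement are
    independent binomials, so the rows can be integrated one after another. *)
Lemma Ex_rows (phi : nat -> nat -> R) :
    (forall m, binE #|~: V1| p (fun l => expR (phi m l)) <= 1) ->
  Ex pe (fun w => expR (\sum_(v in V1) phi (d1 w v) (d2 w v))) <= 1.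
Proof.
move=> hphi.
suff h s : uniq s -> {subset s <= V1} ->
    Ex pe (fun w => expR (\sum_(v <- s) phi (d1 w v) (d2 w v))) <= 1.
  have sV : {subset enum V1 <= V1} by move=> x; rewrite mem_enum.
  apply: le_trans (h _ (enum_uniq _) sV); apply: Ex_le => [|w]; first exact: pe01.
  by rewrite big_enum.
elim: s => [|v s IH] /=.
  by move=> _ _; under Ex_eq do rewrite big_nil expR0; rewrite Ex_cst.
move=> /andP[vs us] sub.
have vV : v \in V1 by apply: sub; exact: mem_head.
have subs : {subset s <= V1} by move=> x xs; apply: sub; rewrite inE xs orbT.
apply: le_trans (IH us subs).
set G := fun w => expR (\sum_(x <- s) phi (d1 w x) (d2 w x)).
rewrite -(Ex_avgs pe [seq eix v u | u <- enum (~: V1)]).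
apply: Ex_le; first exact: pe01.
move=> w.
have en w' : d2 w' v = (\sum_(u <- enum (~: V1)) adj w' v u)%N.
  by rewrite /d2 big_enum.
rewrite (_ : (fun w => expR _) = (fun w => (fun x i => expR (phi x.1 i) * x.2)
   (d1 w v, G w) (\sum_(u <- enum (~: V1)) adj w v u)%N)); last first.
  by apply: boolp.funext => w'; rewrite big_cons expRD -en.
rewrite (@avgs_row (nat * R)%type v (fun w => (d1 w v, G w))
  (fun x i => expR (phi x.1 i) * x.2)) ?enum_uniq ?mem_enum ?inE ?vV //.
- rewrite /= -cardE.
  rewrite (@binE_ext _ _ _ _ (fun i => G w * expR (phi (d1 w v) i) + 0)); last first.
    by move=> i; rewrite addr0 mulrC.
  rewrite binE_lin binE_cst addr0 -[leRHS]mulr1; apply: ler_wpM2l; first exact: expR_ge0.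
  exact: hphi.
- move=> u; rewrite mem_enum inE => uV w'.
  have vu : v != u by apply: contraNneq uV => <-.
  have iv x : x \in V1 -> indep_fun (fun w => adj w v x) (eix v u).
    move=> xV; apply: adj_indep => vx; rewrite eix_eq2 // !xpair_eqE eqxx (negbTE vu) /=.
    by rewrite orbF; apply: contraNneq uV => <-.
  have io x y : x \in V1 -> x != v -> indep_fun (fun w => adj w x y) (eix v u).
    move=> xV xv; apply: adj_indep => xy; rewrite eix_eq2 // !xpair_eqE (negbTE xv) /=.
    by rewrite negb_and (_ : x != u) //; apply: contraNneq uV => <-.
  have e1 : d1 (eix v u |: w') v = d1 w' v.
    by apply: eq_bigr => x xV; rewrite (iv x xV w').1.
  have e2 : d1 (w' :\ eix v u) v = d1 w' v.
    by apply: eq_bigr => x xV; rewrite (iv x xV w').2.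
  have eg w2 : (w2 = eix v u |: w') \/ (w2 = w' :\ eix v u) -> G w2 = G w'.
    move=> hw; rewrite /G; congr expR; apply: eq_big_seq => x xs.
    have xV := subs x xs; have xv : x != v by apply: contraNneq vs => <-.
    by congr phi; apply: eq_bigr => y _; case: hw => ->; rewrite ?(io x y xV xv w').1 ?(io x y xV xv w').2.
  by rewrite e1 e2 !eg; [|right|left].
Qed.

End RowAverage.

(** * Certificates for events of high probability *)

Section HighProbability.
Variables (R : realType) (I : finType) (pr : I -> R).
Hypothesis pr01 : forall i, 0 <= pr i <= 1.
Implicit Types (P Q : {set I} -> Prop) (T : R).

(** [h] is a Markov certificate: [P] can fail only where [h > T]. The event may be any proposition,
    in particular one quantified over all choices of the adversary, and certificates of two events
    are combined by averaging, at the price of halving [T]. *)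
Definition whp T P := exists h : {set I} -> R,
  [/\ forall w, 0 <= h w, Ex pr h <= 1 & forall w, h w <= T -> P w].

Lemma whp_and T P Q : whp T P -> whp T Q -> whp (T / 2) (fun w => P w /\ Q w).
Proof.
move=> [h [h0 h1 hP]] [g [g0 g1 gQ]]; exists (fun w => 2^-1 * (h w + g w)); split.
- by move=> w; rewrite mulr_ge0 ?invr_ge0 // addr_ge0.
- by rewrite ExZl ExD; lra.
- move=> w; have := h0 w; have := g0 w => ? ? ?.
  by split; [apply: hP|apply: gQ]; lra.
Qed.

Lemma whp_le T T' P Q : T' <= T -> (forall w, P w -> Q w) -> whp T P -> whp T' Q.
Proof.
move=> TT PQ [h [h0 h1 hP]]; exists h; split=> // w hw; apply/PQ/hP; exact: le_trans hw TT.
Qed.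

Lemma whp_Ex T P (ev : {set I} -> bool) : 0 < T -> whp T P -> (forall w, P w -> ev w) ->
  1 - T^-1 <= Ex pr (fun w => (ev w)%:R).
Proof.
move=> T0 [h [h0 h1 hP]] Pev.
have : Ex pr (fun w => 1 - T^-1 * h w) <= Ex pr (fun w => (ev w)%:R).
  apply: Ex_le => // w; have [hw|hw] := leP (h w) T.
    by rewrite (Pev w (hP w hw)) /= gerBl mulr_ge0 ?invr_ge0 // ltW.
  apply: (@le_trans _ _ 0); last by case: (ev w).
  rewrite subr_le0 mulrC ler_pdivlMr // mul1r.
  exact: ltW.
rewrite (_ : Ex pr (fun w => 1 - T^-1 * h w) = 1 - T^-1 * Ex pr h); last first.
  transitivity (Ex pr (fun=> 1) + Ex pr (fun w => - T^-1 * h w)).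
    by rewrite -ExD; apply: Ex_eq => w; ring.
  by rewrite Ex_cst ExZl mulNr.
move=> hh; apply: le_trans hh; by rewrite lerD2l lerN2 ler_piMr // invr_ge0 ltW.
Qed.

(** Union bound: the certificate is the normalised sum of the exponentials. *)
Lemma whp_unif (J : finType) (f : J -> {set I} -> R) (t b : R) :
    #|J|%:R <= expR b -> (forall j, Ex pr (fun w => expR (f j w)) <= 1) ->
  whp (expR t) (fun w => forall j, f j w <= t + b).
Proof.
move=> hJ hf.
exists (fun w => expR (- b) * \sum_j expR (f j w)); split.
- by move=> w; rewrite mulr_ge0 ?expR_ge0 // sumr_ge0 // => j _; exact: expR_ge0.
- rewrite ExZl Ex_sum; apply: le_trans (_ : expR (- b) * \sum_(j : J) 1 <= _).
    by apply: ler_wpM2l; [exact: expR_ge0|apply: ler_sum].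
  rewrite sumr_const; apply: le_trans (ler_wpM2l (expR_ge0 _) hJ) _.
  by rewrite -expRD addNr expR0.
- move=> w h j; rewrite -ler_expR expRD.
  have : expR (f j w) <= \sum_j expR (f j w).
    rewrite (bigD1 j) //= lerDl; apply: sumr_ge0 => i _; exact: expR_ge0.
  move: h; rewrite expRN mulrC ler_pdivrMr ?expR_gt0 // => h1 h2; exact: le_trans h2 h1.
Qed.

End HighProbability.

(** * Concentration of degrees and of cut forms *)

Section GraphEvents.
Variables (R : realType) (n : nat) (p : R).
Hypothesis p01 : 0 <= p <= 1.
Local Notation I := ('I_n * 'I_n)%type.
Local Notation pe := (@pe R n p).
Local Notation W := (@W R n p).
Implicit Types (w : {set I}) (u v : 'I_n).

Definition pq : R := p * (1 - p).

Lemma pq_ge0 : 0 <= pq.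
Proof. by case/andP: p01 => *; rewrite mulr_ge0 // subr_ge0. Qed.

Lemma pq_le : pq <= 1 / 4.
Proof. by have := sqr_ge0 (p - 1 / 2); rewrite /pq; lra. Qed.

Lemma whp_lin (J : finType) (c : J -> 'I_n -> 'I_n -> R) (V : J -> R) (t b : R) :
    (forall j u v, `|c j u v + c j v u| <= 1 / 3) ->
    (forall j, 2 * pq * \sum_u \sum_v c j u v ^+ 2 <= V j) ->
    2 * #|J|%:R <= expR b ->
  whp pe (expR t) (fun w => forall j, `|lin p (c j) w| <= V j + (t + b)).
Proof.
move=> hc hV hJ.
pose f (jb : J * bool) w := (if jb.2 then lin p (c jb.1) w else - lin p (c jb.1) w) - V jb.1.
have := @whp_unif R _ pe (J * bool)%type f t b.
rewrite card_prod card_bool natrM mulrC => /(_ hJ); case.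
  move=> [j sg]; rewrite /f /=.
  have aux c0 : (forall u v, `|c0 u v + c0 v u| <= 1 / 3) ->
      2 * pq * \sum_u \sum_v c0 u v ^+ 2 <= V j ->
      Ex pe (fun w => expR (lin p c0 w - V j)) <= 1.
    move=> hc' hV'.
    apply: (@le_trans _ _ (expR (- V j) * Ex pe (fun w => expR (lin p c0 w)))).
      rewrite -ExZl; apply: Ex_le; first exact: pe01.
      by move=> w; rewrite addrC expRD.
    apply: le_trans (ler_wpM2l (expR_ge0 _) (Ex_expR_lin p01 hc')) _.
    rewrite -expRD -[leRHS]expR0 ler_expR.
    by move: hV'; rewrite /pq; lra.
  case: sg; first by apply: aux.
  have e w : - lin p (c j) w = lin p (fun u v => - c j u v) w.
    rewrite /lin -sumrN; apply: eq_bigr => u _.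
    by rewrite -sumrN; apply: eq_bigr => v _; rewrite mulNr.
  rewrite (_ : (fun w => _) = (fun w => expR (lin p (fun u v => - c j u v) w - V j))).
    apply: aux => [u v|]; first by rewrite -opprD normrN.
    apply: le_trans (hV j); rewrite le_eqVlt; apply/orP; left; apply/eqP; congr (_ * _).
    by apply: eq_bigr => u _; apply: eq_bigr => v _; rewrite sqrrN.
  by apply: boolp.funext => w; rewrite e.
move=> h [h0 h1 h2]; exists h; split=> // w hw j; rewrite ler_norml.
have := h2 w hw (j, true); have := h2 w hw (j, false); rewrite /f /= => ? ?.
by apply/andP; split; lra.
Qed.

Definition dt w v : R := \sum_u W w v u.

Lemma dtE w v : (0 < n)%N -> dt w v = (dg w v)%:R - (n%:R - 1) * p.
Proof.
move=> n0; rewrite /dt /dg (bigD1 v) //= /W eqxx add0r.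
rewrite (eq_bigr (fun u => (adj w v u)%:R - p)) => [|u uv]; last by rewrite eq_sym (negbTE uv).
have a0 : adj w v v = false by rewrite /adj eqxx.
rewrite sumrB sumr_const [in RHS](bigD1 v) //= a0 add0n natr_sum; congr (_ - _).
have := cardC1 v; rewrite card_ord => h.
have e : #|(fun i : 'I_n => i != v)| = n.-1 by rewrite -h; apply: eq_card.
by rewrite e -subn1 -(mulr_natl p) natrB.
Qed.

Lemma whp_deg (l t b : R) : 0 <= l <= 1 / 6 -> 2 * n%:R <= expR b ->
  whp pe (expR t) (fun w => forall v, l * `|dt w v| <= 2 * pq * n%:R * l ^+ 2 + (t + b)).
Proof.
move=> /andP[l0 l6] hb.
pose c (v u u' : 'I_n) : R := if u == v then l else 0.
have hc v u u' : `|c v u u' + c v u' u| <= 1 / 3.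
  by rewrite /c; case: ifP => _; case: ifP => _; rewrite ?addr0 ?add0r ger0_norm; lra.
have hV v : 2 * pq * \sum_u \sum_u' c v u u' ^+ 2 <= 2 * pq * n%:R * l ^+ 2.
  rewrite -[leRHS]mulrA; apply: ler_wpM2l; first by rewrite mulr_ge0 // pq_ge0.
  rewrite (bigD1 v) //= [X in _ + X]big1 => [|u uv].
    by rewrite addr0 /c eqxx sumr_const card_ord mulr_natl.
  by rewrite big1 // => u' _; rewrite /c (negbTE uv) expr0n.
apply: (whp_le (lexx _) _ (@whp_lin _ c (fun=> 2 * pq * n%:R * l ^+ 2) t b hc hV _)).
  move=> w h v; have := h v; rewrite (_ : lin p (c v) w = l * dt w v).
    by rewrite normrM ger0_norm.
  rewrite /lin (bigD1 v) //= [X in _ + X]big1 ?addr0 => [|u uv].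
    by rewrite /dt mulr_sumr; apply: eq_bigr => u _; rewrite /c eqxx.
  by rewrite big1 // => u' _; rewrite /c (negbTE uv) mul0r.
by rewrite card_ord.
Qed.

Definition fX (X Y : {set 'I_n}) w : R := form (W w) (ind R X) (ind R Y).

Lemma lin_ind (X Y : {set 'I_n}) (l : R) w :
  lin p (fun u v => l * (ind R X u * ind R Y v)) w = l * fX X Y w.
Proof.
rewrite /lin /fX /form mulr_sumr; apply: eq_bigr => u _.
by rewrite mulr_sumr; apply: eq_bigr => v _; rewrite -mulrA.
Qed.

Lemma sum_ind (X : {set 'I_n}) : \sum_u ind R X u = #|X|%:R.
Proof.
rewrite -sum1_card natr_sum [RHS]big_mkcond; apply: eq_bigr => u _.
by rewrite /ind; case: (u \in X).
Qed.

Lemma sum_ind_sq (X Y : {set 'I_n}) (l : R) :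
  \sum_u \sum_v (l * (ind R X u * ind R Y v)) ^+ 2 = l ^+ 2 * (#|X|%:R * #|Y|%:R).
Proof.
have sq S u : ind R S u ^+ 2 = ind R S u.
  by rewrite /ind; case: (u \in S); rewrite /= ?expr0n ?expr1n.
rewrite -!sum_ind mulr_suml mulr_sumr; apply: eq_bigr => u _.
rewrite !mulr_sumr; apply: eq_bigr => v _; rewrite !exprMn !sq; ring.
Qed.

Lemma ind_coef_le (X Y : {set 'I_n}) (l : R) u v : 0 <= l <= 1 / 6 ->
  `|l * (ind R X u * ind R Y v) + l * (ind R X v * ind R Y u)| <= 1 / 3.
Proof.
move=> /andP[l0 l6]; rewrite /ind.
by case: (u \in X); case: (v \in X); case: (u \in Y); case: (v \in Y);
  rewrite /= ?mulr1n ?mulr0n ger0_norm; lra.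
Qed.

Lemma whp_cut (l t b : R) : 0 <= l <= 1 / 6 -> 2 * 2 ^+ n * 2 ^+ n <= expR b ->
  whp pe (expR t) (fun w => forall X Y : {set 'I_n},
    l * `|fX X Y w| <= 2 * pq * l ^+ 2 * (#|X|%:R * #|Y|%:R) + (t + b)).
Proof.
move=> hl hb; have /andP[l0 l6] := hl.
pose J := ({set 'I_n} * {set 'I_n})%type.
pose c (j : J) u v : R := l * (ind R j.1 u * ind R j.2 v).
apply: (whp_le (lexx _) _ (@whp_lin J c (fun j => 2 * pq * l ^+ 2 * (#|j.1|%:R * #|j.2|%:R)) t b _ _ _)).
- move=> w h X Y; have := h (X, Y); rewrite lin_ind normrM ger0_norm //.
- by move=> j u v; exact: ind_coef_le.
- by move=> j; rewrite sum_ind_sq -!mulrA.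
have e : #|{set 'I_n}| = (2 ^ n)%N by rewrite -cardsT -powersetT card_powerset cardsT card_ord.
by rewrite card_prod e natrM natrX mulrA.
Qed.

Lemma whp_cut_size (m : nat) (l t b : R) : 0 <= l <= 1 / 6 -> 2 * 'C(n, m)%:R <= expR b ->
  whp pe (expR t) (fun w => forall X : {set 'I_n}, #|X| = m ->
    l * `|fX X X w| <= 2 * pq * l ^+ 2 * (m%:R * m%:R) + (t + b)).
Proof.
move=> hl hb; have /andP[l0 l6] := hl.
pose J := {X : {set 'I_n} | #|X| == m}.
pose c (j : J) u v : R := l * (ind R (val j) u * ind R (val j) v).
apply: (whp_le (lexx _) _ (@whp_lin J c (fun j => 2 * pq * l ^+ 2 * (m%:R * m%:R)) t b _ _ _)).
- move=> w h X /eqP Xm; have := h (Sub X Xm); rewrite lin_ind normrM ger0_norm //.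
- by move=> j u v; exact: ind_coef_le.
- by move=> j; rewrite sum_ind_sq -!mulrA (eqP (valP j)).
rewrite card_sig (_ : #|_| = 'C(n, m)) //.
by have := card_draws 'I_n m; rewrite card_ord => <-; apply: eq_card => X; rewrite !inE.
Qed.

Lemma whp_total (t b : R) : (0 < n)%N -> 2 <= expR b ->
  whp pe (expR t) (fun w => `|fX setT setT w| <= 6 * n%:R * (1 + (t + b))).
Proof.
move=> n0 hb; have n0' : 1 <= n%:R :> R by rewrite ler1n.
set l : R := (6 * n%:R)^-1.
have l0 : 0 < l by rewrite invr_gt0; lra.
have l6 : l <= 1 / 6 by rewrite /l div1r lef_pV2 ?posrE; lra.
have hl : 0 <= l <= 1 / 6 by rewrite l6 ltW.
pose c (j : unit) u v : R := l * (ind R setT u * ind R setT v).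
apply: (whp_le (lexx _) _ (@whp_lin unit c (fun=> 1) t b _ _ _)).
- move=> w /(_ tt); rewrite lin_ind normrM (ger0_norm (ltW l0)) => h.
  rewrite mulrC -ler_pdivrMr; last by lra.
  by rewrite mulrC; exact: h.
- by move=> j u v; exact: ind_coef_le.
- move=> j; rewrite sum_ind_sq cardsT card_ord.
  have -> : l ^+ 2 * (n%:R * n%:R) = 1 / 36 by rewrite /l; field; rewrite gt_eqF //; lra.
  by have := pq_le; lra.
by rewrite card_unit mulr1.
Qed.

End GraphEvents.

(** * Clipped degree sums, degree levels and the switching statistic *)

Section MoreEvents.
Variables (R : realType) (n : nat) (p : R).
Hypothesis p01 : 0 <= p <= 1.
Local Notation I := ('I_n * 'I_n)%type.
Local Notation pe := (@pe R n p).
Local Notation W := (@W R n p).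
Local Notation pq := (pq p).
Implicit Types (w : {set I}) (u v a b c d : 'I_n).

Lemma clip_lip (m t i j : nat) : (j <= i)%N ->
  `|clip R m t i - clip R m t j| <= i%:R - j%:R.
Proof.
move=> ji; rewrite /clip ler_norml.
have h1 : (i - (m + t) + (m - t - j) <= j - (m + t) + (m - t - i) + (i - j))%N by lia.
have h2 : (j - (m + t) + (m - t - i) <= i - (m + t) + (m - t - j))%N by lia.
have h3 : (i - j)%:R = i%:R - j%:R :> R by rewrite natrB.
move: h1 h2; rewrite -2!(ler_nat R) !natrD h3 => h1 h2.
have : 0 <= i%:R - j%:R :> R by rewrite subr_ge0 ler_nat.
by move=> h4; apply/andP; lra.
Qed.

Lemma dg_toggle_le i w v : (dg (w :\ i) v <= dg (i |: w) v)%N.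
Proof.
apply: leq_sum => u _; rewrite adjU adjD.
by case: (adj w v u) => //=; rewrite orbT; case: (_ != _).
Qed.

Lemma sum_dg_toggle i w : (0 < n)%N ->
  \sum_v ((dg (i |: w) v)%:R - (dg (w :\ i) v)%:R) <= 2 :> R.
Proof.
move=> n0; have := lin_toggle p (fun _ _ => 1) i w.
rewrite /lin -sumrB => e.
rewrite (_ : \sum_v _ = if (i.1 < i.2)%N then 1 + 1 else 0).
  by case: ifP => _; lra.
rewrite -e; apply: eq_bigr => v _; rewrite -!mulr_sumr !mul1r.
by rewrite -/(dt p (i |: w) v) -/(dt p (w :\ i) v) !dtE //; ring.
Qed.

Lemma Ex_dg (phi : nat -> R) v : Ex pe (fun w => phi (dg w v)) = binE n.-1 p phi.
Proof.
pose s := enum (predC1 v).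
rewrite -(Ex_avgs pe [seq eix v u | u <- s]) -[RHS](Ex_cst pe); apply: Ex_eq => w.
rewrite (_ : (fun w => phi (dg w v))
   = (fun w => (fun (x : unit) i => phi i) tt (\sum_(u <- s) adj w v u)%N)); last first.
  apply: boolp.funext => w'; congr phi; rewrite /dg (bigD1 v) //= {1}/adj eqxx add0n.
  by rewrite /s big_enum /=.
rewrite (@avgs_row R n p unit v (fun=> tt) (fun _ i => phi i)) ?enum_uniq ?mem_enum ?inE ?eqxx //.
by rewrite -cardE cardC1 card_ord.
Qed.

(** The mean is at most [5 n] by [binE_clip]. One edge raises the total degree by [2] and lowers no
    degree, so the clipped sum is 2-Lipschitz in each of the at most [n^2] coordinates, and a tilt
    of order [1 / n] gives fluctuations [O(n log n)]. *)
Lemma whp_clip (m0 : nat) (t b : R) : (0 < n)%N ->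
    m0%:R <= n.-1%:R * p -> n.-1%:R * p < m0%:R + 1 -> 2 * n.+1%:R <= expR b ->
  whp pe (expR t) (fun w => forall i : 'I_n.+1,
    `|\sum_v clip R m0 i (dg w v)| <= 5 * n%:R + 6 * n%:R * (1 + (t + b))).
Proof.
move=> n0 m1 m2 hb; have n1 : 1 <= n%:R :> R by rewrite ler1n.
set l : R := (6 * n%:R)^-1.
have l0 : 0 < l by rewrite invr_gt0; lra.
have l6 : l <= 1 / 6 by rewrite /l div1r lef_pV2 ?posrE; lra.
pose F (i : 'I_n.+1) w : R := \sum_v clip R m0 i (dg w v).
pose EF (i : 'I_n.+1) : R := n%:R * binE n.-1 p (clip R m0 i).
have eEF i : Ex pe (F i) = EF i.
  rewrite /F Ex_sum (eq_bigr (fun=> binE n.-1 p (clip R m0 i))).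
    by rewrite sum_ord_cst.
  by move=> v _; rewrite Ex_dg.
have lipF i e w : `|F i (e |: w) - F i (w :\ e)| <= 2.
  rewrite /F -sumrB; apply: le_trans (ler_norm_sum _ _ _) _.
  apply: le_trans (sum_dg_toggle e w n0); apply: ler_sum => v _.
  exact: clip_lip (dg_toggle_le e w v).
have main (i : 'I_n.+1) (s : R) : `|s| = l ->
    Ex pe (fun w => expR (s * (F i w - EF i) - 1)) <= 1.
  move=> hs.
  have lip2 e w : `|(s * (F i (e |: w) - EF i) - 1) - (s * (F i (w :\ e) - EF i) - 1)| <= 2 * l.
    rewrite (_ : _ - _ = s * (F i (e |: w) - F i (w :\ e))); last by ring.
    rewrite normrM hs mulrC; apply: ler_wpM2r; [exact: ltW|exact: lipF].
  have hc (e : I) : 2 * l <= 1 / 3 by lra.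
  have h := @Ex_expR_lip R _ pe (pe01 p01) (fun w => s * (F i w - EF i) - 1) (fun=> 2 * l) lip2 hc.
  apply: le_trans h _; clear hc.
  rewrite (_ : Ex pe (fun w => s * (F i w - EF i) - 1) = -1); last first.
    transitivity (s * Ex pe (F i) + Ex pe (fun=> - (s * EF i) - 1)).
      by rewrite -ExZl -ExD; apply: Ex_eq => w; ring.
    by rewrite eEF Ex_cst; ring.
  rewrite -[leRHS]expR0 ler_expR.
  have : \sum_(e : I) pe e * (1 - pe e) * (2 * l) ^+ 2 <= \sum_(e : I) (1 / 4 * (2 * l) ^+ 2).
    apply: ler_sum => e _; apply: ler_wpM2r; first exact: sqr_ge0.
    by move: (pe e) => z; have := sqr_ge0 (z - 1 / 2); lra.
  rewrite sumr_const card_prod card_ord -(mulr_natl (1 / 4 * (2 * l) ^+ 2)) natrM.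
  have -> : n%:R * n%:R * (1 / 4 * (2 * l) ^+ 2) = 1 / 36.
    by rewrite /l; field; rewrite gt_eqF //; lra.
  lra.
pose f (j : 'I_n.+1 * bool) w := (if j.2 then l else - l) * (F j.1 w - EF j.1) - 1.
have := @whp_unif R _ pe ('I_n.+1 * bool)%type f t b.
rewrite card_prod card_bool card_ord natrM mulrC => /(_ hb).
case.
  by move=> [i sg]; apply: main; case: sg; rewrite ?normrN ger0_norm // ltW.
move=> h [h0 h1 h2]; exists h; split=> // w hw i.
have hE : `|EF i| <= 5 * n%:R.
  by rewrite /EF normrM ger0_norm // mulrC ler_pM2r ?binE_clip // (lt_le_trans _ n1).
have k1 := h2 w hw (i, true); have k2 := h2 w hw (i, false); rewrite /f /= in k1 k2.
rewrite -/(F i w).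
have k3 : `|F i w - EF i| <= 6 * n%:R * (1 + (t + b)).
  rewrite mulrC -ler_pdivrMr; last by lra.
  have -> : `|F i w - EF i| / (6 * n%:R) = `|l * (F i w - EF i)|.
    by rewrite normrM (ger0_norm (ltW l0)) mulrC.
  by rewrite ler_norml; apply/andP; split; lra.
apply: le_trans (lerD hE k3); rewrite addrC -[X in `|X|](subrK (EF i)).
exact: ler_normD.
Qed.

Lemma whp_zone (V1 : {set 'I_n}) (K r s k k' t b : R) : 16 * 12 ^+ 4 <= K ->
    0 < p < 1 -> 1 <= s -> s ^+ 2 = #|~: V1|%:R * p * (1 - p) -> 1 <= r ->
    k = 6 * K * r / s -> k' = 3 * K * (r ^+ 3)^-1 / s -> k <= 1 / 3 ->
    2 * n%:R <= expR b ->
  whp pe (expR t) (fun w => forall j : 'I_n,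
    \sum_(v in V1) ((dg w v == j)%:R - k * (j <= dg w v)%N%:R - k') <= t + b /\
    \sum_(v in V1) ((dg w v == j)%:R - k * (dg w v <= j)%N%:R - k') <= t + b).
Proof.
move=> hK p01' s1 s2 r1 ek ek' k3 hb.
pose f (j : 'I_n * bool) w : R := if j.2
  then \sum_(v in V1) ((dg w v == j.1)%:R - k * (j.1 <= dg w v)%N%:R - k')
  else \sum_(v in V1) ((dg w v == j.1)%:R - k * (dg w v <= j.1)%N%:R - k').
have := @whp_unif R _ pe ('I_n * bool)%type f t b.
rewrite card_prod card_bool card_ord natrM mulrC => /(_ hb); case.
  move=> [j [|]]; rewrite /f /=.
    pose phi (m l : nat) : R := (m + l == j)%N%:R - k * (j <= m + l)%N%:R - k'.
    rewrite (_ : (fun w => _) = (fun w => expR (\sum_(v in V1) phi (d1 V1 w v) (d2 V1 w v)))).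
      apply: Ex_rows => // m; exact: (binE_zone_up m j hK p01' s1 s2 r1 ek ek' k3).
    by apply: boolp.funext => w; congr expR; apply: eq_bigr => v _; rewrite /phi -dg_split.
  pose phi (m l : nat) : R := (m + l == j)%N%:R - k * (m + l <= j)%N%:R - k'.
  rewrite (_ : (fun w => _) = (fun w => expR (\sum_(v in V1) phi (d1 V1 w v) (d2 V1 w v)))).
    apply: Ex_rows => // m; exact: (binE_zone_down m j hK p01' s1 s2 r1 ek ek' k3).
  by apply: boolp.funext => w; congr expR; apply: eq_bigr => v _; rewrite /phi -dg_split.
move=> h [h0 h1 h2]; exists h; split=> // w hw j.
by split; [have := h2 w hw (j, true)|have := h2 w hw (j, false)].
Qed.

Definition small (M : nat) w :=
  forall a b, (#|[set c | adj w a c != adj w b c]| <= M)%N.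

(** A weighted union bound: [H] is a prior on the indices that may depend on the degree sequence,
    and an index of weight at least [exp (- e)] pays only [e]. *)
Lemma whp_swap (J : finType) (M : nat) (H : J -> {ffun 'I_n -> nat} -> R)
    (lam : J -> R) (X Y : J -> {ffun 'I_n -> nat} -> {set 'I_n}) (t : R) :
    (0 < n)%N -> (0 < M)%N -> (forall j f, 0 <= H j f) ->
    (forall f, \sum_j H j f <= 1) -> (forall j, `|lam j| <= 1 / 3) ->
  whp pe (expR t) (fun w => small M w -> forall j (e : R), expR (- e) <= H j (dgf w) ->
    lam j * Zd R (X j) (Y j) w - lam j ^+ 2 * Vd R (X j) (Y j) w
      <= 16 * n%:R * M%:R * (t + e)).
Proof.
move=> n0 M0 H0 H1 hl.
pose Phi j := swPhi M (fun=> lam j) (X j) (Y j).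
exists (fun w => \sum_j H j (dgf w) * expR (Phi j w)); split.
- by move=> w; apply: sumr_ge0 => j _; rewrite mulr_ge0 ?expR_ge0.
- rewrite Ex_sum; apply: (@le_trans _ _ (\sum_j Ex pe (fun w => H j (dgf w)))).
    by apply: ler_sum => j _; apply: swap_exp.
  rewrite -Ex_sum -[leRHS](Ex_cst pe); apply: Ex_le => [|w]; [exact: pe01|exact: H1].
move=> w hw sm j e he.
have g := swPhi_ge (fun=> lam j) (X j) (Y j) n0 M0 sm.
have h1 : H j (dgf w) * expR (Phi j w) <= expR t.
  apply: le_trans hw; rewrite (bigD1 j) //= lerDl; apply: sumr_ge0 => i _.
  by rewrite mulr_ge0 ?expR_ge0.
have h2 : Phi j w <= t + e.
  rewrite -ler_expR expRD.
  have := le_trans (ler_wpM2r (expR_ge0 (Phi j w)) he) h1.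
  by rewrite expRN mulrC ler_pdivrMr ?expR_gt0.
have nM : 0 < 16 * n%:R * M%:R :> R by rewrite !mulr_gt0 // ltr0n.
by have := le_trans g h2; rewrite ler_pdivrMr // (mulrC (t + e)).
Qed.

Lemma pW01 w u v : 0 <= p + W w u v <= 1.
Proof.
have /andP[p0 p1] := p01; rewrite /W; case: eqP => _; first by rewrite addr0.
by case: (adj w u v); rewrite /= ?mulr1n ?mulr0n; apply/andP; lra.
Qed.

Lemma W_le1 w u v : `|W w u v| <= 1.
Proof.
have /andP[p0 p1] := p01; have /andP[h1 h2] := pW01 w u v.
by rewrite ler_norml; apply/andP; lra.
Qed.

Lemma sw0_swp w a b c d : ~~ coinc a b c d -> sw0 R w a b c d = swp p (W w) a b c d.
Proof.
rewrite /coinc !negb_or => /and4P[ac ad bc bd].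
have e u v : u != v -> W w u v = (adj w u v)%:R - p by move=> uv; rewrite /W (negbTE uv).
rewrite /swp !e // /sw0.
by case: (adj w a c); case: (adj w b d); case: (adj w a d); case: (adj w b c);
  rewrite /= ?mulr1n ?mulr0n; ring.
Qed.

Lemma cform_Zd w (X Y : {ffun 'I_n -> nat} -> {set 'I_n}) (Lam : R) : 0 <= Lam ->
    (forall S : {set 'I_n}, l1bound (W w) Lam (ind R S)) ->
  `|Zd R X Y w - pq * n%:R ^+ 2 * cform (W w) (ind R (X (dgf w))) (ind R (Y (dgf w)))|
    <= 6 * Lam ^+ 2 + 8 * (n%:R ^+ 3 * pq + n%:R * Lam).
Proof.
move=> L0 hL.
have i1 S (a : 'I_n) : `|ind R S a| <= 1.
  by rewrite /ind; case: (_ \in _); rewrite /= ?mulr1n ?mulr0n ?normr1 ?normr0.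
have L1 : l1bound (W w) Lam (@one R n).
  have := hL setT; rewrite /l1bound (_ : ind R setT = @one R n) //.
  by apply: boolp.funext => a; rewrite /ind inE.
have := @sum4_nc_le R n p p01 (W w) (fun u v => WC p w u v) Lam L0 (ind R (X (dgf w))) (ind R (Y (dgf w)))
  (W_le1 w) (i1 _) (i1 _) (hL _) (hL _) L1 (pW01 w).
rewrite /pq; congr (`|_ - _| <= _); rewrite /Zd; apply: eq_sum4 => a b c d.
by case: (boolP (coinc a b c d)) => h; rewrite ?mul0r // sw0_swp.
Qed.

(** [B] is either adjacency or its negation. In both cases a quadruple in an alternating state has
    [ac] and [bd] in [B], or [ad] and [bc] in [B], and the two kinds are counted separately. *)
Lemma Vd_le w (X Y : {ffun 'I_n -> nat} -> {set 'I_n}) (B : 'I_n -> 'I_n -> bool) (D E : R) :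
    (B = adj w \/ B = (fun u v => ~~ adj w u v)) ->
    (forall u, \sum_v (B u v)%:R <= D) ->
    \sum_a \sum_c ind R (X (dgf w)) a * ind R (Y (dgf w)) c * (B a c)%:R <= E ->
  Vd R X Y w <= E * (n%:R * D) + #|X (dgf w)|%:R * #|Y (dgf w)|%:R * D ^+ 2.
Proof.
move=> hB hD hE; set x := ind R (X (dgf w)) in hE *; set y := ind R (Y (dgf w)) in hE *.
have x0 a : 0 <= x a by rewrite /x /ind.
have y0 a : 0 <= y a by rewrite /y /ind.
have BC a b : B a b = B b a by case: hB => ->; rewrite adjC.
pose F1 a b c d : R := x a * y c * (B a c)%:R * (B b d)%:R.
pose F2 a b c d : R := x a * (B a d)%:R * (y c * (B c b)%:R).
apply: (@le_trans _ _ (sum4 (fun a b c d => F1 a b c d + F2 a b c d))).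
  rewrite /Vd /sum4; apply: ler_sum => a _; apply: ler_sum => b _; apply: ler_sum => c _.
  apply: ler_sum => d _; rewrite /F1 /F2 -/x -/y.
  have -> : x a * y c * (B a c)%:R * (B b d)%:R + x a * (B a d)%:R * (y c * (B c b)%:R)
     = x a * y c * ((B a c)%:R * (B b d)%:R + (B a d)%:R * (B c b)%:R) by ring.
  rewrite mulrCA; apply: ler_wpM2l; first exact: mulr_ge0.
  rewrite (BC c b) /sw0.
  by case: hB => ->; case: (~~ coinc _ _ _ _); case: (adj w a c); case: (adj w b d);
    case: (adj w a d); case: (adj w b c); rewrite /= ?mulr1n ?mulr0n; lra.
rewrite sum4D; apply: lerD.
  have B0 : 0 <= n%:R * D.
    apply: le_trans (_ : \sum_(b < n) \sum_(d < n) (B b d)%:R <= _).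
      by apply: sumr_ge0 => b _; apply: sumr_ge0.
    by rewrite -(sum_ord_cst n); apply: ler_sum => b _.
  apply: (@le_trans _ _ (\sum_a \sum_c x a * y c * (B a c)%:R * (n%:R * D))); last first.
    under eq_bigr => a _ do rewrite -mulr_suml.
    by rewrite -mulr_suml; apply: ler_wpM2r.
  rewrite /sum4; apply: ler_sum => a _; rewrite exchange_big /=; apply: ler_sum => c _.
  rewrite /F1; under eq_bigr => b _ do rewrite -mulr_sumr.
  rewrite -mulr_sumr; apply: ler_wpM2l; first by rewrite !mulr_ge0.
  by rewrite -(sum_ord_cst n); apply: ler_sum => b _.
have -> : sum4 F2 = (\sum_a x a * \sum_d (B a d)%:R) * (\sum_c y c * \sum_b (B c b)%:R).
  rewrite /sum4 mulr_suml; apply: eq_bigr => a _.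
  rewrite exchange_big /= mulr_sumr; apply: eq_bigr => c _.
  transitivity (\sum_b (\sum_d x a * (B a d)%:R) * (y c * (B c b)%:R)).
    by apply: eq_bigr => b _; rewrite mulr_suml; apply: eq_bigr => d _.
  by rewrite -!mulr_sumr.
have sx S : 0 <= \sum_a ind R S a * \sum_d (B a d)%:R.
  by apply: sumr_ge0 => a _; rewrite mulr_ge0 ?sumr_ge0 // /ind.
rewrite expr2 mulrACA; apply: ler_pM; rewrite ?sx // -sum_ind mulr_suml;
  by apply: ler_sum => a _; apply: ler_wpM2l.
Qed.

End MoreEvents.

(** * Exchange between true and corrupted top sets *)

Section Exchange.
Variables (R : realType) (n : nat).
Implicit Types (d dA x : 'I_n -> R) (T B : {set 'I_n}).

Definition top d T := forall u v, u \in T -> v \notin T -> d v <= d u.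

Lemma top_threshold d T : (#|T| < n)%N -> top d T -> exists2 v0, v0 \notin T &
  (forall v, v \notin T -> d v <= d v0) /\ (forall u, u \in T -> d v0 <= d u).
Proof.
move=> Tn hT.
have [v1 v1T] : exists v1, v1 \notin T.
  apply/existsP; rewrite -negb_forall; apply: contraL Tn => /forallP h.
  rewrite -leqNgt -{1}(card_ord n) -cardsT; apply: subset_leq_card.
  by apply/subsetP => v _; exact: h.
pose s := [arg max_(v > v1 | v \notin T) d v]%O.
exists s; rewrite /s; case: arg_maxP => // v vT hmax //.
by split=> [v' v'T|u uT]; [exact: hmax|exact: hT].
Qed.

Lemma card_setD_eq T T' : #|T| = #|T'| -> #|T :\: T'| = #|T' :\: T|.
Proof.
move=> h; have := cardsID T' T; have := cardsID T T'; rewrite h setIC => <-.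
by move/addnI.
Qed.

Lemma sum_setD d T T' : \sum_(v in T) d v - \sum_(v in T') d v
  = \sum_(v in T :\: T') d v - \sum_(v in T' :\: T) d v.
Proof.
rewrite (big_setID T') [X in _ - X](big_setID T) /= setIC; ring.
Qed.

Lemma top_sum_max d T T' : #|T| = #|T'| -> (#|T| < n)%N -> top d T ->
  \sum_(v in T') d v <= \sum_(v in T) d v.
Proof.
move=> hc hn hT; have [v0 _ [h1 h2]] := top_threshold hn hT.
rewrite -subr_ge0 sum_setD subr_ge0.
apply: (@le_trans _ _ (\sum_(v in T' :\: T) d v0)).
  by apply: ler_sum => v; rewrite inE => /andP[vT _]; exact: h1.
rewrite sumr_const -card_setD_eq // -sumr_const.
by apply: ler_sum => v; rewrite inE => /andP[_ vT]; exact: h2.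
Qed.

Lemma sum_le_shift (T B : {set 'I_n}) (f : 'I_n -> R) (c k w e : R) :
    0 <= w -> 0 <= e -> #|T|%:R <= k -> #|B|%:R <= w ->
    (forall v, v \in T -> v \notin B -> f v <= c + w) ->
    (forall v, v \in T -> v \in B -> f v <= c + w + e) ->
  \sum_(v in T) f v <= #|T|%:R * c + k * w + w * e.
Proof.
move=> w0 e0 hk hB h1 h2.
apply: (@le_trans _ _ (\sum_(v in T) ((c + w) + (v \in B)%:R * e))).
  apply: ler_sum => v vT; case: (boolP (v \in B)) => vB; rewrite /= ?mul1r ?mul0r ?addr0.
    exact: h2.
  exact: h1.
rewrite big_split /= sumr_const -mulr_suml -(mulr_natl (c + w)) mulrDr.
have e1 : \sum_(v in T) (v \in B)%:R <= w.
  apply: le_trans hB; rewrite -sum1_card natr_sum big_mkcond [leRHS]big_mkcond.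
  by apply: ler_sum => v _; case: (v \in T); case: (v \in B).
by rewrite lerD ?ler_wpM2r // lerD2l ler_wpM2r.
Qed.

Lemma abs_near (mu eta w y z : R) : `|y - mu| <= eta + w -> 0 <= w -> `|z - mu| <= eta ->
  z <= y + w + 2 * (eta + w) /\ - z <= - y + w + 2 * (eta + w).
Proof.
rewrite !ler_norml => /andP[y1 y2] y3 /andP[z1 z2]; split; lra.
Qed.

Variables (d dA : 'I_n -> R) (B T Ts : {set 'I_n}) (mu eta w : R).
Hypotheses (w0 : 0 <= w) (eta0 : 0 <= eta) (hB : #|B|%:R <= w)
  (hwT : w <= #|T|%:R) (hn : #|T|%:R + w < n%:R)
  (hd : forall v, `|d v - mu| <= eta)
  (hdA : forall v, v \notin B -> `|dA v - d v| <= w)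
  (hT : top dA T).

Let Tn : (#|T| < n)%N.
Proof. by rewrite -(ltr_nat R); apply: le_lt_trans hn; rewrite lerDl. Qed.

(** The threshold is squeezed between degrees of uncorrupted vertices, which are within [eta + w] of
    [mu]. *)
Lemma threshold_bounds v0 : v0 \notin T -> (forall v, v \notin T -> dA v <= dA v0) ->
    (forall u, u \in T -> dA v0 <= dA u) ->
  `|dA v0 - mu| <= eta + w.
Proof.
move=> v0T h1 h2.
have good v : v \notin B -> `|dA v - mu| <= eta + w.
  move=> vB; have := hdA vB; have := hd v; rewrite !ler_norml => /andP[? ?] /andP[? ?].
  by apply/andP; lra.
have [vl vlT vlB] : exists2 v, v \notin T & v \notin B.
  have : (#|T :|: B| < n)%N.
    rewrite -(ltr_nat R); apply: le_lt_trans hn; apply: (@le_trans _ _ (#|T| + #|B|)%:R).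
      by rewrite ler_nat; apply: leq_card_setU.
    by rewrite natrD lerD2l.
  move=> hc; have : exists v, v \notin T :|: B.
    apply/existsP; rewrite -negb_forall; apply: contraL hc => /forallP h.
    rewrite -leqNgt -{1}(card_ord n) -cardsT; apply: subset_leq_card.
    by apply/subsetP => v _; exact: h.
  by case=> v; rewrite inE negb_or => /andP[? ?]; exists v.
have lo : mu - (eta + w) <= dA v0.
  apply: le_trans (h1 vl vlT); have := good vl vlB; rewrite ler_norml => /andP[? ?]; lra.
have hi : dA v0 <= mu + (eta + w).
  (* If [T] has only corrupted vertices, then [T = B] because [|B| <= w <= |T|], and the threshold
     vertex itself is uncorrupted. *)
  case: (boolP (T \subset B)) => TB.
    have eT : T = B.
      apply/eqP; rewrite eqEcard TB /=; rewrite -(ler_nat R); exact: le_trans hB hwT.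
    have := good v0; rewrite -eT => /(_ v0T); rewrite ler_norml => /andP[? ?]; lra.
  have /subsetPn[u uT uB] := TB.
  apply: le_trans (h2 u uT) _; have := good u uB; rewrite ler_norml => /andP[? ?]; lra.
by rewrite ler_norml; apply/andP; split; lra.
Qed.

(** An uncorrupted vertex on which the two sets differ has true degree within [w] of the threshold
    on the relevant side; the at most [w] corrupted ones deviate by [O(eta + w)] each. *)
Lemma top_exchange : #|Ts| = #|T| -> top d Ts ->
  `|\sum_(v in T) d v - \sum_(v in Ts) d v| <= 2 * #|T|%:R * w + 4 * w * (eta + w).
Proof.
move=> hc hTs; have [v0 v0T [h1 h2]] := top_threshold Tn hT.
have hb := threshold_bounds v0T h1 h2; set b := dA v0 in h1 h2 hb.
have Tsn : (#|Ts| < n)%N by rewrite hc.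
have mx : \sum_(v in T) d v <= \sum_(v in Ts) d v by apply: top_sum_max.
rewrite distrC ger0_norm ?subr_ge0 //.
have e0 : 0 <= 2 * (eta + w) by rewrite mulr_ge0 // addr_ge0.
have kk (S S' : {set 'I_n}) : #|S|%:R <= #|T|%:R :> R -> #|S :\: S'|%:R <= #|T|%:R :> R.
  by move=> h; apply: le_trans h; rewrite ler_nat; apply: subset_leq_card; exact: subsetDl.
have a1 : \sum_(v in Ts :\: T) d v <= #|Ts :\: T|%:R * b + #|T|%:R * w + w * (2 * (eta + w)).
  apply: (sum_le_shift (B := B)) => //; first by apply: kk; rewrite hc.
    move=> v; rewrite inE => /andP[vT _] vB; have := h1 v vT; have := hdA vB.
    by rewrite ler_norml => /andP[? ?] ?; lra.
  by move=> v _ _; have [? ?] := abs_near hb w0 (hd v).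
have a2 : \sum_(v in T :\: Ts) (- d v) <= #|T :\: Ts|%:R * (- b) + #|T|%:R * w + w * (2 * (eta + w)).
  apply: (sum_le_shift (B := B)) => //; first by apply: kk.
    move=> v; rewrite inE => /andP[_ vT] vB; have := h2 v vT; have := hdA vB.
    by rewrite ler_norml => /andP[? ?] ?; lra.
  by move=> v _ _; have [? ?] := abs_near hb w0 (hd v).
rewrite sumrN (card_setD_eq (esym hc)) in a2.
by rewrite sum_setD; lra.
Qed.

End Exchange.

(** * Trimmed sums through soft thresholding *)

Section TrimmedSums.
Variables (R : realType) (n : nat).
Implicit Types (x : 'I_n -> R) (T L : {set 'I_n}).

Definition pos (y : R) : R := Num.max y 0.

Lemma posE y : pos y = y + pos (- y).
Proof. by rewrite /pos; case: (leP y 0); case: (leP (- y) 0); lra. Qed.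

Definition gt (tau y : R) : R := pos (y - tau) - pos (- y - tau).

(** Reduces negative thresholds to positive ones, at the cost of the plain sum. *)
Lemma gtN (s y : R) : gt (- s) y = 2 * y - gt s y.
Proof.
rewrite /gt (posE (y - - s)) (posE (- y - - s)).
have -> : - (y - - s) = - y - s by ring.
have -> : - (- y - - s) = y - s by ring.
ring.
Qed.

Lemma sum_top_le x T (tau : R) :
  \sum_(v in T) x v <= #|T|%:R * tau + \sum_v pos (x v - tau).
Proof.
apply: (@le_trans _ _ (\sum_(v in T) (tau + pos (x v - tau)))).
  by apply: ler_sum => v _; rewrite -lerBlDl /pos le_max lexx.
rewrite big_split /= sumr_const mulr_natl lerD2l big_mkcond /=.
by apply: ler_sum => v _; case: ifP => // _; rewrite /pos le_max lexx orbT.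
Qed.

Lemma sum_top_eq x T v0 : v0 \notin T -> (forall v, v \notin T -> x v <= x v0) ->
    (forall u, u \in T -> x v0 <= x u) ->
  \sum_(v in T) x v = #|T|%:R * x v0 + \sum_v pos (x v - x v0).
Proof.
move=> v0T h1 h2.
rewrite [X in _ = _ + X](bigID (mem T)) /= [X in _ = _ + (_ + X)]big1 ?addr0; last first.
  by move=> v vT; rewrite /pos max_r // subr_le0 h1.
rewrite mulr_natl -sumr_const -big_split /=.
by apply: eq_bigr => v vT; rewrite /pos max_l ?subr_ge0 ?h2 // addrC subrK.
Qed.

(** Duality for top sums: [sum_top_le] holds for every [tau], with equality at the threshold of [T].
    Taking that [tau] for both [T] and [L], the terms [k tau] cancel and the sum of [gt] remains as
    a lower bound; the threshold of [L] gives the upper bound. *)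
Lemma trimmed_sum_le x T L (F : R) : #|T| = #|L| -> (#|T| < n)%N ->
    top x T -> top (fun v => - x v) L ->
    (forall v, exists2 t : nat, x v = t%:R \/ x v = - t%:R & `|\sum_v gt t%:R (x v)| <= F) ->
    `|\sum_v x v| <= F ->
  `|\sum_(v in T) x v + \sum_(v in L) x v| <= 3 * F.
Proof.
move=> hc hn hT hL hF hS.
have F0 : 0 <= F by apply: le_trans hS.
have gF v : `|\sum_u gt (x v) (x u)| <= 3 * F /\ `|\sum_u gt (- x v) (x u)| <= 3 * F.
  have [t hx ht] := hF v.
  have hN : `|\sum_u gt (- t%:R) (x u)| <= 3 * F.
    under eq_bigr => u _ do rewrite gtN.
    rewrite sumrB -mulr_sumr; apply: le_trans (ler_normB _ _) _.
    rewrite normrM (ger0_norm (ler0n R 2)); lra.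
  have hP : `|\sum_u gt t%:R (x u)| <= 3 * F by lra.
  by case: hx => ->; rewrite ?opprK.
have [v0 v0T [h1 h2]] := top_threshold hn hT.
have hnL : (#|L| < n)%N by rewrite -hc.
have [v1 v1L [h3 h4]] := top_threshold hnL hL.
have eT := sum_top_eq v0T h1 h2.
have eL := sum_top_eq v1L h3 h4.
have lL := sum_top_le (fun v => - x v) L (x v0).
have lT := sum_top_le x T (- x v1).
have [g0 _] := gF v0; have [_ g1] := gF v1.
move: g0 g1; rewrite /gt !sumrB !ler_norml => /andP[g0 _] /andP[_ g1].
rewrite !sumrN in eL lL; rewrite hc in eT lT.
by apply/andP; split; lra.
Qed.

Lemma clipE (m t i : nat) : clip R m t i = gt t%:R (i%:R - m%:R).
Proof.
rewrite /clip /gt /pos; congr (_ - _).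
  case: (leqP i (m + t)) => h.
    rewrite (_ : (i - (m + t) = 0)%N); last by lia.
    by rewrite max_r //; move: h; rewrite -(ler_nat R) natrD; lra.
  rewrite natrB 1?ltnW // natrD max_l; first by lra.
  by move: h; rewrite -(ltr_nat R) natrD; lra.
case: (leqP (t + i) m) => h.
  have -> : (m - t - i = m - (t + i))%N by lia.
  rewrite natrB // natrD max_l; first by lra.
  by move: h; rewrite -(ler_nat R) natrD; lra.
rewrite (_ : (m - t - i = 0)%N); last by lia.
by rewrite max_r //; move: h; rewrite -(ltr_nat R) natrD; lra.
Qed.

End TrimmedSums.

(** * Algebra of the quadratic form under changes of the vertex set *)

Section Forms.
Variables (R : realType) (n : nat) (w : 'I_n -> 'I_n -> R).
Hypothesis wC : forall u v, w u v = w v u.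
Hypothesis w1 : forall u v, `|w u v| <= 1.
Implicit Types (X Y S U B : {set 'I_n}).
Local Notation fm X Y := (form w (ind R X) (ind R Y)).

Lemma formC (f g : 'I_n -> R) : form w f g = form w g f.
Proof.
rewrite /form exchange_big; apply: eq_bigr => a _; apply: eq_bigr => c _.
by rewrite wC; ring.
Qed.

Lemma form_addl (f f' g : 'I_n -> R) :
  form w (fun a => f a + f' a) g = form w f g + form w f' g.
Proof.
rewrite /form -big_split; apply: eq_bigr => a _ /=; rewrite -big_split.
by apply: eq_bigr => c _ /=; ring.
Qed.

Lemma ind_setU X S : [disjoint X & S] -> ind R (X :|: S) = (fun a => ind R X a + ind R S a).
Proof.
move=> dXS; apply: boolp.funext => a; rewrite /ind inE.
case: (boolP (a \in X)) => aX; last by rewrite /= add0r.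
by rewrite (disjointFr dXS aX) /= addr0.
Qed.

Lemma cform_add (f f' : 'I_n -> R) :
  cform w (fun a => f a + f' a) (fun a => f a + f' a)
  = cform w f f + 2 * cform w f' f + cform w f' f'.
Proof.
have r (g h h' : 'I_n -> R) : form w g (fun a => h a + h' a) = form w g h + form w g h'.
  by rewrite formC form_addl !(formC g).
rewrite /cform !big_split /= !form_addl !r (formC f f').
rewrite ?exprVn ?invfM ?exprMn; set N := (n%:R)^-1; move: N => N; ring.
Qed.

Lemma form_diff_le U Y B (k : R) : (forall a, a \notin B -> (a \in U) = (a \in Y)) ->
    #|U :|: Y|%:R <= k -> `|fm U U - fm Y Y| <= 2 * #|B|%:R * k.
Proof.
move=> hUY hk; rewrite /form -sumrB.
apply: (@le_trans _ _ (\sum_a \sum_c (ind R B a * ind R (U :|: Y) c + ind R (U :|: Y) a * ind R B c))).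
  apply: le_trans (ler_norm_sum _ _ _) _; apply: ler_sum => a _.
  rewrite -sumrB; apply: le_trans (ler_norm_sum _ _ _) _; apply: ler_sum => c _.
  rewrite -mulrBl normrM.
  apply: (@le_trans _ _ `|ind R U a * ind R U c - ind R Y a * ind R Y c|).
    by apply: ler_piMr.
  rewrite /ind !inE; case: (boolP (a \in B)) => aB; case: (boolP (c \in B)) => cB.
  - by case: (a \in U); case: (a \in Y); case: (c \in U); case: (c \in Y);
      rewrite /= ?mulr1n ?mulr0n ler_norml; lra.
  - rewrite (hUY c cB); by case: (a \in U); case: (a \in Y); case: (c \in Y);
      rewrite /= ?mulr1n ?mulr0n ler_norml; lra.
  - rewrite (hUY a aB); by case: (c \in U); case: (c \in Y); case: (a \in Y);
      rewrite /= ?mulr1n ?mulr0n ler_norml; lra.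
  - by rewrite (hUY a aB) (hUY c cB) subrr normr0; case: (_ || _); case: (_ || _); rewrite /= ?mulr1n ?mulr0n; lra.
have -> : \sum_a \sum_c (ind R B a * ind R (U :|: Y) c + ind R (U :|: Y) a * ind R B c)
   = 2 * #|B|%:R * #|U :|: Y|%:R.
  under eq_bigr => a _ do rewrite big_split /= -!mulr_sumr !sum_ind.
  by rewrite big_split /= -!mulr_suml !sum_ind; ring.
by apply: ler_wpM2l; rewrite ?mulr_ge0.
Qed.

End Forms.

(** The main term [q N^2 cf] is [N sg^2 cf]. Dividing by [lam N sg^2] leaves the error [N], a
    variance proportional to [lam], and the deviation [t / lam]. *)
Lemma switch_arith (R : realType) (x y cf Z V f M N q sg lam t : R) :
    0 < lam -> 0 <= t -> 1 <= N -> 1 <= sg -> sg ^+ 2 = N * q -> M <= 9 * sg ^+ 2 -> 0 <= x * y ->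
    `|Z - q * N ^+ 2 * cf| <=
      6 * (110 * N * sg) ^+ 2 + 8 * (N ^+ 3 * q + N * (110 * N * sg)) ->
    V <= (2 * q * (x * y) + f + N) * (N * (4 * sg ^+ 2)) + x * y * (4 * sg ^+ 2) ^+ 2 ->
    lam * `|Z| - lam ^+ 2 * V <= 16 * N * M * t ->
  `|cf| <= 300 * 300 * N + lam * (24 * q * (x * y) + 4 * f + 4 * N) + 144 * t / lam.
Proof.
move=> l0 t0 n1 s1' eS hM xy0 h1 h3 hZ.
have s1 : 1 <= sg ^+ 2 by rewrite expr_ge1 // (le_trans ler01 s1').
have Ns0 : 0 < N * sg ^+ 2 by apply: mulr_gt0; lra.
have a1 : N * sg ^+ 2 * `|cf| <= `|Z| + (300 * 300) * N * (N * sg ^+ 2).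
  have : N * sg ^+ 2 * `|cf| = `|q * N ^+ 2 * cf|.
    have e : q * N ^+ 2 = N * sg ^+ 2 by rewrite eS; ring.
    by rewrite e normrM (ger0_norm (ltW Ns0)).
  move=> ->; rewrite (_ : q * _ * _ = Z - (Z - q * N ^+ 2 * cf)); last by ring.
  apply: le_trans (ler_normB _ _) _; apply: lerD => //; apply: le_trans h1 _.
  have -> : 6 * (110 * N * sg) ^+ 2 + 8 * (N ^+ 3 * q + N * (110 * N * sg))
     = 6 * 110 * 110 * N * (N * sg ^+ 2) + 8 * N * (N * sg ^+ 2) + 8 * 110 * N * N * sg.
    by rewrite (_ : N ^+ 3 * q = N * N * (N * q)); [rewrite -eS; ring|ring].
  have : N * N * sg <= N * (N * sg ^+ 2).
    have g : sg <= sg ^+ 2 by rewrite expr2 ler_peMl //; lra.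
    have NN : 0 <= N * N by apply: mulr_ge0; lra.
    by have := ler_wpM2l NN g; lra.
  have : 0 <= N * (N * sg ^+ 2) by apply: mulr_ge0; lra.
  lra.
have a2 : lam * `|Z| <= lam * (lam * (N * sg ^+ 2) * (24 * q * (x * y) + 4 * f + 4 * N) + N * sg ^+ 2 * (144 * t / lam)).
  have -> : lam * (lam * (N * sg ^+ 2) * (24 * q * (x * y) + 4 * f + 4 * N) + N * sg ^+ 2 * (144 * t / lam))
    = lam ^+ 2 * ((N * sg ^+ 2) * (24 * q * (x * y) + 4 * f + 4 * N)) + 144 * N * sg ^+ 2 * t.
    by field; rewrite gt_eqF.
  have b1 : lam ^+ 2 * V <= lam ^+ 2 * ((N * sg ^+ 2) * (24 * q * (x * y) + 4 * f + 4 * N)).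
    apply: ler_wpM2l; first exact: sqr_ge0.
    apply: le_trans h3 _; rewrite le_eqVlt; apply/orP; left; apply/eqP.
    rewrite (_ : (4 * sg ^+ 2) ^+ 2 = 16 * sg ^+ 2 * (N * q)); first by ring.
    by rewrite -eS; ring.
  have b2 : 16 * N * M * t <= 144 * N * sg ^+ 2 * t.
    apply: ler_wpM2r => //.
    rewrite (_ : 144 * N * sg ^+ 2 = 16 * N * (9 * sg ^+ 2)); last by ring.
    by apply: ler_wpM2l => //; lra.
  lra.
rewrite ler_pM2l // in a2.
rewrite -(ler_pM2l Ns0); apply: le_trans a1 _.
move: a2; set E := 24 * q * (x * y) + 4 * f + 4 * N; move: E => E a2.
have -> : N * sg ^+ 2 * (300 * 300 * N + lam * E + 144 * t / lam)
  = 300 * 300 * N * (N * sg ^+ 2) + (lam * (N * sg ^+ 2) * E + N * sg ^+ 2 * (144 * t / lam)) by ring.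
by rewrite addrC lerD2l.
Qed.

(** * From the switching statistic to the centred form *)

Section SwitchBound.
Variables (R : realType) (n : nat) (p : R).
Hypothesis p01 : 0 <= p <= 1.
Local Notation I := ('I_n * 'I_n)%type.
Local Notation pe := (@pe R n p).
Local Notation W := (@W R n p).
Local Notation pq := (pq p).

Lemma whp_swap_abs (J : finType) (M : nat) (H : J -> {ffun 'I_n -> nat} -> R)
    (lam : R) (X Y : J -> {ffun 'I_n -> nat} -> {set 'I_n}) (t : R) :
    (0 < n)%N -> (0 < M)%N -> (forall j f, 0 <= H j f) ->
    (forall f, \sum_j H j f <= 1) -> 0 <= lam <= 1 / 3 ->
  whp pe (expR t) (fun w => small M w -> forall j (e : R), expR (- e) <= H j (dgf w) / 2 ->
    lam * `|Zd R (X j) (Y j) w| - lam ^+ 2 * Vd R (X j) (Y j) w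
      <= 16 * n%:R * M%:R * (t + e)).
Proof.
move=> n0 M0 H0 H1 /andP[l0 l3].
pose H' (j : J * bool) f : R := H j.1 f / 2.
pose lam' (j : J * bool) : R := if j.2 then lam else - lam.
have h := @whp_swap R n p p01 (J * bool)%type M H' lam' (fun j => X j.1) (fun j => Y j.1) t n0 M0.
apply: (whp_le (lexx _) _ (h _ _ _)).
- move=> w hw sm j e he; have k1 := hw sm (j, true) e he; have k2 := hw sm (j, false) e he.
  rewrite /lam' /= ?sqrrN in k1 k2.
  by case: (leP 0 (Zd R (X j) (Y j) w)) => hz;
    [rewrite ger0_norm|rewrite ltr0_norm // mulrN -mulNr].
- by move=> j f; rewrite /H' divr_ge0.
- move=> f; rewrite -(pair_bigA _ (fun j b => H' (j, b) f)) /=.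
  under eq_bigr => j _ do rewrite big_bool /H' /= -mulrDr -[X in _ * (X + X)]div1r.
  rewrite -mulr_suml; have := H1 f; lra.
- by move=> [j [|]]; rewrite /lam' /= ?normrN ger0_norm.
Qed.

Variables (w : {set I}) (sg : R).
Hypotheses (n0 : (0 < n)%N) (sg1 : 1 <= sg) (sgE : sg ^+ 2 = n%:R * pq)
  (hcut : forall X Y : {set 'I_n}, `|fX p X Y w| <= 55 * n%:R * sg)
  (hdeg : forall v, `|dt p w v| <= sg ^+ 2).

(** The [l1] norm of an image is a difference of two cut forms, over the rows with nonnegative and
    with negative entry. *)
Lemma l1_cut S : l1bound (W w) (110 * n%:R * sg) (ind R S).
Proof.
rewrite /l1bound; pose P := [set a | 0 <= mulv (W w) (ind R S) a].
have e : \sum_a `|mulv (W w) (ind R S) a| = fX p P S w - fX p (~: P) S w.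
  rewrite /fX !formE -sumrB; apply: eq_bigr => a _; rewrite /ind /P !inE.
  by case: (leP 0 (mulv _ _ a)) => ha; rewrite /= ?mulr1n ?mulr0n; [rewrite ger0_norm|rewrite ltr0_norm]; rewrite //; ring.
rewrite e; have := hcut P S; have := hcut (~: P) S.
by rewrite !ler_norml => /andP[? ?] /andP[? ?]; lra.
Qed.

Lemma sum_ind2 (X Y : {set 'I_n}) (c : R) :
  \sum_a \sum_b ind R X a * ind R Y b * c = #|X|%:R * #|Y|%:R * c.
Proof.
rewrite -!sum_ind mulr_suml mulr_suml; apply: eq_bigr => a _.
by rewrite mulr_sumr mulr_suml.
Qed.

(** A switchable quadruple has two edges and two non-edges, so it can be counted on the sparser
    side, where the density [min (p, 1 - p)] is at most [2 p (1 - p)]. The extra [n] pays for the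
    diagonal when non-adjacency is used. *)
Lemma sparse_side : exists B : 'I_n -> 'I_n -> bool,
  [/\ B = adj w \/ B = (fun u v => ~~ adj w u v),
      forall u, \sum_v (B u v)%:R <= 4 * sg ^+ 2 &
      forall X Y : {set 'I_n}, \sum_a \sum_c ind R X a * ind R Y c * (B a c)%:R
        <= 2 * pq * (#|X|%:R * #|Y|%:R) + `|fX p X Y w| + n%:R].
Proof.
have /andP[p0 p1] := p01.
have s1 : 1 <= sg ^+ 2 by rewrite expr_ge1 // (le_trans ler01 sg1).
have n1 : 1 <= n%:R :> R by rewrite ler1n.
have dgE u : (dg w u)%:R = (n%:R - 1) * p + dt p w u by rewrite dtE // addrC subrK.
have sumadj u : \sum_v (adj w u v)%:R = (dg w u)%:R :> R by rewrite /dg natr_sum.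
have i0 (S : {set 'I_n}) a : 0 <= ind R S a by rewrite /ind.
have i1 (S : {set 'I_n}) a : ind R S a <= 1.
  by rewrite /ind; case: (_ \in _); rewrite /= ?mulr1n ?mulr0n.
have xy0 (X Y : {set 'I_n}) : 0 <= #|X|%:R * #|Y|%:R :> R by rewrite mulr_ge0.
case: (leP p (1 / 2)) => hp.
  have hp2 : p <= 2 * pq by rewrite /pq; have h : 0 <= p * (1 - 2 * p); [by apply: mulr_ge0; lra|lra].
  exists (adj w); split; first by left.
    move=> u; rewrite sumadj dgE; have := hdeg u; rewrite ler_norml => /andP[_ h].
    have : n%:R * p <= 2 * sg ^+ 2.
      by rewrite sgE mulrCA; apply: ler_wpM2l => //; lra.
    by rewrite mulrBl mul1r; lra.
  move=> X Y; apply: (@le_trans _ _ (\sum_a \sum_c (ind R X a * ind R Y c * p + ind R X a * ind R Y c * W w a c))).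
    apply: ler_sum => a _; apply: ler_sum => c _; rewrite -mulrDr.
    apply: ler_wpM2l; first by rewrite mulr_ge0.
    by rewrite /W /adj; case: eqP => _ /=; [rewrite addr0|rewrite addrC subrK].
  under eq_bigr => a _ do rewrite big_split /=.
  rewrite big_split /= sum_ind2 -/(form (W w) (ind R X) (ind R Y)) -/(fX p X Y w).
  have h1 : #|X|%:R * #|Y|%:R * p <= 2 * pq * (#|X|%:R * #|Y|%:R).
    by rewrite mulrC; apply: ler_wpM2r.
  by have := ler_norm (fX p X Y w); lra.
have hp2 : 1 - p <= 2 * pq by rewrite /pq; have h : 0 <= (1 - p) * (2 * p - 1); [by apply: mulr_ge0; lra|lra].
exists (fun u v => ~~ adj w u v); split; first by right.
  move=> u; rewrite (_ : \sum_v _ = n%:R - (dg w u)%:R); last first.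
    rewrite -sumadj -[X in _ = X - _](mulr1 n%:R) -sum_ord_cst -sumrB.
    by apply: eq_bigr => v _; case: adj; rewrite /= ?mulr1n ?mulr0n; ring.
  rewrite dgE; have := hdeg u; rewrite ler_norml => /andP[h _].
  have : n%:R * (1 - p) <= 2 * sg ^+ 2.
    by rewrite sgE mulrCA; apply: ler_wpM2l => //; lra.
  by rewrite mulrBl mulrBr mul1r mulr1; lra.
move=> X Y; apply: (@le_trans _ _ (\sum_a \sum_c (ind R X a * ind R Y c * (1 - p)
     - ind R X a * ind R Y c * W w a c + (a == c)%:R))).
  apply: ler_sum => a _; apply: ler_sum => c _; rewrite -mulrBr.
  rewrite /W /adj; case: (eqVneq a c) => _ /=.
    rewrite subr0 mulr1; have ? : 0 <= ind R X a * ind R Y c * (1 - p) by rewrite !mulr_ge0 //; lra.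
    have : ind R X a * ind R Y c <= 1.
      by rewrite -[leRHS]mulr1; apply: ler_pM.
    by rewrite /= ?mulr1n; lra.
  rewrite addr0; apply: ler_wpM2l; first by rewrite mulr_ge0.
  by case: (_ \in w); rewrite /= ?mulr1n ?mulr0n; lra.
under eq_bigr => a _ do rewrite big_split /= sumrB.
rewrite big_split /= sumrB sum_ind2 -/(form (W w) (ind R X) (ind R Y)) -/(fX p X Y w).
have -> : \sum_(a < n) \sum_(c < n) (a == c)%:R = n%:R :> R.
  rewrite -[RHS]mulr1 -sum_ord_cst; apply: eq_bigr => a _.
  rewrite (bigD1 a) //= eqxx big1 ?addr0 // => c ca.
  by rewrite eq_sym (negbTE ca).
have h1 : #|X|%:R * #|Y|%:R * (1 - p) <= 2 * pq * (#|X|%:R * #|Y|%:R).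
  by rewrite mulrC; apply: ler_wpM2r.
by have := ler_norm (- fX p X Y w); rewrite normrN; lra.
Qed.

(** Two rows disagree in at most [8 sg^2] columns, as each has at most [4 sg^2] entries on the
    sparse side. *)
Definition switch_span : nat := (Num.truncn (8 * sg ^+ 2)).+1.

Lemma switch_span_le : switch_span%:R <= 9 * sg ^+ 2.
Proof.
have s1 : 1 <= sg ^+ 2 by rewrite expr_ge1 // (le_trans ler01 sg1).
have h : 0 <= 8 * sg ^+ 2 by lra.
have := truncn_le (8 * sg ^+ 2); rewrite h /switch_span -natr1 => ?; lra.
Qed.

Lemma small_switch_span : small switch_span w.
Proof.
move=> a b; have [B [hB hrow _]] := sparse_side.
have e u v c : (adj w u c != adj w v c) = (B u c != B v c).
  by case: hB => -> //; case: (adj w u c); case: (adj w v c).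
have h : (#|[set c | adj w a c != adj w b c]|)%:R <= 8 * sg ^+ 2.
  have ra := hrow a; have rb := hrow b.
  apply: (@le_trans _ _ (\sum_v (B a v)%:R + \sum_v (B b v)%:R)); last by lra.
  rewrite -big_split -sum1_card natr_sum big_mkcond /=; apply: ler_sum => c _.
  by rewrite inE e; case: (B a c); case: (B b c); rewrite /= ?mulr1n ?mulr0n; lra.
apply: leqW; rewrite truncn_ge_nat //.
have s1 : 1 <= sg ^+ 2 by rewrite expr_ge1 // (le_trans ler01 sg1).
lra.
Qed.

(* The switch statistic dominates [pq n^2] times the centred form, so an
   exponential bound on it controls the centred form itself. *)
Lemma cform_le (X Y : {ffun 'I_n -> nat} -> {set 'I_n}) (X0 Y0 : {set 'I_n}) (lam t : R) :
    X (dgf w) = X0 -> Y (dgf w) = Y0 -> 0 < lam -> 0 <= t ->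
    lam * `|Zd R X Y w| - lam ^+ 2 * Vd R X Y w <= 16 * n%:R * switch_span%:R * t ->
  `|cform (W w) (ind R X0) (ind R Y0)| <= (300 * 300) * n%:R
    + lam * (24 * pq * (#|X0|%:R * #|Y0|%:R) + 4 * `|fX p X0 Y0 w| + 4 * n%:R) + 144 * t / lam.
Proof.
move=> eX eY l0 t0 hZ.
have n1 : 1 <= n%:R :> R by rewrite ler1n.
have s1 : 1 <= sg ^+ 2 by rewrite expr_ge1 // (le_trans ler01 sg1).
have [B [hB hrow hE]] := sparse_side.
have L0 : 0 <= 110 * n%:R * sg by rewrite !mulr_ge0 // (le_trans ler01 sg1).
have h1 := cform_Zd p01 X Y L0 l1_cut.
have h3 := Vd_le hB hrow (hE (X (dgf w)) (Y (dgf w))).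
rewrite eX eY in h1 h3.
have hM := switch_span_le.
have xy0 := mulr_ge0 (ler0n R #|X0|) (ler0n R #|Y0|).
exact: (switch_arith l0 t0 n1 sg1 sgE hM xy0 h1 h3 hZ).
Qed.

End SwitchBound.

(** * Bounds on logarithms and on the sizes of the union bounds *)

Section LogBounds.
Variables (R : realType) (n : nat).
Hypothesis n2 : (2 <= n)%N.
Local Notation L := (ln (@GRing.natmul R 1 n)).
Local Notation N := (@GRing.natmul R 1 n).

Lemma natr_ge2 : 2 <= N.
Proof. by rewrite (ler_nat R 2). Qed.

Lemma ln_nat_ge : 1 / 2 <= L.
Proof.
have N2 := natr_ge2; rewrite -ler_expR lnK ?posrE; last by lra.
apply: le_trans N2.
have h := expR_ge1Dx (- (1 / 2 : R)).
have := expRN (1 / 2 : R) => e; rewrite e in h.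
have p0 := expR_gt0 (1 / 2 : R).
have h1 : expR (1 / 2 : R) / 2 <= 1.
  rewrite -[leRHS](mulfV (lt0r_neq0 p0)); apply: ler_wpM2l; first exact: ltW.
  by apply: le_trans h; lra.
lra.
Qed.

Lemma ln_nat_le : L <= N.
Proof.
have N2 := natr_ge2; have := expR_ge1Dx L; rewrite lnK ?posrE; lra.
Qed.

Lemma natr_le_mul_ln : N <= 2 * (N * L).
Proof. by have := @ler_wpM2l _ N _ (1 / 2) L; have := natr_ge2; have := ln_nat_ge; lra. Qed.

Lemma expR_mul_ln (a : nat) : expR (a%:R * L) = N ^+ a.
Proof.
by rewrite expRM_natl lnK // posrE; have := natr_ge2; lra.
Qed.

Lemma two_le_expR (x : R) : 1 <= x -> 2 <= expR x.
Proof. by move=> h; have := expR_ge1Dx x; lra. Qed.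

Lemma double_natr_le_expR : 2 * N <= expR (2%:R * L).
Proof. by rewrite expR_mul_ln expr2; apply: ler_wpM2r; rewrite ?natr_ge2. Qed.

Lemma double_succ_le_expR : 2 * n.+1%:R <= expR (3%:R * L).
Proof.
rewrite expR_mul_ln -natr1; have h := natr_ge2.
have h1 : 2 * 2 <= N * N by apply: ler_pM.
have h2 : 2 * 2 * N <= N * N * N by apply: ler_wpM2r.
by rewrite -[N ^+ 3]/(N * (N * N)) mulrA; lra.
Qed.

Lemma sqr_double_le_expR : (N ^+ 2 * 2) <= expR (3%:R * L).
Proof.
by rewrite expR_mul_ln [leRHS]exprSr; apply: ler_wpM2l; rewrite ?natr_ge2 ?sqr_ge0.
Qed.

Lemma double_exp2_le_expR : 2 * 2 ^+ n * 2 ^+ n <= expR (3 * N).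
Proof.
have h : 2 * 2 ^+ n * 2 ^+ n <= expR (1 : R) * expR (1 : R) ^+ n * expR (1 : R) ^+ n.
  have e2 : (2 : R) <= expR 1 by apply: two_le_expR.
  have en : (2 : R) ^+ n <= expR 1 ^+ n by apply: lerXn2r; rewrite ?nnegrE ?expR_ge0.
  by apply: ler_pM => //; rewrite ?mulr_ge0 ?exprn_ge0 //; apply: ler_pM; rewrite ?exprn_ge0.
apply: le_trans h _; rewrite -!expRM_natl -!expRD ler_expR.
by have := natr_ge2; lra.
Qed.

(* [C(n, m) x^m <= (1 + x)^n] with [x = y^-1], and [y <= exp (y - 1)]. *)
Lemma bin_le_expR (m : nat) (y : R) : 1 <= y -> 'C(n, m)%:R <= expR (N / y + m%:R * y).
Proof.
move=> y1; have y0 : 0 < y by lra.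
have h1 : 'C(n, m)%:R * y^-1 ^+ m <= (1 + y^-1) ^+ n.
  rewrite exprDn; case: (ltnP n m) => hm.
    rewrite bin_small // mul0r; apply: sumr_ge0 => i _; apply: mulrn_wge0.
    by rewrite mulr_ge0 ?exprn_ge0 // invr_ge0 ltW.
  have hm' : (m < n.+1)%N by [].
  rewrite (bigD1 (Ordinal hm')) //= expr1n mul1r mulr_natl lerDl.
  apply: sumr_ge0 => i _; apply: mulrn_wge0.
  by rewrite mulr_ge0 ?exprn_ge0 // invr_ge0 ltW.
have h2 : (1 + y^-1) ^+ n <= expR (N / y).
  rewrite expRM_natl; apply: lerXn2r; rewrite ?nnegrE ?expR_ge0 ?addr_ge0 ?invr_ge0 ?(ltW y0) //.
  exact: expR_ge1Dx.
have h3 : y ^+ m <= expR (m%:R * y).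
  rewrite expRM_natl; apply: lerXn2r; rewrite ?nnegrE ?expR_ge0 ?(ltW y0) //.
  by have := expR_ge1Dx y; lra.
rewrite expRD; apply: (@le_trans _ _ ('C(n, m)%:R * y^-1 ^+ m * y ^+ m)).
  by rewrite -mulrA -exprMn mulVf ?gt_eqF // expr1n mulr1.
by apply: ler_pM => //; rewrite ?mulr_ge0 ?exprn_ge0 ?invr_ge0 ?(ltW y0) //; exact: le_trans h1 h2.
Qed.

End LogBounds.

(** * Cut and degree events with explicit tilting parameters *)

Section CutEvents.
Variables (R : realType) (n : nat) (p : R).
Hypothesis p01 : 0 <= p <= 1.
Hypothesis n2 : (2 <= n)%N.
Local Notation pe := (@pe R n p).
Local Notation pq := (pq p).
Local Notation L := (ln (@GRing.natmul R 1 n)).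
Local Notation N := (@GRing.natmul R 1 n).
Variable sg : R.
Hypotheses (sg0 : 0 <= sg) (sgE : sg ^+ 2 = N * pq).

Lemma sg_le : sg <= N.
Proof.
have N2 := natr_ge2 R n2; have h := pq_le p.
rewrite -(@ler_pXn2r _ 2) ?nnegrE ?ler0n // sgE expr2; apply: ler_wpM2l; lra.
Qed.

(** [bin_le_expR] at [y = rho^-2] bounds the entropy by [3 k / rho^2]. Since
    [p (1 - p) k^2 = sg^2 k rho^4], the tilt [1 / (sg rho^3)] makes the variance and entropy terms
    [8 k sg rho] and [3 k sg rho]. *)
Lemma whp_crude (k : nat) (rho : R) : (0 < k)%N -> 0 < rho -> rho <= 1 -> rho ^+ 4 * N = k%:R ->
  whp pe (expR (6 * L)) (fun w => forall X : {set 'I_n}, #|X| = (2 * k)%N ->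
    `|fX p X X w| <= 12 * k%:R * sg * rho + 90 * N * L).
Proof.
move=> k0 r0 r1 hr.
have N2 := natr_ge2 R n2; have L2 := ln_nat_ge R n2.
have k1 : 1 <= k%:R :> R by rewrite ler1n.
set r2 := rho ^+ 2.
have r20 : 0 < r2 by rewrite exprn_gt0.
have r21 : r2 <= 1 by rewrite /r2 expr_le1 // ltW.
pose b : R := 3 * k%:R / r2 + 1.
have hb : 2 * 'C(n, 2 * k)%:R <= expR b.
  have h := @bin_le_expR R n (2 * k) r2^-1.
  rewrite /b addrC expRD; apply: ler_pM => //; first by apply: two_le_expR.
  rewrite (_ : 3 * k%:R / r2 = N / r2^-1 + (2 * k)%:R * r2^-1).
    by apply: h; rewrite invf_ge1.
  rewrite natrM -hr invrK /r2; field; rewrite gt_eqF //.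
have kr : k%:R / r2 <= N.
  rewrite ler_pdivrMr // -hr mulrC; apply: ler_wpM2l; first lra.
  by rewrite -[rho ^+ 4]/(rho ^+ (2 + 2)) exprD -/r2 ler_piMr // ltW.
have nL := natr_le_mul_ln R n2.
have LNL : L <= N * L by rewrite ler_peMl; lra.
have pqk : pq * (k%:R * k%:R) = sg ^+ 2 * k%:R * rho ^+ 4.
  by rewrite -hr sgE; ring.
set x := sg * rho ^+ 3.
have x0 : 0 <= x by rewrite mulr_ge0 // exprn_ge0 // ltW.
have kx : k%:R * sg * rho >= 0 by rewrite !mulr_ge0 // ltW.
(* If the optimal tilt exceeds the admissible [1/6], then [1/6] itself suffices, the variance term
   being small. *)
case: (leP x 6) => hx.
  have hl : 0 <= (1 / 6 : R) <= 1 / 6 by rewrite lexx andbT; lra.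
  apply: (whp_le (lexx _) _ (@whp_cut_size R n p p01 (2 * k) (1 / 6) (6 * L) b hl hb)).
  move=> w hw X hX; have := hw X hX.
  have -> : 2 * pq * (1 / 6) ^+ 2 * ((2 * k)%:R * (2 * k)%:R) = 2 / 9 * (k%:R * sg * rho * x).
    transitivity (2 / 9 * (pq * (k%:R * k%:R))); first by rewrite natrM; field.
    by rewrite pqk /x; ring.
  have : k%:R * sg * rho * x <= k%:R * sg * rho * 6 by apply: ler_wpM2l.
  rewrite /b; lra.
set l : R := x^-1.
have l0 : 0 < l by rewrite invr_gt0; lra.
have hl : 0 <= l <= 1 / 6 by rewrite ltW //= /l div1r lef_pV2 ?posrE; lra.
apply: (whp_le (lexx _) _ (@whp_cut_size R n p p01 (2 * k) l (6 * L) b hl hb)).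
move=> w hw X hX; have := hw X hX; rewrite -(ler_pM2l (_ : 0 < x)); last by lra.
rewrite [X in X <= _]mulrA /l mulfV ?mul1r; last by rewrite gt_eqF //; lra.
move=> h; apply: le_trans h _.
rewrite mulrDr (_ : x * _ = 8 * (k%:R * sg * rho)); last first.
  transitivity (8 * (pq * (k%:R * k%:R)) / x); first by rewrite natrM; field; rewrite gt_eqF //; lra.
  have s0 : 0 < sg by rewrite lt_neqAle sg0 andbT eq_sym; apply/eqP => e; move: hx; rewrite /x e mul0r; lra.
  rewrite pqk /x; field; rewrite !gt_eqF //.
have -> : x * (6 * L + b) = x * (6 * L + 1) + 3 * (k%:R * sg * rho).
  by rewrite /b /x /r2; field; rewrite gt_eqF.
have xN : x <= N.
  apply: le_trans sg_le; rewrite /x ler_piMr // expr_le1 // ltW //.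
have : x * (6 * L + 1) <= N * (6 * L + 1) by apply: ler_wpM2r; lra.
lra.
Qed.

Lemma whp_cut_sg : 1 <= sg -> whp pe (expR (6 * L)) (fun w => forall X Y : {set 'I_n},
    `|fX p X Y w| <= 55 * N * sg).
Proof.
move=> s1; have N2 := natr_ge2 R n2; have LN := ln_nat_le R n2.
(* At this tilt the variance term is at most [n / 18], so the entropy [3 n] of the pairs of sets
   dominates. *)
set l : R := (6 * sg)^-1.
have l0 : 0 < l by rewrite invr_gt0; lra.
have hl : 0 <= l <= 1 / 6 by rewrite ltW //= /l div1r lef_pV2 ?posrE; lra.
apply: (whp_le (lexx _) _ (@whp_cut R n p p01 l (6 * L) (3 * N) hl (double_exp2_le_expR R n2))).
move=> w hw X Y; have := hw X Y.
have XY : #|X|%:R * #|Y|%:R <= N * N :> R.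
  by apply: ler_pM => //; rewrite ler_nat -[leqRHS]card_ord max_card.
have pq0 := pq_ge0 p01.
have hs : l ^+ 2 * (2 * pq * (N * N)) = N / 18.
  transitivity (2 * N * sg ^+ 2 * l ^+ 2); first by rewrite sgE; ring.
  by rewrite /l; field; rewrite gt_eqF //; lra.
have h1 : 2 * pq * l ^+ 2 * (#|X|%:R * #|Y|%:R) <= N / 18.
  rewrite -hs [leRHS]mulrA (mulrC (l ^+ 2)); apply: ler_wpM2l => //.
  by apply: mulr_ge0; [exact: mulr_ge0|exact: sqr_ge0].
move=> h; have h2 : l * `|fX p X Y w| <= 9 * N + N / 18 by lra.
have : 6 * sg * (l * `|fX p X Y w|) <= 6 * sg * (9 * N + N / 18) by apply: ler_wpM2l; lra.
rewrite mulrA /l mulfV ?mul1r; last by rewrite gt_eqF //; lra.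
have : 0 <= N * sg by rewrite mulr_ge0.
lra.
Qed.

Lemma whp_deg_eta : whp pe (expR (6 * L)) (fun w => forall v, `|dt p w v| <= 60 * Num.sqrt (N * L)).
Proof.
have N2 := natr_ge2 R n2; have L2 := ln_nat_ge R n2; have LN := ln_nat_le R n2.
have NL0 : 0 < N * L by rewrite mulr_gt0; lra.
set s := Num.sqrt (N * L).
have s0 : 0 < s by rewrite sqrtr_gt0.
have s2 : s ^+ 2 = N * L by rewrite sqr_sqrtr // ltW.
set l : R := s / (6 * N).
have l0 : 0 < l by rewrite divr_gt0 //; lra.
have sN : s <= N.
  rewrite -(@ler_pXn2r _ 2) ?nnegrE ?(ltW s0) //.
  by rewrite s2 expr2; apply: ler_wpM2l => //; lra.
have hl : 0 <= l <= 1 / 6.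
  by rewrite ltW //= /l ler_pdivrMr; lra.
apply: (whp_le (lexx _) _ (@whp_deg R n p p01 l (6 * L) (2 * L) hl (double_natr_le_expR R n2))).
move=> w hw v; have := hw v.
have h1 : 2 * pq * N * l ^+ 2 <= L / 72.
  have -> : 2 * pq * N * l ^+ 2 = 2 * pq * (L / 36).
    transitivity (2 * pq * N * s ^+ 2 / (36 * N ^+ 2)); first by rewrite /l; field; rewrite gt_eqF //; lra.
    by rewrite s2; field; rewrite gt_eqF //; lra.
  have := pq_le p; have := @ler_wpM2r _ (L / 36) _ pq (1/4); lra.
move=> h; have h2 : l * `|dt p w v| <= 9 * L by lra.
have e : 9 * L = l * (54 * s).
  transitivity (9 * s ^+ 2 / N); first by rewrite s2; field; rewrite gt_eqF //; lra.
  by rewrite /l; field; rewrite gt_eqF //; lra.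
by rewrite e ler_pM2l // in h2; lra.
Qed.

Lemma whp_deg_sg : 144 * L <= sg ^+ 2 ->
  whp pe (expR (6 * L)) (fun w => forall v, `|dt p w v| <= sg ^+ 2).
Proof.
move=> hs; have hl : 0 <= (1 / 6 : R) <= 1 / 6 by rewrite lexx andbT; lra.
apply: (whp_le (lexx _) _ (@whp_deg R n p p01 (1 / 6) (6 * L) (2 * L) hl (double_natr_le_expR R n2))).
move=> w hw v; have := hw v.
have -> : 2 * pq * N * (1 / 6) ^+ 2 = sg ^+ 2 / 18 by rewrite sgE; field.
have := sqr_ge0 sg; lra.
Qed.

End CutEvents.

(** * Number of vertices in a band of degrees *)

Section ZoneSize.
Variables (R : realType) (n : nat).

Lemma zone_card (d : 'I_n -> nat) (b s : nat) (Z : {set 'I_n}) (c : R) : 0 <= c ->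
    (forall v, v \in Z -> (b <= d v + s)%N /\ (d v <= b + s)%N) ->
    (forall v, v \in Z -> #|[set u | d u == d v]|%:R <= c) ->
  #|Z|%:R <= (2 * s%:R + 1) * c.
Proof.
move=> c0 hZ hc.
have -> : #|Z|%:R = \sum_(i < (2 * s).+1) \sum_(v in Z) (d v + s == b + i)%N%:R :> R.
  rewrite exchange_big /= -sum1_card natr_sum; apply: eq_bigr => v vZ.
  have [h1 h2] := hZ v vZ.
  have hi : (d v + s - b < (2 * s).+1)%N by lia.
  rewrite (bigD1 (Ordinal hi)) //= big1; first by rewrite subnKC // eqxx addr0.
  move=> i; rewrite -val_eqE /= => hi'; case: eqP => // e.
  by move: hi'; rewrite e addKn eqxx.
have -> : (2 * s%:R + 1) * c = \sum_(i < (2 * s).+1) c.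
  by rewrite sum_ord_cst -[(2 * s).+1%:R]natr1 (natrM R 2).
apply: ler_sum => i _.
case: (pickP (fun v => (v \in Z) && (d v + s == b + i)%N)) => [v /andP[vZ /eqP hv]|h0].
  apply: le_trans (hc v vZ); rewrite -sum1_card natr_sum.
  rewrite big_mkcond [leRHS]big_mkcond; apply: ler_sum => u _; rewrite inE.
  case: (u \in Z); last by case: ifP.
  case: eqP => hu; last by case: ifP.
  by have -> : d u == d v by apply/eqP; lia.
rewrite big1 // => v vZ; have := h0 v; rewrite vZ /= => -> //.
Qed.

(** A self-bounding estimate: a level is compared with the vertices beyond it, which lie in the zone
    or in [Hi]. The zone then reappears on the right with factor at most [1/2] and is absorbed. *)
Lemma zone_side (d : 'I_n -> nat) (b s : nat) (Z Hi : {set 'I_n}) (kap c m : R) :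
    0 <= kap -> 0 <= c -> (2 * s%:R + 1) * kap <= 1 / 2 ->
    (forall v, v \in Z -> (b <= d v + s)%N /\ (d v <= b + s)%N) ->
    #|Hi|%:R <= m ->
    (forall v, v \in Z -> exists2 V : {set 'I_n}, V \subset Hi :|: Z &
       #|[set u | d u == d v]|%:R <= kap * #|V|%:R + c) ->
  #|Z|%:R <= 2 * (2 * s%:R + 1) * (kap * m + c).
Proof.
move=> k0 c0 hk hZ hm hV.
have m0 : 0 <= m by apply: le_trans hm.
have h : #|Z|%:R <= (2 * s%:R + 1) * (kap * (m + #|Z|%:R) + c).
  apply: (zone_card (d := d) (b := b)) => //; first by rewrite addr_ge0 // mulr_ge0 // addr_ge0.
  move=> v vZ; have [V hV1 hV2] := hV v vZ; apply: le_trans hV2 _; rewrite lerD2r.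
  apply: ler_wpM2l => //; apply: (@le_trans _ _ (#|Hi| + #|Z|)%:R); last by rewrite natrD lerD2r.
  by rewrite ler_nat; apply: leq_trans (subset_leq_card hV1) _; exact: leq_card_setU.
have h2 : (2 * s%:R + 1) * kap * #|Z|%:R <= 1 / 2 * #|Z|%:R by apply: ler_wpM2r.
move: h h2; move: (#|Z|%:R : R) (2 * s%:R + 1 : R) => z y h h2; lra.
Qed.

End ZoneSize.

Lemma dg_lt (n : nat) (w : {set ('I_n * 'I_n)}) (v : 'I_n) : (dg w v < n)%N.
Proof.
rewrite /dg (bigD1 v) //= {1}/adj eqxx add0n.
apply: (@leq_ltn_trans (\sum_(u | u != v) 1)); first by apply: leq_sum => u _; case: adj.
have n0 : (0 < n)%N by apply: leq_trans (ltn_ord v).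
by rewrite sum1_card cardC1 card_ord ltn_predL.
Qed.

(** [Ex_rows] uses only the edges leaving a set, so the degree levels are treated on two halves,
    each with at least [n / 4] vertices outside. *)
Lemma half_set (n : nat) : (2 <= n)%N ->
  exists V : {set 'I_n}, (n <= 4 * #|~: V|)%N /\ (n <= 4 * #|~: ~: V|)%N.
Proof.
move=> n2; pose V : {set 'I_n} := [set v : 'I_n | (v < n./2)%N].
have hn := odd_double_half n; rewrite -addnn in hn.
have hle : (n./2 <= n)%N by lia.
have cV : #|V| = n./2.
  rewrite -sum1_card -[RHS]card_ord -sum1_card (big_ord_widen n (fun=> 1%N) hle).
  by apply: eq_bigl => v; rewrite inE.
exists V; rewrite setCK cV cardsCs setCK cV card_ord.
by case: (odd n) hn => /= hn; lia.
Qed.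

(** * The hard regime: consequences of its defining inequality *)

Section Regime.
Variables (R : realType) (n : nat) (p : R) (k ww : nat) (K sg rho : R).
Hypotheses (p01 : 0 <= p <= 1) (n2 : (2 <= n)%N) (k0 : (0 < k)%N) (k4 : (4 * k <= n)%N)
  (hwk : (ww <= k)%N) (hK : 16 * 12 ^+ 4 <= K)
  (r0 : 0 < rho) (r1 : rho <= 1) (hr : rho ^+ 4 * n%:R = k%:R)
  (sg0 : 0 <= sg) (sgE : sg ^+ 2 = n%:R * pq p).
Local Notation I := ('I_n * 'I_n)%type.
Local Notation pe := (@pe R n p).
Local Notation W := (@W R n p).
Local Notation pq := (pq p).
Local Notation N := (@GRing.natmul R 1 n).
Local Notation L := (ln (@GRing.natmul R 1 n)).
Local Notation k' := (@GRing.natmul R 1 k).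
Local Notation w1 := (@GRing.natmul R 1 ww + 1).
Local Notation Q := (N * L + k' * w1).
Hypothesis hreg : 1000 * K * Q < k' * sg * rho.

Lemma reg_facts : [/\ 2 <= N, 1 / 2 <= L, L <= N, 300 <= K & 1 <= k' /\ 1 <= w1].
Proof.
split; [exact: natr_ge2|exact: ln_nat_ge|exact: ln_nat_le|by apply: le_trans hK; lra|].
by rewrite ler1n k0 lerDr.
Qed.

Lemma reg_w : 1000 * K * w1 <= sg * rho.
Proof.
have [N2 L2 LN K1 [k1 hw1]] := reg_facts.
have kp : 0 < k' by lra.
rewrite -(ler_pM2l kp); apply: (@le_trans _ _ (1000 * K * Q)); last by rewrite mulrA; exact: ltW.
rewrite mulrCA; apply: ler_wpM2l; first lra.
by rewrite lerDr mulr_ge0; lra.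
Qed.

Lemma reg_L : 1000 * K * L <= sg * rho ^+ 5.
Proof.
have [N2 L2 LN K1 [k1 hw1]] := reg_facts.
have Np : 0 < N by lra.
rewrite -(ler_pM2l Np); apply: le_trans (_ : 1000 * K * Q <= _).
  by rewrite mulrCA; apply: ler_wpM2l; [lra|rewrite lerDl mulr_ge0; lra].
by apply: le_trans (ltW hreg) _; rewrite le_eqVlt -hr; apply/orP; left; apply/eqP; ring.
Qed.

Let rX (i : nat) : 0 <= rho ^+ i <= 1.
Proof. by apply/andP; split; [exact: exprn_ge0 (ltW r0)|exact: exprn_ile1 (ltW r0) r1]. Qed.

Lemma reg_sg : 1000 * K <= sg.
Proof.
have [N2 L2 LN K1 [k1 hw1]] := reg_facts.
apply: (@le_trans _ _ (sg * rho)); last by rewrite ler_piMr.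
apply: le_trans reg_w; rewrite ler_peMr //; lra.
Qed.

Lemma reg_sr2 : 1 <= sg * rho ^+ 2.
Proof.
have [N2 L2 LN K1 [k1 hw1]] := reg_facts.
apply: (@le_trans _ _ (sg * rho ^+ 5)).
  apply: le_trans reg_L; have := @ler_pM R 1 K (1/2) L; lra.
apply: ler_wpM2l => //; rewrite -[rho ^+ 5]/(rho ^+ (2 + 3)) exprD ler_piMr //.
  by case/andP: (rX 2).
by case/andP: (rX 3).
Qed.

Lemma reg_L_sg : L <= sg.
Proof.
have [N2 L2 LN K1 [k1 hw1]] := reg_facts.
have h := reg_L; have /andP[_ r51] := rX 5.
have h1 : sg * rho ^+ 5 <= sg by rewrite ler_piMr.
have : L <= 1000 * K * L by rewrite ler_peMl; lra.
lra.
Qed.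

Lemma reg_pq : 0 < p < 1.
Proof.
have [N2 L2 LN K1 [k1 hw1]] := reg_facts.
have s1 : 0 < sg by have := reg_sg; lra.
have : 0 < N * pq by rewrite -sgE exprn_gt0.
rewrite pmulr_rgt0; last by lra.
have /andP[q0 q1] := p01; rewrite /pq !lt_neqAle q0 q1 !andbT => h; apply/andP; split.
  by apply: contraTneq h => <-; rewrite mul0r eqxx.
by apply: contraTneq h => ->; rewrite subrr mulr0 eqxx.
Qed.

(** The rate [6 K r / s] of [binE_zone_up] at [r = 1 / rho], with [s >= sg / 2] since a half leaves
    a quarter of the vertices outside. *)
Definition kap : R := 12 * K / (rho * sg).

Lemma kap_ge0 : 0 <= kap.
Proof.
have [N2 L2 LN K1 [k1 hw1]] := reg_facts.
by rewrite divr_ge0 ?mulr_ge0 ?(ltW r0) //; lra.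
Qed.

Lemma kapw : (2 * ww%:R + 1) * kap <= 1 / 4.
Proof.
have [N2 L2 LN K1 [k1 hw1]] := reg_facts.
have h := reg_w; have s1 : 0 < rho * sg by rewrite mulr_gt0 //; have := reg_sg; lra.
rewrite /kap mulrA ler_pdivrMr //.
have : (2 * ww%:R + 1) * K <= 2 * w1 * K by apply: ler_wpM2r; lra.
lra.
Qed.

(** The first term is [n] times the additive rate [k'] of [binE_zone_up]: [6 K n rho^3 / sg] equals
    [6 K k / (rho sg)], so [r = 1 / rho] balances it with [kap] times [k]. The second is the
    deviation [8 log n] of each half. *)
Definition czone : R := 6 * K * k' / (rho * sg) + 16 * L.

Lemma czone_ge0 : 0 <= czone.
Proof.
have [N2 L2 LN K1 [k1 hw1]] := reg_facts.
have s1 : 0 < rho * sg by rewrite mulr_gt0 //; have := reg_sg; lra.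
apply: addr_ge0; last by lra.
by apply: divr_ge0; [apply: mulr_ge0; lra|exact: ltW].
Qed.

Definition zone_ok (w : {set I}) := forall v : 'I_n,
  #|[set u | dg w u == dg w v]|%:R <= kap * #|[set u | (dg w v <= dg w u)%N]|%:R + czone /\
  #|[set u | dg w u == dg w v]|%:R <= kap * #|[set u | (dg w u <= dg w v)%N]|%:R + czone.

Lemma whp_zone_half (V : {set 'I_n}) : (n <= 4 * #|~: V|)%N ->
  whp pe (expR (6 * L)) (fun w => forall j : 'I_n,
    \sum_(v in V) (dg w v == j)%:R <= kap * (\sum_(v in V) (j <= dg w v)%N%:R)
       + #|V|%:R * (6 * K * k' / (N * (rho * sg))) + 8 * L /\
    \sum_(v in V) (dg w v == j)%:R <= kap * (\sum_(v in V) (dg w v <= j)%N%:R)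
       + #|V|%:R * (6 * K * k' / (N * (rho * sg))) + 8 * L).
Proof.
have [N2 L2 LN K1 [k1 hw1]] := reg_facts.
move=> hV; have p01' := reg_pq.
have hV' : N <= 4 * #|~: V|%:R by rewrite -(natrM R 4) ler_nat.
have pq0 : 0 <= pq by apply: pq_ge0.
set s := Num.sqrt (#|~: V|%:R * pq).
have s2 : s ^+ 2 = #|~: V|%:R * pq by rewrite sqr_sqrtr // mulr_ge0.
have s0 : 0 <= s by apply: sqrtr_ge0.
have sS : sg <= 2 * s.
  rewrite -(@ler_pXn2r _ 2) ?nnegrE ?mulr_ge0 // exprMn s2 sgE.
  have := ler_wpM2r pq0 hV'; lra.
have hs := reg_sg.
have s1 : 1 <= s by lra.
have sp : 0 < s by lra.
have hsp : 0 < sg by lra.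
have rsp : 0 < rho * sg by rewrite mulr_gt0.
have hk3 : 6 * K * rho^-1 / s <= kap.
  have -> : 6 * K * rho^-1 / s = 6 * K / (rho * s) by field; rewrite !gt_eqF.
  rewrite /kap ler_pdivrMr ?mulr_gt0 // mulrAC ler_pdivlMr //.
  have : rho * sg <= rho * (2 * s) by apply: ler_wpM2l => //; exact: ltW.
  move=> /(ler_wpM2l (_ : 0 <= 6 * K)) h; have := h ltac:(lra); lra.
have hk' : 3 * K * (rho^-1 ^+ 3)^-1 / s <= 6 * K * k' / (N * (rho * sg)).
  have -> : 6 * K * k' / (N * (rho * sg)) = 6 * K * rho ^+ 3 / sg.
    by rewrite -hr; field; rewrite !gt_eqF //; lra.
  have -> : 3 * K * (rho^-1 ^+ 3)^-1 / s = 3 * K * rho ^+ 3 / s by rewrite exprVn invrK.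
  rewrite ler_pdivrMr // [leRHS]mulrAC ler_pdivlMr //.
  have h0 : 0 <= 3 * K * rho ^+ 3 by case/andP: (rX 3) => ? _; apply: mulr_ge0 => //; lra.
  have := ler_wpM2l h0 sS; lra.
have kk : kap <= 1 / 3.
  have := kapw; have : kap <= (2 * ww%:R + 1) * kap.
    by rewrite ler_peMl ?kap_ge0 // lerDr mulr_ge0.
  lra.
have h := @whp_zone R n p p01 V K rho^-1 s _ _ (6 * L) (2 * L) hK p01' s1.
have e2 : s ^+ 2 = #|~: V|%:R * p * (1 - p) by rewrite s2 /pq mulrA.
have ri : 1 <= rho^-1 by rewrite invf_ge1.
have {}h := h _ _ e2 ri erefl erefl (le_trans hk3 kk) (double_natr_le_expR R n2).
apply: (whp_le (lexx _) _ h).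
move=> w hw j; have [h1 h2] := hw j.
have conv (P : 'I_n -> bool) (x y : R) : x <= kap -> y <= 6 * K * k' / (N * (rho * sg)) ->
   \sum_(v in V) ((dg w v == j)%:R - x * (P v)%:R - y) <= 6 * L + 2 * L ->
   \sum_(v in V) (dg w v == j)%:R <= kap * (\sum_(v in V) (P v)%:R)
       + #|V|%:R * (6 * K * k' / (N * (rho * sg))) + 8 * L.
  move=> hx hy; rewrite !sumrB -mulr_sumr sumr_const -(mulr_natl y) => hh.
  have S0 : 0 <= \sum_(v in V) (P v)%:R :> R by apply: sumr_ge0.
  have a1 := ler_wpM2r S0 hx.
  have a2 := ler_wpM2l (ler0n R #|V|) hy.
  lra.
by split; [exact: (conv (fun v => (j <= dg w v)%N) _ _ hk3 hk' h1)|exact: (conv (fun v => (dg w v <= j)%N) _ _ hk3 hk' h2)].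
Qed.

Lemma whp_zone_ok : whp pe (expR (6 * L) / 2) zone_ok.
Proof.
have [V [hA hB]] := half_set n2.
apply: whp_le (lexx _) _ (whp_and (whp_zone_half hA) (whp_zone_half hB)).
have [N2 L2 LN K1 [k1 hw1]] := reg_facts.
move=> w [h1 h2] v.
have dn := dg_lt w v.
have cardE (P : 'I_n -> bool) : #|[set u | P u]|%:R
   = \sum_(u in V) (P u)%:R + \sum_(u in ~: V) (P u)%:R :> R.
  rewrite -sum1_card natr_sum big_mkcond /= (bigID (mem V)) /=; congr (_ + _).
    by apply: eq_bigr => u _; rewrite inE; case: (P u).
  by apply: eq_big => u; rewrite !inE // => _; case: (P u).
have [a1 a2] := h1 (Ordinal dn); have [b1 b2] := h2 (Ordinal dn); rewrite /= in a1 a2 b1 b2.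
have cc : (#|V|%:R + #|~: V|%:R) * (6 * K * k' / (N * (rho * sg))) = 6 * K * k' / (rho * sg).
  have -> : #|V|%:R + #|~: V|%:R = N by rewrite -natrD cardsC card_ord.
  have ? := reg_sg; field; rewrite !gt_eqF //; lra.
rewrite mulrDl in cc.
by rewrite !cardE /czone; split; lra.
Qed.

End Regime.

(** * The hard regime: centred forms of cores and of zone subsets *)

Section HardRegime.
Variables (R : realType) (n : nat) (p : R) (k ww : nat) (K sg rho : R).
Hypotheses (p01 : 0 <= p <= 1) (n2 : (2 <= n)%N) (k0 : (0 < k)%N) (k4 : (4 * k <= n)%N)
  (hwk : (ww <= k)%N) (hK : 16 * 12 ^+ 4 <= K)
  (r0 : 0 < rho) (r1 : rho <= 1) (hr : rho ^+ 4 * n%:R = k%:R)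
  (sg0 : 0 <= sg) (sgE : sg ^+ 2 = n%:R * pq p).
Local Notation I := ('I_n * 'I_n)%type.
Local Notation pe := (@pe R n p).
Local Notation W := (@W R n p).
Local Notation pq := (pq p).
Local Notation N := (@GRing.natmul R 1 n).
Local Notation L := (ln (@GRing.natmul R 1 n)).
Local Notation k' := (@GRing.natmul R 1 k).
Local Notation w1 := (@GRing.natmul R 1 ww + 1).
Local Notation Q := (N * L + k' * w1).
Hypothesis hreg : 1000 * K * Q < k' * sg * rho.
Local Notation M := (switch_span sg).
Implicit Types (f : {ffun 'I_n -> nat}) (w : {set I}) (b a : nat) (S : {set 'I_n}).

(** [b] and [a] stand for the corrupted degree thresholds of the upper and the lower pruned set. *)
Definition core b a f : {set 'I_n} := [set v | (b + ww < f v)%N || (f v + ww < a)%N].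
Definition zon b a f : {set 'I_n} := [set v | ((b <= f v + ww) && (f v <= b + ww))%N
  || ((a <= f v + ww) && (f v <= a + ww))%N].

(** A core costs only [t = O(log n)], so a tilt of order [1 / (n p (1 - p))] is affordable. A zone
    subset costs [t] of order [z + log n]; as [p (1 - p) k = (sg rho^2)^2], the tilt [lam2] balances
    the variance [lam p (1 - p) z k] against [z / lam]. *)
Definition lam1 : R := (3 * sg ^+ 2)^-1.
Definition lam2 : R := (6 * (sg * rho ^+ 2))^-1.

Definition switch_ok (lam t : R) (X Y : {ffun 'I_n -> nat} -> {set 'I_n}) w :=
  lam * `|Zd R X Y w| - lam ^+ 2 * Vd R X Y w <= 16 * N * M%:R * t.

Let facts := reg_facts ww n2 k0 hK.
Let hsg : 1000 * K <= sg.
Proof. by move: hreg; apply: reg_sg. Qed.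
Let hsr2 : 1 <= sg * rho ^+ 2.
Proof. by move: hreg; apply: reg_sr2. Qed.

Lemma lam1_bound : 0 < lam1 <= 1 / 3.
Proof.
have [_ _ _ K1 _] := facts; have h := hsg.
have s1 : 1 <= sg ^+ 2 by apply: exprn_ege1; lra.
rewrite /lam1 invr_gt0 div1r lef_pV2 ?posrE; lra.
Qed.

Lemma lam2_bound : 0 < lam2 <= 1 / 6.
Proof.
have h := hsr2; rewrite /lam2 invr_gt0 div1r lef_pV2 ?posrE; lra.
Qed.

Lemma whp_core : whp pe (expR (6 * L)) (fun w => small M w -> forall b a : 'I_n,
  switch_ok lam1 (9 * L) (core b a) (core b a) w).
Proof.
have [N2 L2 LN K1 _] := facts; have /andP[l0 l3] := lam1_bound.
have n0 : (0 < n)%N by apply: leq_trans n2.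
have Nn : N != 0 by rewrite pnatr_eq0 -lt0n.
pose H (j : 'I_n * 'I_n) f : R := (N ^+ 2)^-1.
have hl : 0 <= lam1 <= 1 / 3 by rewrite l3 ltW.
have h := @whp_swap_abs R n p p01 ('I_n * 'I_n)%type M H lam1
  (fun j => core j.1 j.2) (fun j => core j.1 j.2) (6 * L) n0 isT.
apply: (whp_le (lexx _) _ (h _ _ hl)).
- move=> w hw sm b a; rewrite /switch_ok.
  have -> : 9 * L = 6 * L + 3 * L by ring.
  apply: (hw sm (b, a) (3 * L)).
  rewrite expRN /H -invfM lef_pV2 ?posrE ?expR_gt0 ?mulr_gt0 ?exprn_gt0 ?ltr0n //.
  exact: sqr_double_le_expR.
- by move=> j f; rewrite invr_ge0 sqr_ge0.
- move=> f; rewrite /H sumr_const card_prod card_ord -(mulr_natl (N ^+ 2)^-1) natrM -expr2 mulfV //.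
  exact: expf_neq0.
Qed.

Lemma whp_sub (Y : 'I_n -> 'I_n -> {set 'I_n} -> {ffun 'I_n -> nat} -> {set 'I_n}) :
  whp pe (expR (6 * L)) (fun w => small M w -> forall (b a : 'I_n) S, S \subset zon b a (dgf w) ->
  switch_ok lam2 (9 * L + #|zon b a (dgf w)|%:R) (fun=> S) (Y b a S) w).
Proof.
have [N2 L2 LN K1 _] := facts; have /andP[l0 l3] := lam2_bound.
have n0 : (0 < n)%N by apply: leq_trans n2.
have Nn : N != 0 by rewrite pnatr_eq0 -lt0n.
pose J := ('I_n * 'I_n * {set 'I_n})%type.
(* The prior: uniform thresholds, then a uniform subset of the zone. The zone is degree-determined,
   so the weight is a function of the degrees. *)
pose H (j : J) f : R := (j.2 \subset zon j.1.1 j.1.2 f)%:R * (2 ^+ #|zon j.1.1 j.1.2 f|)^-1 * (N ^+ 2)^-1.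
have hl : 0 <= lam2 <= 1 / 3 by apply/andP; lra.
have p2 (m : nat) : 0 < (2 : R) ^+ m by rewrite exprn_gt0.
have h := @whp_swap_abs R n p p01 J M H lam2
  (fun j _ => j.2) (fun j => Y j.1.1 j.1.2 j.2) (6 * L) n0 isT.
apply: (whp_le (lexx _) _ (h _ _ hl)).
- move=> w hw sm b a S hS; rewrite /switch_ok.
  set z := #|zon b a (dgf w)|%:R.
  have -> : 9 * L + z = 6 * L + (3 * L + z) by ring.
  apply: (hw sm (b, a, S) (3 * L + z)).
  rewrite /H /= hS mul1r expRN -!invfM lef_pV2 ?posrE ?expR_gt0 ?mulr_gt0 ?exprn_gt0 ?ltr0n //.
  rewrite -mulrA mulrC expRD; apply: ler_pM; rewrite ?mulr_ge0 ?exprn_ge0 //.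
    exact: sqr_double_le_expR.
  rewrite -[z]mulr1 expRM_natl; apply: lerXn2r; rewrite ?nnegrE ?expR_ge0 //.
  exact: two_le_expR.
- by move=> j f; rewrite /H !mulr_ge0 // invr_ge0 ?sqr_ge0 // ltW.
- move=> f; rewrite -(pair_bigA _ (fun ba S => H (ba, S) f)) /=.
  have e (ba : 'I_n * 'I_n) : \sum_(S : {set 'I_n}) H (ba, S) f = (N ^+ 2)^-1.
    rewrite /H /= -!mulr_suml; set Z := zon _ _ f.
    have -> : \sum_(S : {set 'I_n}) (S \subset Z)%:R = 2 ^+ #|Z| :> R.
      rewrite -natrX -card_powerset -sum1_card natr_sum [RHS]big_mkcond /=.
      by apply: eq_bigr => S _; rewrite powersetE; case: (S \subset Z).
    by rewrite mulfV ?mul1r // gt_eqF.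
  under eq_bigr => ba _ do rewrite e.
  rewrite sumr_const card_prod card_ord -(mulr_natl (N ^+ 2)^-1) natrM -expr2 mulfV //.
  exact: expf_neq0.
Qed.

(** The third clause restates the cut bound at the tilt [lam2]: from the first clause the term
    [lam * |fX|] in [cform_le] would be of order [n / rho^2], which is too large. *)
Definition good w := [/\ forall X Y : {set 'I_n}, `|fX p X Y w| <= 55 * N * sg,
  forall v, `|dt p w v| <= sg ^+ 2,
  forall X Y : {set 'I_n},
    lam2 * `|fX p X Y w| <= 2 * pq * lam2 ^+ 2 * (#|X|%:R * #|Y|%:R) + (6 * L + 3 * N),
  zone_ok k K sg rho w &
  forall b a : 'I_n, switch_ok lam1 (9 * L) (core b a) (core b a) w /\
   forall S, S \subset zon b a (dgf w) ->
    switch_ok lam2 (9 * L + #|zon b a (dgf w)|%:R) (fun=> S) (core b a) w /\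
    switch_ok lam2 (9 * L + #|zon b a (dgf w)|%:R) (fun=> S) (fun=> S) w].

Lemma whp_good : whp pe (expR (6 * L) / 2 / 2 / 2) good.
Proof.
have [N2 L2 LN K1 _] := facts; have h := hsg.
have n0 : (0 < n)%N by apply: leq_trans n2.
have s1 : 1 <= sg by lra.
have hL : 144 * L <= sg ^+ 2.
  have hl : L <= sg by move: hreg; apply: reg_L_sg.
  by rewrite expr2; apply: ler_pM => //; lra.
have hl2 : 0 <= lam2 <= 1 / 6 by case/andP: lam2_bound => ? ->; rewrite ltW.
have a1 := whp_cut_sg p01 n2 sg0 sgE s1.
have a2 := whp_deg_sg p01 n2 sgE hL.
have a3 := @whp_cut R n p p01 lam2 (6 * L) (3 * N) hl2 (double_exp2_le_expR R n2).
have a4 : whp pe (expR (6 * L) / 2) (zone_ok k K sg rho) by move: hreg; apply: whp_zone_ok.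
have a5 := whp_core.
have a6 := whp_sub (fun (b a : 'I_n) _ => core b a).
have a7 := whp_sub (fun (b a : 'I_n) (S : {set 'I_n}) _ => S).
have c1 := whp_and a1 a2; have c2 := whp_and a5 a6; have c3 := whp_and a3 a7.
have d1 := whp_and c1 c2; have d2 := whp_and c3 a4.
apply: whp_le (lexx _) _ (whp_and d1 d2).
move=> w [[[b1 b2] [b3 b4]] [[b5 b6] b7]].
have sm : small M w by apply: (small_switch_span p01).
split=> // b a; split; first exact: b3.
by move=> S hS; split; [exact: b4|exact: b6].
Qed.

Section Bounds.
Variable w : {set I}.
Hypothesis hgood : good w.

Let n0 : (0 < n)%N. Proof. exact: leq_trans n2. Qed.
Let s1 : 1 <= sg. Proof. by have [_ _ _ K1 _] := facts; have h := hsg; lra. Qed.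
Let kN : 4 * k' <= N. Proof. by rewrite -(natrM R 4) ler_nat. Qed.

Lemma core_cform (b a : 'I_n) : #|core b a (dgf w)|%:R <= 3 * k' ->
  `|cform (W w) (ind R (core b a (dgf w))) (ind R (core b a (dgf w)))| <= 450 * 450 * (N * L).
Proof.
move=> hx; have [hcut hdeg _ _ hsw] := hgood; have [sw _] := hsw b a.
have [N2 L2 LN K1 [k1 _]] := facts; have /andP[l0 l3] := lam1_bound.
have t0 : 0 <= 9 * L by lra.
apply: le_trans (cform_le p01 n0 s1 sgE hcut hdeg erefl erefl l0 t0 sw) _.
set X := core b a (dgf w) in hx *.
have ss := s1; have pq0 := pq_ge0 p01; have pq4 := pq_le p; have hf := hcut X X.
have kn := kN.
have s2 : 0 < sg ^+ 2 by rewrite exprn_gt0 //; lra.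
have A1 : lam1 * (24 * pq * (#|X|%:R * #|X|%:R)) <= 72 * N.
  have -> : lam1 * (24 * pq * (#|X|%:R * #|X|%:R)) = 8 * (#|X|%:R * #|X|%:R) / N.
    have pqp : 0 < pq by move: s2; rewrite sgE pmulr_rgt0 //; lra.
    by rewrite /lam1 sgE; field; rewrite !gt_eqF //; lra.
  rewrite ler_pdivrMr; last by lra.
  have := ler_pM (ler0n R #|X|) (ler0n R #|X|) hx hx.
  have kN1 : k' <= N by rewrite ler_nat; apply: leq_trans k4; rewrite leq_pmull.
  have : k' * k' <= N * N by apply: ler_pM.
  lra.
have A2 : lam1 * `|fX p X X w| <= 55 * N.
  have h1 : lam1 * sg <= 1.
    rewrite /lam1 mulrC ler_pdivrMr ?mul1r; last by lra.
    have : sg <= sg ^+ 2 by rewrite expr2; apply: ler_peMl.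
    lra.
  have h2 := ler_wpM2l (ltW l0) hf.
  have h3 : 55 * N * (lam1 * sg) <= 55 * N * 1 by apply: ler_wpM2l => //; exact: mulr_ge0.
  lra.
have A3 : lam1 * N <= N by apply: ler_piMl => //; apply: le_trans l3 _; rewrite ler_pdivrMr // mul1r ler1n.
have A4 : 144 * (9 * L) / lam1 <= 972 * (N * L).
  rewrite /lam1 invrK sgE.
  have : N * L * pq <= N * L * (1 / 4) by apply: ler_wpM2l => //; apply: mulr_ge0 => //; apply: le_trans L2; rewrite divr_ge0.
  lra.
have NL := natr_le_mul_ln R n2.
rewrite mulrDr mulrDr; lra.
Qed.

Lemma sub_cform S (Y : {ffun 'I_n -> nat} -> {set 'I_n}) (z : R) :
    #|S|%:R <= z -> z <= 2 * k' -> #|Y (dgf w)|%:R <= 3 * k' ->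
    switch_ok lam2 (9 * L + z) (fun=> S) Y w ->
  `|cform (W w) (ind R S) (ind R (Y (dgf w)))| <= 450 * 450 * (N * L) + 900 * (sg * rho ^+ 2 * z).
Proof.
move=> hx hz hy sw; have [hcut hdeg hc2 _ _] := hgood.
have [N2 L2 LN K1 [k1 _]] := facts; have /andP[l0 l6] := lam2_bound.
have z0 : 0 <= z by apply: le_trans hx.
have t0 : 0 <= 9 * L + z by lra.
have hs2 := hsr2; have kn := kN.
apply: le_trans (@cform_le R n p p01 w sg n0 s1 sgE hcut hdeg (fun=> S) Y _ _ _ _ erefl erefl l0 t0 sw) _.
set Y0 := Y (dgf w) in hy *.
have hf := hc2 S Y0.
have pq0 := pq_ge0 p01.
have pqk : pq * k' = (sg * rho ^+ 2) ^+ 2 by rewrite exprMn sgE -hr; ring.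
have xy : pq * (#|S|%:R * #|Y0|%:R) <= 3 * z * (sg * rho ^+ 2) ^+ 2.
  rewrite -pqk (_ : 3 * z * (pq * k') = pq * (z * (3 * k'))); last by ring.
  by apply: ler_wpM2l => //; apply: ler_pM.
have s2N : sg * rho ^+ 2 <= N.
  by apply: le_trans (sg_le n2 sg0 sgE); rewrite ler_piMr //; apply: exprn_ile1 => //; exact: ltW.
move: hf xy hs2 s2N l0 l6; rewrite /lam2; clear sw.
set s2 := sg * rho ^+ 2; move: (s2) => y; set g := `|fX p S Y0 w|; set q := #|S|%:R * #|Y0|%:R.
move: (g) (q) => {}g {}q hf xy hs2 s2N l0 l6.
have A1 : (6 * y)^-1 * (24 * pq * q) <= 12 * (y * z).
  rewrite mulrC ler_pdivrMr; last by lra.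
  lra.
have A2 : (6 * y)^-1 * g <= z / 6 + 9 * N.
  apply: le_trans hf _.
  have : 2 * pq * (6 * y)^-1 ^+ 2 * q <= z / 6.
    rewrite exprVn (_ : 2 * pq * _ * q = 2 * (pq * q) / (6 * y) ^+ 2); last by ring.
    rewrite ler_pdivrMr; last by rewrite exprn_gt0 //; lra.
    lra.
  lra.
have A3 : (6 * y)^-1 * N <= N by apply: ler_piMl => //; apply: le_trans l6 _; rewrite ler_pdivrMr // mul1r ler1n.
have A4 : 144 * (9 * L + z) / (6 * y)^-1 <= 864 * (y * z) + 864 * 9 * (N * L).
  rewrite invrK; have : y * L <= N * L by apply: ler_wpM2r => //; apply: le_trans L2; rewrite divr_ge0.
  lra.
have NL := natr_le_mul_ln R n2.
have yz : 0 <= y * z by apply: mulr_ge0 => //; exact: le_trans ler01 hs2.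
rewrite mulrDr mulrDr; lra.
Qed.

End Bounds.

End HardRegime.

Lemma zone_arith (R : realType) (N L k w1 K sg rho z : R) :
    2 <= N -> 1 / 2 <= L -> 300 <= K -> 1 <= k -> 1 <= w1 -> 0 < sg -> 0 < rho -> rho <= 1 ->
    rho ^+ 4 * N = k -> sg ^+ 2 <= N -> 1000 * K * w1 <= sg * rho ->
    1000 * K * L <= sg * rho ^+ 5 ->
    z <= 8 * (w1 * (30 * K * (k / (rho * sg)) + 16 * L)) ->
  z <= 2 * k /\ sg * rho ^+ 2 * z <= 250 * K * (N * L + k * w1).
Proof.
have arith (KX Kk KY Y NL KNL : R) : KX <= Kk -> 1000 * KY <= NL -> Y <= KY -> NL <= KNL ->
    0 <= Kk -> 0 <= NL -> 240 * KX + 128 * Y <= 250 * KNL + 250 * Kk by move=> *; lra.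
have arith1 (Kx y k0 z0 : R) : 0 <= k0 -> z0 <= 8 * (30 * Kx + 16 * y) -> 1000 * Kx <= k0 ->
    1000 * 1000 * y <= k0 -> z0 <= 2 * k0 by move=> *; lra.
move=> N2 L2 K1 k1 hw1 sp r0 r1 hr s2N hW hL.
set T := 30 * K * _ + _ => zT.
have rs : 0 < rho * sg by rewrite mulr_gt0.
have sg0 := ltW sp.
have w0 : 0 <= w1 := le_trans ler01 hw1.
have L0 : 0 <= L by apply: le_trans L2; rewrite divr_ge0.
have K1' : 1 <= K by apply: le_trans K1; rewrite ler1n.
have Kp : 0 <= K := le_trans ler01 K1'.
have k0 : 0 <= k := le_trans ler01 k1.
have N0 : 0 <= N by apply: le_trans N2.
have r2 : 0 <= rho ^+ 2 by apply: exprn_ge0; exact: ltW.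
have s22 : 0 <= sg ^+ 2 by apply: exprn_ge0.
have s2r : 0 <= sg * rho ^+ 2 by apply: mulr_ge0.
have B1 : 1000 * K * (w1 * (k / (rho * sg))) <= k.
  have -> : 1000 * K * (w1 * (k / (rho * sg))) = 1000 * K * w1 / (rho * sg) * k by ring.
  by apply: ler_piMl => //; rewrite ler_pdivrMr // mul1r (mulrC rho).
have rX i : rho ^+ i <= 1 by apply: exprn_ile1 => //; exact: ltW.
have K0 : 0 <= 1000 * K by apply: mulr_ge0.
have B2 : 1000 * K * w1 * (1000 * K * L) <= k.
  (* The product of the two regime inequalities is [sg^2 rho^6], at most [N rho^4 = k]; this bounds
     the logarithmic part of the zone. *)
  apply: (@le_trans _ _ (sg * rho * (sg * rho ^+ 5))).
    by apply: ler_pM => //; apply: mulr_ge0.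
  have -> : sg * rho * (sg * rho ^+ 5) = sg ^+ 2 * rho ^+ 2 * rho ^+ 4 by ring.
  rewrite -hr [leRHS]mulrC; apply: ler_wpM2r; first exact: exprn_ge0 (ltW r0).
  by apply: le_trans s2N; apply: ler_piMr.
have wL0 : 0 <= w1 * L by apply: mulr_ge0.
have KK : 1 <= K * K by rewrite -[leLHS]mulr1; apply: ler_pM.
have B3 : 1000 * 1000 * (w1 * L) <= k.
  apply: le_trans B2; rewrite (_ : 1000 * K * w1 * (1000 * K * L) = 1000 * 1000 * (w1 * L) * (K * K)); last by ring.
  by apply: ler_peMr => //; apply: mulr_ge0 => //; apply: mulr_ge0.
have B4 : 1000 * K * (sg * rho ^+ 2 * (w1 * L)) <= N * L.
  have -> : 1000 * K * (sg * rho ^+ 2 * (w1 * L)) = 1000 * K * w1 * (sg * rho ^+ 2) * L by ring.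
  apply: ler_wpM2r => //.
  apply: (@le_trans _ _ (sg * rho * (sg * rho ^+ 2))).
    by apply: ler_wpM2r.
  have -> : sg * rho * (sg * rho ^+ 2) = sg ^+ 2 * rho ^+ 3 by ring.
  by apply: le_trans s2N; apply: ler_piMr.
have B5 : sg * rho ^+ 2 * (k / (rho * sg)) <= k.
  have -> : sg * rho ^+ 2 * (k / (rho * sg)) = k * rho by field; rewrite !gt_eqF.
  by apply: ler_piMr.
have eqT : w1 * T = 30 * (K * (w1 * (k / (rho * sg)))) + 16 * (w1 * L) by rewrite /T; ring.
split.
  by rewrite eqT in zT; apply: (arith1 _ _ _ _ k0 zT _ B3); rewrite mulrA.
apply: (@le_trans _ _ (sg * rho ^+ 2 * (8 * (w1 * T)))).
  by apply: ler_wpM2l.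
have -> : sg * rho ^+ 2 * (8 * (w1 * T))
  = 240 * K * (w1 * (sg * rho ^+ 2 * (k / (rho * sg)))) + 128 * (sg * rho ^+ 2 * (w1 * L)).
  by rewrite eqT; ring.
have B6 : K * (w1 * (sg * rho ^+ 2 * (k / (rho * sg)))) <= K * (w1 * k).
  by apply: ler_wpM2l => //; apply: ler_wpM2l.
have x0 : 0 <= sg * rho ^+ 2 * (w1 * L).
  by apply: mulr_ge0.
have B7 : sg * rho ^+ 2 * (w1 * L) <= K * (sg * rho ^+ 2 * (w1 * L)) by apply: ler_peMl.
have NL0 : 0 <= N * L by apply: mulr_ge0.
have B8 : N * L <= K * (N * L) by apply: ler_peMl.
have B9 : 0 <= K * (w1 * k) by apply: mulr_ge0 => //; apply: mulr_ge0.
apply: (@le_trans _ _ (250 * (K * (N * L)) + 250 * (K * (w1 * k)))).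
  rewrite -(mulrA 240); apply: (arith _ _ _ _ (N * L) _ B6 _ B7 B8 B9 NL0).
  by rewrite mulrA.
by rewrite le_eqVlt; apply/orP; left; apply/eqP; ring.
Qed.

(** * Size of the zone in the hard regime *)

Section ZoneBound.
Variables (R : realType) (n : nat) (p : R) (k ww : nat) (K sg rho : R).
Hypotheses (p01 : 0 <= p <= 1) (n2 : (2 <= n)%N) (k0 : (0 < k)%N) (k4 : (4 * k <= n)%N)
  (hwk : (ww <= k)%N) (hK : 16 * 12 ^+ 4 <= K)
  (r0 : 0 < rho) (r1 : rho <= 1) (hr : rho ^+ 4 * n%:R = k%:R)
  (sg0 : 0 <= sg) (sgE : sg ^+ 2 = n%:R * pq p).
Local Notation I := ('I_n * 'I_n)%type.
Local Notation pq := (pq p).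
Local Notation N := (@GRing.natmul R 1 n).
Local Notation L := (ln (@GRing.natmul R 1 n)).
Local Notation k' := (@GRing.natmul R 1 k).
Local Notation w1 := (@GRing.natmul R 1 ww + 1).
Local Notation Q := (N * L + k' * w1).
Hypothesis hreg : 1000 * K * Q < k' * sg * rho.

Lemma zone_size (w : {set I}) b a : zone_ok k K sg rho w ->
    #|[set v | (b + ww < dg w v)%N]|%:R <= 2 * k' ->
    #|[set v | (dg w v + ww < a)%N]|%:R <= 2 * k' ->
  #|zon ww b a (dgf w)|%:R <= 2 * k' /\ sg * rho ^+ 2 * #|zon ww b a (dgf w)|%:R <= 250 * K * Q.
Proof.
move=> hz hb ha; set z := #|zon _ _ _ _|%:R.
have [N2 L2 LN K1 [k1 hw1]] := reg_facts ww n2 k0 hK.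
have kap0 : 0 <= kap K sg rho by rewrite /kap; apply: divr_ge0; [lra|apply: mulr_ge0 => //; exact: ltW].
have c0 : 0 <= czone n k K sg rho by move: hreg; apply: czone_ge0.
have kw : (2 * ww%:R + 1) * kap K sg rho <= 1 / 2.
  by apply: (@le_trans _ _ (1 / 4)); [by move: hreg; apply: kapw|lra].
pose Zb := [set v | (b <= dg w v + ww) && (dg w v <= b + ww)]%N.
pose Za := [set v | (a <= dg w v + ww) && (dg w v <= a + ww)]%N.
have hZb : #|Zb|%:R <= 2 * (2 * ww%:R + 1) * (kap K sg rho * (2 * k') + czone n k K sg rho).
  apply: (zone_side (d := dg w) (b := b) kap0 c0 kw _ hb) => v; rewrite inE => /andP[h1 h2] //.
  exists [set u | (dg w v <= dg w u)%N]; last by have [] := hz v.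
  by apply/subsetP => u; rewrite !inE => h; case: (leqP (dg w u) (b + ww)) => //= _;
    rewrite andbT (leq_trans h1) // leq_add2r.
have hZa : #|Za|%:R <= 2 * (2 * ww%:R + 1) * (kap K sg rho * (2 * k') + czone n k K sg rho).
  apply: (zone_side (d := dg w) (b := a) kap0 c0 kw _ ha) => v; rewrite inE => /andP[h1 h2] //.
  exists [set u | (dg w u <= dg w v)%N]; last by have [] := hz v.
  by apply/subsetP => u; rewrite !inE => h; case: (leqP a (dg w u + ww)) => //= _; exact: leq_trans h h2.
have hz' : z <= #|Zb|%:R + #|Za|%:R.
  rewrite /z -natrD ler_nat; apply: leq_trans (leq_card_setU _ _); apply: subset_leq_card.
  by apply/subsetP => v; rewrite !inE ffunE.
have hs : 1000 * K <= sg by move: hreg; apply: reg_sg.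
have hW : 1000 * K * w1 <= sg * rho by move: hreg; apply: reg_w.
have hL : 1000 * K * L <= sg * rho ^+ 5 by move: hreg; apply: reg_L.
have sp : 0 < sg by apply: lt_le_trans hs; apply: mulr_gt0 => //; apply: lt_le_trans K1.
have rs : 0 < rho * sg by rewrite mulr_gt0.
set T := 30 * K * (k' / (rho * sg)) + 16 * L.
have eT : kap K sg rho * (2 * k') + czone n k K sg rho = T.
  by rewrite /kap /czone /T; field; rewrite !gt_eqF.
rewrite eT in hZb hZa.
have T0 : 0 <= T by rewrite -eT addr_ge0 // mulr_ge0 // mulr_ge0.
have zT : z <= 8 * (w1 * T).
  have : (2 * ww%:R + 1) * T <= 2 * w1 * T by apply: ler_wpM2r => //; rewrite mulrDr mulr1 lerD2l ler1n.
  lra.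
have s2N : sg ^+ 2 <= N by rewrite sgE ler_piMr //; apply: le_trans (pq_le p) _; rewrite ler_pdivrMr // mul1r ler1n.
exact: (zone_arith N2 L2 K1 k1 hw1 sp r0 r1 hr s2N hW hL zT).
Qed.

End ZoneBound.

Lemma hard_arith (R : realType) (K x y u a b c : R) : 300 <= K -> 0 <= x -> 0 <= y ->
    a <= 450 * 450 * x -> b <= 450 * 450 * x + 900 * u -> c <= 450 * 450 * x + 900 * u ->
    u <= 250 * K * (x + y) ->
  a + 2 * b + c <= 900 * 900 * 2 * K * (x + y).
Proof.
move=> K1 x0 y0 ha hb hc hu.
have h1 : 300 * x <= K * x by apply: ler_wpM2r.
have h2 : 0 <= K * y by apply: mulr_ge0 => //; lra.
lra.
Qed.

Lemma crude_arith (R : realType) (K x y u f : R) : 300 <= K -> 0 <= x -> 0 <= y ->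
    u <= 1000 * K * (x + y) -> f <= 12 * u + 90 * x ->
  f <= 900 * 900 * 2 * K * (x + y).
Proof.
move=> K1 x0 y0 hu hf.
have h1 : 300 * x <= K * x by apply: ler_wpM2r.
have h2 : 0 <= K * y by apply: mulr_ge0 => //; lra.
lra.
Qed.

(** * The quadratic form of the pruned set *)

Section PrunedForm.
Variables (R : realType) (n : nat) (p : R) (k ww : nat) (K : R).
Hypotheses (p01 : 0 <= p <= 1) (n2 : (2 <= n)%N) (k4 : (4 * k <= n)%N)
  (hwk : (ww <= k)%N) (hK : 16 * 12 ^+ 4 <= K).
Local Notation I := ('I_n * 'I_n)%type.
Local Notation pe := (@pe R n p).
Local Notation W := (@W R n p).
Local Notation pq := (pq p).
Local Notation N := (@GRing.natmul R 1 n).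
Local Notation L := (ln (@GRing.natmul R 1 n)).
Local Notation k' := (@GRing.natmul R 1 k).
Local Notation w1 := (@GRing.natmul R 1 ww + 1).
Local Notation Q := (N * L + k' * w1).
Implicit Types (w : {set I}) (S X Y U B C T Lo : {set 'I_n}).

Lemma form_one w X : form (W w) (ind R X) (@one R n) = \sum_(v in X) dt p w v.
Proof.
rewrite formE [RHS]big_mkcond; apply: eq_bigr => v _.
rewrite /ind /mulv /dt; under eq_bigr => c _ do rewrite /one mulr1.
by case: (v \in X); rewrite /= ?mul1r ?mul0r.
Qed.

Lemma ind_setT : ind R [set: 'I_n] = @one R n.
Proof. by apply: boolp.funext => v; rewrite /ind inE. Qed.

(** Centring removes only a degree sum over [X] and the total form, both controlled separately. *)
Lemma form_cform w X : fX p X X w = cform (W w) (ind R X) (ind R X)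
  + 2 * (#|X|%:R / N) * (\sum_(v in X) dt p w v) - (#|X|%:R / N) ^+ 2 * fX p setT setT w.
Proof.
rewrite /cform /fX form_one !sum_ind ind_setT.
by rewrite exprMn exprVn; move: (form _ _ _) (form _ _ _) (\sum_(v in X) _) (N^-1) => f g s y; ring.
Qed.

Lemma sum_diff_le (f : 'I_n -> R) X Y B (eta : R) :
    (forall v, v \notin B -> (v \in X) = (v \in Y)) -> (forall v, `|f v| <= eta) ->
  `|\sum_(v in X) f v - \sum_(v in Y) f v| <= #|B|%:R * eta.
Proof.
move=> hXY hf; rewrite big_mkcond [X in _ - X]big_mkcond -sumrB.
apply: (@le_trans _ _ (\sum_(v in B) eta)); last by rewrite sumr_const mulr_natl.
apply: le_trans (ler_norm_sum _ _ _) _; rewrite [leRHS]big_mkcond; apply: ler_sum => v _.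
case: (boolP (v \in B)) => [vB|vB]; last first.
  by rewrite hXY // subrr normr0.
have e0 : 0 <= eta by apply: le_trans (hf v).
by case: (v \in X); case: (v \in Y); rewrite ?subrr ?subr0 ?sub0r ?normrN ?normr0.
Qed.

(** [U] is replaced by the disjoint union of the core [C] and the remaining uncorrupted pruned
    vertices [S], which differs from [U] only inside [B]. The centred form then splits into the
    three pieces bounded by switchings. *)
Lemma sandwich_form w C B U (A Dt FT eta : R) : C \subset U :|: B ->
    #|U :|: B|%:R <= 3 * k' ->
    let S := (U :\: B) :\: C in
    `|cform (W w) (ind R C) (ind R C)| + 2 * `|cform (W w) (ind R S) (ind R C)|
      + `|cform (W w) (ind R S) (ind R S)| <= A ->
    `|\sum_(v in U) dt p w v| <= Dt -> `|fX p setT setT w| <= FT ->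
    (forall v, `|dt p w v| <= eta) ->
  `|fX p U U w| <= A + 2 * (Dt + #|B|%:R * eta) + FT + 6 * k' * #|B|%:R.
Proof.
move=> CU hk S hA hDt hFT heta; pose Y := C :|: S.
have dCS : [disjoint C & S].
  rewrite -setI_eq0; apply/eqP/setP => v; rewrite !inE.
  by case: (v \in C); rewrite ?andbF.
have hUY v : v \notin B -> (v \in U) = (v \in Y).
  move=> vB; rewrite !inE vB /=; case: (boolP (v \in C)) => vC //=.
  by have := subsetP CU v vC; rewrite !inE (negbTE vB) orbF.
have UYB : U :|: Y \subset U :|: B.
  rewrite subUset subsetUl subUset CU /=; apply/subsetP => v.
  by rewrite !inE => /andP[_ /andP[_ ->]].
have UYk : #|U :|: Y|%:R <= 3 * k'.
  by apply: le_trans hk; rewrite ler_nat; exact: subset_leq_card.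
have D1 := form_diff_le (W_le1 p01 w) hUY UYk.
rewrite -/(fX p U U w) -/(fX p Y Y w) in D1.
have D2 : `|\sum_(v in U) dt p w v - \sum_(v in Y) dt p w v| <= #|B|%:R * eta by apply: sum_diff_le.
have D4 : cform (W w) (ind R Y) (ind R Y) = cform (W w) (ind R C) (ind R C)
   + 2 * cform (W w) (ind R S) (ind R C) + cform (W w) (ind R S) (ind R S).
  by rewrite (ind_setU R dCS) cform_add //; exact: WC.
have D5 : `|cform (W w) (ind R Y) (ind R Y)| <= A.
  rewrite D4; apply: le_trans hA; apply: le_trans (ler_normD _ _) _; rewrite lerD2r.
  by apply: le_trans (ler_normD _ _) _; rewrite lerD2l normrM (ger0_norm (ler0n R 2)).
have Np : 0 < N by rewrite ltr0n (leq_trans _ n2).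
have y0 : 0 <= #|Y|%:R / N by rewrite divr_ge0.
have y1 : #|Y|%:R / N <= 1.
  by rewrite ler_pdivrMr // mul1r ler_nat -[leqRHS]card_ord max_card.
have D6 : `|\sum_(v in Y) dt p w v| <= Dt + #|B|%:R * eta.
  rewrite -[X in `|X|](subrK (\sum_(v in U) dt p w v)) addrC.
  by apply: le_trans (ler_normD _ _) _; rewrite (distrC (\sum_(v in Y) _)); apply: lerD.
have D7 : `|fX p Y Y w| <= A + 2 * (Dt + #|B|%:R * eta) + FT.
  rewrite form_cform; apply: le_trans (ler_normB _ _) _; apply: lerD.
    apply: le_trans (ler_normD _ _) _; apply: lerD => //.
    have y2 : 0 <= 2 * (#|Y|%:R / N) by apply: mulr_ge0.
    rewrite normrM (ger0_norm y2); apply: ler_pM => //.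
    by apply: ler_piMr.
  rewrite normrM (ger0_norm (sqr_ge0 _)); apply: le_trans hFT; apply: ler_piMl => //.
  exact: exprn_ile1.
rewrite -[X in `|X|](subrK (fX p Y Y w)); apply: le_trans (ler_normD _ _) _.
rewrite addrC; apply: lerD => //; apply: le_trans D1 _.
by rewrite le_eqVlt; apply/orP; left; apply/eqP; ring.
Qed.

Section Hard.
Variables sg rho : R.
Hypotheses (k0 : (0 < k)%N) (r0 : 0 < rho) (r1 : rho <= 1) (hr : rho ^+ 4 * n%:R = k%:R)
  (sg0 : 0 <= sg) (sgE : sg ^+ 2 = n%:R * pq) (hreg : 1000 * K * Q < k' * sg * rho).
Local Notation core := (core (n := n) ww).
Local Notation zon := (zon (n := n) ww).

Lemma pruned_form_hard w (dA : 'I_n -> nat) B T Lo (Dt FT eta : R) :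
    good p k ww K sg rho w ->
    (#|B| <= ww)%N -> (forall v, (dA v < n)%N) ->
    (forall v, v \notin B -> (dA v <= dg w v + ww)%N /\ (dg w v <= dA v + ww)%N) ->
    #|T| = k -> #|Lo| = k ->
    top (fun v => (dA v)%:R : R) T -> top (fun v => - (dA v)%:R : R) Lo ->
    `|\sum_(v in T :|: Lo) dt p w v| <= Dt -> `|fX p setT setT w| <= FT ->
    (forall v, `|dt p w v| <= eta) ->
  `|fX p (T :|: Lo) (T :|: Lo) w|
    <= 900 * 900 * 2 * K * Q + 2 * (Dt + ww%:R * eta) + FT + 6 * k' * ww%:R.
Proof.
move=> hgood hB hdn hdA cT cL tT tL hDt hFT heta; set U := T :|: Lo in hDt *.
have kn : (k < n)%N by apply: leq_trans k4; rewrite -{1}[k]mul1n ltn_mul2r k0.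
have [v0 v0T [b1 b2]] := top_threshold (T := T) ltac:(by rewrite cT) tT.
have [v1 v1L [a1 a2]] := top_threshold (T := Lo) ltac:(by rewrite cL) tL.
(* The thresholds are adversarial, but each takes at most [n] values, and [good] covers all of
   them. *)
pose b := Ordinal (hdn v0); pose a := Ordinal (hdn v1).
have {}b1 v : v \notin T -> (dA v <= b)%N by move=> /b1; rewrite ler_nat.
have {}b2 v : v \in T -> (b <= dA v)%N by move=> /b2; rewrite ler_nat.
have {}a1 v : v \notin Lo -> (a <= dA v)%N by move=> /a1; rewrite lerN2 ler_nat.
have {}a2 v : v \in Lo -> (dA v <= a)%N by move=> /a2; rewrite lerN2 ler_nat.
set d := dgf w; have dE v : d v = dg w v by rewrite ffunE.
(* Off [B], a true degree above [b + ww] forces a corrupted degree above [b], hence membership in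
   [T]. *)
have hiT : [set v | (b + ww < dg w v)%N] \subset T :|: B.
  apply/subsetP => v; rewrite !inE => hv; case: (boolP (v \in B)) => vB; rewrite ?orbT // orbF.
  apply: contraLR hv => vT; have := b1 v vT; have [_] := hdA v vB; clear -vT; move=> *; lia.
have loL : [set v | (dg w v + ww < a)%N] \subset Lo :|: B.
  apply/subsetP => v; rewrite !inE => hv; case: (boolP (v \in B)) => vB; rewrite ?orbT // orbF.
  apply: contraLR hv => vT; have := a1 v vT; have [+ _] := hdA v vB; clear -vT; move=> *; lia.
have c2 X Y (m : nat) : X \subset Y :|: B -> #|Y| = m -> #|X|%:R <= (m + ww)%:R :> R.
  move=> h <-; rewrite ler_nat; apply: leq_trans (subset_leq_card h) _.
  by apply: leq_trans (leq_card_setU _ _) _; rewrite leq_add2l.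
have kw : (k + ww)%:R <= 2 * k' by rewrite -(natrM R 2) ler_nat mul2n -addnn leq_add2l.
have hb : #|[set v | (b + ww < dg w v)%N]|%:R <= 2 * k' by apply: le_trans (c2 _ _ _ hiT cT) kw.
have ha : #|[set v | (dg w v + ww < a)%N]|%:R <= 2 * k' by apply: le_trans (c2 _ _ _ loL cL) kw.
have [z2 zQ] : #|zon b a d|%:R <= 2 * k' /\ sg * rho ^+ 2 * #|zon b a d|%:R <= 250 * K * Q.
  by apply: (zone_size (p := p)) => //; case: hgood.
pose C := core b a d; pose S := (U :\: B) :\: C.
have CU : C \subset U :|: B.
  apply/subsetP => v; rewrite inE dE => /orP[h|h].
    have : v \in T :|: B by apply: (subsetP hiT); rewrite inE.
    by rewrite !inE => /orP[->|->]; rewrite ?orbT.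
  have : v \in Lo :|: B by apply: (subsetP loL); rewrite inE.
  by rewrite !inE => /orP[->|->]; rewrite ?orbT.
have cU : (#|U| <= 2 * k)%N by rewrite mul2n -addnn -{1}cT -cL leq_card_setU.
have c3 X : X \subset U :|: B -> #|X|%:R <= 3 * k'.
  move=> h; apply: (@le_trans _ _ (2 * k + k)%:R); last by rewrite natrD natrM; lra.
  rewrite ler_nat; apply: leq_trans (subset_leq_card h) _.
  by apply: leq_trans (leq_card_setU _ _) _; apply: leq_add => //; apply: leq_trans hB hwk.
have SZ : S \subset zon b a d.
  apply/subsetP => v; rewrite !inE !dE negb_or -!leqNgt => /andP[/andP[h1 h2] /andP[vB vU]].
  have [h3 h4] := hdA v vB.
  case/orP: vU => vU.
    by have h5 := b2 v vU; rewrite h1 andbT (_ : (b <= _)%N) //; clear -h5 h3; lia.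
  by have h5 := a2 v vU; rewrite h2 (_ : (dg w v <= a + _)%N) ?orbT //; clear -h5 h4; lia.
have [_ _ _ _ hsw] := hgood; have [_ /(_ S SZ) [sw1 sw2]] := hsw b a.
have cC := c3 _ CU.
have cS : #|S|%:R <= #|zon b a d|%:R :> R by rewrite ler_nat; exact: subset_leq_card.
have cS3 : #|S|%:R <= 3 * k' by apply: le_trans cS _; have := ler0n R k; lra.
have B1 : `|cform (W w) (ind R C) (ind R C)| <= 450 * 450 * (N * L).
  by apply: (core_cform (k := k) (K := K) (sg := sg) (rho := rho)).
have B2 : `|cform (W w) (ind R S) (ind R C)| <= 450 * 450 * (N * L) + 900 * (sg * rho ^+ 2 * #|zon b a d|%:R).
  by apply sub_cform with (k := k) (ww := ww) (K := K) (Y := core b a).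
have B3 : `|cform (W w) (ind R S) (ind R S)| <= 450 * 450 * (N * L) + 900 * (sg * rho ^+ 2 * #|zon b a d|%:R).
  by apply sub_cform with (k := k) (ww := ww) (K := K) (Y := fun=> S).
have [N2 L2 LN K1 [k1 hw1]] := reg_facts ww n2 k0 hK.
have e0 : 0 <= eta by apply: le_trans (heta v0).
have Bw : #|B|%:R <= ww%:R :> R by rewrite ler_nat.
have L0 : 0 <= L by apply: le_trans L2; rewrite divr_ge0.
have NL0 : 0 <= N * L by apply: mulr_ge0.
have kw0 : 0 <= k' * w1 by apply: mulr_ge0 => //; apply: addr_ge0.
have A : `|cform (W w) (ind R C) (ind R C)| + 2 * `|cform (W w) (ind R S) (ind R C)|
    + `|cform (W w) (ind R S) (ind R S)| <= 900 * 900 * 2 * K * Q.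
  exact: (hard_arith K1 NL0 kw0 B1 B2 B3 zQ).
apply: le_trans (sandwich_form CU (c3 _ (subxx _)) A hDt hFT heta) _.
by rewrite -!addrA lerD2l; apply: lerD;
  [apply: ler_wpM2l => //; rewrite lerD2l; apply: ler_wpM2r|rewrite lerD2l; apply: ler_wpM2l => //; exact: mulr_ge0].
Qed.

End Hard.

Lemma whp_always (T : R) (P : {set I} -> Prop) : 0 <= T -> (forall w, P w) -> whp pe T P.
Proof. by move=> T0 hP; exists (fun=> 0); split=> //; rewrite Ex_cst. Qed.

Lemma whp_pruned_form : whp pe (expR (6 * L) / 2 / 2 / 2) (fun w =>
  forall (dA : 'I_n -> nat) B T Lo (Dt FT eta : R),
    (#|B| <= ww)%N -> (forall v, (dA v < n)%N) ->
    (forall v, v \notin B -> (dA v <= dg w v + ww)%N /\ (dg w v <= dA v + ww)%N) ->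
    #|T| = k -> #|Lo| = k -> [disjoint T & Lo] ->
    top (fun v => (dA v)%:R : R) T -> top (fun v => - (dA v)%:R : R) Lo ->
    `|\sum_(v in T :|: Lo) dt p w v| <= Dt -> `|fX p setT setT w| <= FT -> 0 <= eta ->
    (forall v, `|dt p w v| <= eta) ->
  `|fX p (T :|: Lo) (T :|: Lo) w|
    <= 900 * 900 * 2 * K * Q + 2 * (Dt + ww%:R * eta) + FT + 6 * k' * ww%:R).
Proof.
have N2 := natr_ge2 R n2; have L2 := ln_nat_ge R n2.
have T0 : 0 <= expR (6 * L) / 2 / 2 / 2 by rewrite !divr_ge0 // expR_ge0.
have K1 : 300 <= K by apply: le_trans hK; lra.
have NL0 : 0 <= N * L by apply: mulr_ge0; lra.
have kw0 : 0 <= k' * w1 by apply: mulr_ge0 => //; rewrite addr_ge0.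
have Q0 : 0 <= K * Q by apply: mulr_ge0; [lra|exact: addr_ge0].
have rest (Dt FT eta : R) : 0 <= Dt -> 0 <= FT -> 0 <= eta ->
    0 <= 2 * (Dt + ww%:R * eta) + FT + 6 * k' * ww%:R.
  by move=> *; rewrite !addr_ge0 ?mulr_ge0 // addr_ge0 // mulr_ge0.
case: (posnP k) => [k00|k0].
  apply: whp_always => // w dA B T Lo Dt FT eta _ _ _ cT cL _ _ _ hDt hFT e0 _.
  have -> : T :|: Lo = set0.
    by move: cT cL; rewrite k00 => /eqP; rewrite cards_eq0 => /eqP -> /eqP; rewrite cards_eq0 => /eqP ->; rewrite setU0.
  have -> : fX p set0 set0 w = 0.
    rewrite /fX /form big1 // => a _; rewrite big1 // => c _.
    by rewrite /ind inE !mul0r.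
  have := rest Dt FT eta (le_trans (normr_ge0 _) hDt) (le_trans (normr_ge0 _) hFT) e0.
  rewrite normr0; move: Q0; rewrite -!addrA => Q0 h; apply: addr_ge0 => //.
  by rewrite -(mulrA _ K); apply: mulr_ge0 => //; rewrite !mulr_ge0.
set sg := Num.sqrt (N * pq).
have Np : 0 < N by lra.
have pq0 : 0 <= pq by apply: pq_ge0.
have sg0 : 0 <= sg by apply: sqrtr_ge0.
have sgE : sg ^+ 2 = N * pq by rewrite sqr_sqrtr // mulr_ge0.
have kN : k' <= N by rewrite ler_nat; apply: leq_trans k4; rewrite leq_pmull.
have kp : 0 < k' by rewrite ltr0n.
set rho := Num.sqrt (Num.sqrt (k' / N)).
have r0 : 0 < rho by rewrite !sqrtr_gt0 divr_gt0.
have hr : rho ^+ 4 * N = k'.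
  rewrite (_ : rho ^+ 4 = (rho ^+ 2) ^+ 2); last by rewrite -exprM.
  by rewrite !sqr_sqrtr ?sqrtr_ge0 ?divr_ge0 // divfK // gt_eqF.
have r1 : rho <= 1.
  rewrite -(@ler_pXn2r _ 4) ?nnegrE ?(ltW r0) // expr1n -(ler_pM2r Np) hr mul1r //.
(* Below this threshold the error [12 k sg rho] of the union bound is already [O(Q)]. *)
case: (leP (k' * sg * rho) (1000 * K * Q)) => hreg.
  apply: whp_le _ _ (whp_crude p01 n2 sg0 sgE k0 r0 r1 hr).
    by have := expR_ge0 (6 * L); lra.
  move=> w hw dA B T Lo Dt FT eta _ _ _ cT cL dTL _ _ hDt hFT e0 _.
  have cU : #|T :|: Lo| = (2 * k)%N.
    by rewrite cardsU (disjoint_setI0 dTL) cards0 subn0 cT cL mul2n addnn.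
  have := rest Dt FT eta (le_trans (normr_ge0 _) hDt) (le_trans (normr_ge0 _) hFT) e0.
  have h1 := hw _ cU.
  move=> h2; apply: (@le_trans _ _ (900 * 900 * 2 * K * Q)).
    apply: (crude_arith K1 NL0 kw0 hreg).
    by rewrite !(mulrA 12) (mulrA 90).
  by rewrite -!addrA lerDl addrA.
have hgd : whp pe (expR (6 * L) / 2 / 2 / 2) (good p k ww K sg rho) by apply: whp_good.
apply: whp_le (lexx _) _ hgd.
move=> w hw dA B T Lo Dt FT eta h1 h2 h3 h4 h5 _ h6 h7 h8 h9 _ h10.
by apply pruned_form_hard with (dA := dA) (B := B) (sg := sg) (rho := rho).
Qed.
End PrunedForm.

(** * Deterministic effect of the corruption and of the pruning *)

Section Corruption.
Variables (R : realType) (n : nat) (p : R) (k ww m0 : nat).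
Hypotheses (p01 : 0 <= p <= 1) (n2 : (2 <= n)%N) (k4 : (4 * k < n)%N) (hwk : (ww <= k)%N)
  (m0l : m0%:R <= n.-1%:R * p) (m0u : n.-1%:R * p < m0%:R + 1).
Local Notation I := ('I_n * 'I_n)%type.
Local Notation W := (@W R n p).
Local Notation N := (@GRing.natmul R 1 n).
Local Notation k' := (@GRing.natmul R 1 k).
Local Notation w' := (@GRing.natmul R 1 ww).
Variables (w wA : {set I}) (B T Lo Ts Ls : {set 'I_n}) (eta F : R).
Hypotheses (hB : (#|B| <= ww)%N)
  (hadj : forall u v, u \notin B -> v \notin B -> adj wA u v = adj w u v)
  (cT : #|T| = k) (cL : #|Lo| = k) (dTL : [disjoint T & Lo])
  (tT : forall u v, u \in T -> v \notin T -> (dg wA v <= dg wA u)%N)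
  (tL : forall u v, u \in Lo -> v \notin Lo -> (dg wA u <= dg wA v)%N)
  (cTs : #|Ts| = k) (cLs : #|Ls| = k)
  (tTs : forall u v, u \in Ts -> v \notin Ts -> (dg w v <= dg w u)%N)
  (tLs : forall u v, u \in Ls -> v \notin Ls -> (dg w u <= dg w v)%N)
  (e0 : 0 <= eta) (heta : forall v, `|dt p w v| <= eta)
  (hF : forall i : 'I_n.+1, `|\sum_v clip R m0 i (dg w v)| <= F).
Local Notation U := (T :|: Lo).
Local Notation S := (~: (T :|: Lo)).

Let n0 : (0 < n)%N. Proof. exact: leq_trans n2. Qed.
Let kn : (k < n)%N.
Proof. by apply: leq_ltn_trans k4; rewrite leq_pmull. Qed.

Lemma dg_corrupt v : v \notin B -> (dg wA v <= dg w v + ww)%N /\ (dg w v <= dg wA v + ww)%N.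
Proof.
move=> vB; have key (x y : {set I}) : (forall u, u \notin B -> adj x v u = adj y v u) ->
    (dg x v <= dg y v + ww)%N.
  move=> h; apply: (@leq_trans (\sum_u (adj y v u + (u \in B)))).
    apply: leq_sum => u _; case: (boolP (u \in B)) => uB; last by rewrite h // addn0.
    by apply: leq_trans (leq_b1 _) _; rewrite leq_addl.
  rewrite big_split leq_add2l /=; apply: leq_trans hB.
  rewrite -sum1_card [leqRHS]big_mkcond; apply: leq_sum => u _.
  by case: (u \in B).
by split; apply: key => u uB; rewrite hadj.
Qed.

Lemma dt_corrupt v : v \notin B -> `|dt p wA v - dt p w v| <= w'.
Proof.
move=> vB; have [h1 h2] := dg_corrupt vB; rewrite !dtE //.
move: h1 h2; rewrite -2!(ler_nat R) !natrD => h1 h2.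
by rewrite ler_norml; apply/andP; split; lra.
Qed.

Lemma top_dt (x : {set I}) (X : {set 'I_n}) : (forall u v, u \in X -> v \notin X -> (dg x v <= dg x u)%N) ->
  top (dt p x) X.
Proof. by move=> h u v uX vX; rewrite !dtE // lerD2r ler_nat h. Qed.

Lemma top_dtN (x : {set I}) (X : {set 'I_n}) : (forall u v, u \in X -> v \notin X -> (dg x u <= dg x v)%N) ->
  top (fun v => - dt p x v) X.
Proof. by move=> h u v uX vX; rewrite lerN2 !dtE // lerD2r ler_nat h. Qed.

Let Bw : #|B|%:R <= w'. Proof. by rewrite ler_nat. Qed.
Let kwn : k' + w' < N.
Proof.
rewrite -natrD ltr_nat; apply: leq_ltn_trans k4; apply: (@leq_trans (k + k)).
  by rewrite leq_add2l.
by rewrite addnn -mul2n leq_mul2r orbT.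
Qed.

(** This covers corrupted survivors too: their degrees lie between the two pruning thresholds, which
    [threshold_bounds] places near the mean. *)
Lemma dt_survivor v : v \notin U -> `|dt p wA v| <= eta + w'.
Proof.
rewrite inE negb_or => /andP[vT vL].
have hd u : `|dt p w u - 0| <= eta by rewrite subr0.
have hdN u : `|- dt p w u - 0| <= eta by rewrite subr0 normrN.
have hA u : u \notin B -> `|- dt p wA u - - dt p w u| <= w'.
  by move=> uB; rewrite -opprD normrN; exact: dt_corrupt.
have [v0 v0T [h1 h2]] := top_threshold (T := T) ltac:(by rewrite cT) (top_dt tT).
have [v1 v1L [h3 h4]] := top_threshold (T := Lo) ltac:(by rewrite cL) (top_dtN tL).
have a1 : `|dt p wA v0 - 0| <= eta + w'.
  by apply: (threshold_bounds (d := dt p w) (dA := dt p wA) (B := B) (T := T)); rewrite ?cT ?ler_nat //; exact: dt_corrupt.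
have a2 : `|- dt p wA v1 - 0| <= eta + w'.
  by apply: (threshold_bounds (d := fun u => - dt p w u) (dA := fun u => - dt p wA u) (B := B) (T := Lo)); rewrite ?cL ?ler_nat.
have b1 := h1 v vT; have b2 := h3 v vL.
move: a1 a2; rewrite !subr0 !ler_norml => /andP[_ a1] /andP[_ a2].
by apply/andP; split; lra.
Qed.

(** Clipping is around the integer [m0] and not the exact mean [p (n - 1)]; the offset is at most
    [1] per vertex, hence the term [2 k]. *)
Lemma true_trim_le : `|\sum_(v in Ts) dt p w v + \sum_(v in Ls) dt p w v| <= 3 * F + 2 * k'.
Proof.
pose x v : R := (dg w v)%:R - m0%:R.
have en : n.-1%:R = N - 1 :> R by rewrite -(prednK n0) -natr1 addrK.
pose c : R := m0%:R - (N - 1) * p.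
have xE v : dt p w v = x v + c by rewrite dtE // /x /c; lra.
have c1 : `|c| <= 1.
  by move: m0l m0u; rewrite en /c => ? ?; rewrite ler_norml; apply/andP; lra.
have gE (i : 'I_n.+1) : \sum_v clip R m0 i (dg w v) = \sum_v gt i%:R (x v).
  by apply: eq_bigr => v _; rewrite clipE.
have m0n : (m0 <= n)%N.
  rewrite -(ler_nat R); apply: le_trans m0l _; rewrite en; have /andP[p0 p1] := p01.
  have N1 : 0 <= N - 1 by rewrite subr_ge0 ler1n.
  by have := ler_wpM2l N1 p1; lra.
have h : `|\sum_(v in Ts) x v + \sum_(v in Ls) x v| <= 3 * F.
  apply: trimmed_sum_le; rewrite ?cTs ?cLs //.
  - by move=> u v uT vT; rewrite lerD2r ler_nat tTs.
  - by move=> u v uT vT; rewrite lerN2 lerD2r ler_nat tLs.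
  (* The thresholds that occur are integers of absolute value at most [n], so the [n + 1] clip
     levels suffice. *)
  - move=> v; have dn := dg_lt w v; case: (leqP m0 (dg w v)) => hm.
      have hi : (dg w v - m0 < n.+1)%N by apply: leq_ltn_trans (leq_subr _ _) _; exact: ltnW.
      exists (dg w v - m0)%N; first by left; rewrite natrB.
      by have := hF (Ordinal hi); rewrite gE.
    have hi : (m0 - dg w v < n.+1)%N by apply: leq_ltn_trans (leq_subr _ _) _.
    exists (m0 - dg w v)%N; first by right; rewrite natrB 1?ltnW // opprB.
    by have := hF (Ordinal hi); rewrite gE.
  - have := hF ord0; rewrite gE; congr (`|_| <= _); apply: eq_bigr => v _.
    by rewrite /gt !subr0 (posE (x v)) addrK.
have -> : \sum_(v in Ts) dt p w v + \sum_(v in Ls) dt p w v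
   = (\sum_(v in Ts) x v + \sum_(v in Ls) x v) + 2 * k' * c.
  have shift (X : {set 'I_n}) : \sum_(v in X) dt p w v = \sum_(v in X) x v + #|X|%:R * c.
    rewrite (eq_bigr (fun v => x v + c)) => [|v _]; last exact: xE.
    by rewrite big_split sumr_const mulr_natl.
  by rewrite !shift cTs cLs; ring.
apply: le_trans (ler_normD _ _) _; apply: lerD => //.
by rewrite normrM ger0_norm ?mulr_ge0 // ler_piMr // mulr_ge0.
Qed.

Definition Dt : R := 3 * F + 2 * k' + 4 * k' * w' + 8 * w' * (eta + w').

Lemma sum_pruned_le : `|\sum_(v in U) dt p w v| <= Dt.
Proof.
have hd u : `|dt p w u - 0| <= eta by rewrite subr0.
have hdN u : `|- dt p w u - 0| <= eta by rewrite subr0 normrN.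
have hA u : u \notin B -> `|- dt p wA u - - dt p w u| <= w'.
  by move=> uB; rewrite -opprD normrN; exact: dt_corrupt.
have a1 : `|\sum_(v in T) dt p w v - \sum_(v in Ts) dt p w v| <= 2 * #|T|%:R * w' + 4 * w' * (eta + w').
  by apply: (top_exchange (ler0n R ww) e0 Bw (dA := dt p wA) (mu := 0)); rewrite ?cT ?cTs ?ler_nat //;
    [exact: dt_corrupt|exact: top_dt|exact: top_dt].
have a2 : `|\sum_(v in Lo) - dt p w v - \sum_(v in Ls) - dt p w v| <= 2 * #|Lo|%:R * w' + 4 * w' * (eta + w').
  by apply: (top_exchange (ler0n R ww) e0 Bw (dA := fun v => - dt p wA v) (mu := 0)); rewrite ?cL ?cLs ?ler_nat //;
    [exact: top_dtN|exact: top_dtN].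
have a3 := true_trim_le.
rewrite (eq_bigl (mem [predU T & Lo])); last by move=> v; rewrite !inE.
rewrite bigU //=.
rewrite !sumrN cT cL in a1 a2; rewrite /Dt.
move: a1 a2 a3; rewrite !ler_norml => /andP[? ?] /andP[? ?] /andP[? ?].
by apply/andP; split; lra.
Qed.

Lemma sum_pruned_row (x : {set I}) v (b : R) : `|dt p x v| <= b ->
  `|\sum_(u in S) W x v u| <= b + 2 * k'.
Proof.
move=> h.
have -> : \sum_(u in S) W x v u = dt p x v - \sum_(u in U) W x v u.
  rewrite /dt [in RHS](bigID (mem U)) /= addrAC subrr add0r.
  by apply: eq_bigl => u; rewrite inE.
apply: le_trans (ler_normB _ _) _; apply: lerD => //.
apply: le_trans (ler_norm_sum _ _ _) _; apply: (@le_trans _ _ (\sum_(u in U) 1)).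
  by apply: ler_sum => u _; exact: W_le1.
rewrite sumr_const -(natrM R 2) ler_nat mul2n -addnn -{1}cT -cL.
exact: leq_card_setU.
Qed.

Lemma norm_sum_le (X : {set 'I_n}) (f : 'I_n -> R) (c x : R) : 0 <= c -> #|X|%:R <= x ->
  (forall v, v \in X -> `|f v| <= c) -> `|\sum_(v in X) f v| <= x * c.
Proof.
move=> c0 hX hf; apply: le_trans (ler_norm_sum _ _ _) _.
apply: (@le_trans _ _ (\sum_(v in X) c)); first exact: ler_sum.
by rewrite sumr_const -(mulr_natl c); apply: ler_wpM2r.
Qed.

(** Counting changed entries would give [w n]. Instead, the rows of surviving corrupted vertices
    have small sums in both graphs, by [dt_survivor] and [heta]; the columns follow by symmetry, the
    corner within [B] being at most [w] per row. *)
Lemma form_corrupt_le :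
  `|fX p S S wA - fX p S S w| <= w' * (4 * eta + 3 * w' + 8 * k').
Proof.
pose D u v := W wA u v - W w u v.
have D0 u v : u \notin B -> v \notin B -> D u v = 0.
  by move=> uB vB; rewrite /D /W hadj // subrr.
have D1 u v : `|D u v| <= 1.
  rewrite /D /W; case: eqP => _; first by rewrite subrr normr0.
  by case: (adj wA u v); case: (adj w u v); rewrite /= ?mulr1n ?mulr0n ler_norml; apply/andP; lra.
have DC u v : D u v = D v u by rewrite /D !(WC p _ u).
have e : fX p S S wA - fX p S S w = \sum_(u in S) \sum_(v in S) D u v.
  rewrite /fX /form -sumrB [RHS]big_mkcond; apply: eq_bigr => u _.
  rewrite -sumrB /ind; case: (u \in S) => /=; last first.
    by rewrite big1 // => v _; rewrite !mul0r subrr.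
  rewrite [RHS]big_mkcond; apply: eq_bigr => v _; rewrite mul1r.
  by case: (v \in S); rewrite /= ?mul1r ?mul0r ?subrr.
have BS : #|S :&: B|%:R <= w'.
  by apply: le_trans Bw; rewrite ler_nat; apply: subset_leq_card; exact: subsetIr.
have rowD u : u \in S -> `|\sum_(v in S) D u v| <= 2 * eta + w' + 4 * k'.
  rewrite inE => uU; rewrite /D sumrB; apply: le_trans (ler_normB _ _) _.
  have := sum_pruned_row (dt_survivor uU); have := sum_pruned_row (heta u); lra.
have rowB u : `|\sum_(v in S :&: B) D u v| <= w'.
  by rewrite -[leRHS]mulr1; apply: norm_sum_le.
have c0 : 0 <= 2 * eta + w' + 4 * k' by rewrite !addr_ge0 ?mulr_ge0.
rewrite e (big_setID B) /=.
have -> : \sum_(u in S :\: B) \sum_(v in S) D u v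
    = \sum_(v in S :&: B) (\sum_(u in S) D v u - \sum_(u in S :&: B) D v u).
  transitivity (\sum_(u in S :\: B) \sum_(v in S :&: B) D u v).
    apply: eq_bigr => u; rewrite inE => /andP[uB _]; rewrite (big_setID B) /=.
    by rewrite [X in _ + X]big1 ?addr0 // => v; rewrite inE => /andP[vB _]; exact: D0.
  rewrite exchange_big; apply: eq_bigr => v _ /=; rewrite [X in _ = X - _](big_setID B) /=.
  by rewrite addrAC subrr add0r; apply: eq_bigr => u _.
apply: le_trans (ler_normD _ _) _.
have h1 : `|\sum_(u in S :&: B) \sum_(v in S) D u v| <= w' * (2 * eta + w' + 4 * k').
  by apply: norm_sum_le => // u; rewrite inE => /andP[uS _]; exact: rowD.
have h2 : `|\sum_(v in S :&: B) (\sum_(u in S) D v u - \sum_(u in S :&: B) D v u)|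
    <= w' * (2 * eta + w' + 4 * k' + w').
  apply: norm_sum_le => //; first exact: addr_ge0.
  move=> u; rewrite inE => /andP[uS _]; apply: le_trans (ler_normB _ _) _.
  by apply: lerD; [exact: rowD|exact: rowB].
lra.
Qed.

Lemma form_setC (x : {set I}) : fX p S S x
  = fX p setT setT x - 2 * (\sum_(v in U) dt p x v) + fX p U U x.
Proof.
have dU : [disjoint U & S] by rewrite -setI_eq0 setICr.
have eT := ind_setU R dU; rewrite setUCr in eT.
have wC := WC p x.
rewrite -form_one -ind_setT /fX eT !form_addl.
have r (f g h : 'I_n -> R) : form (W x) f (fun a => g a + h a) = form (W x) f g + form (W x) f h.
  by rewrite (formC wC) form_addl !(formC wC f).
rewrite !r (formC wC (ind R S) (ind R U)); ring.
Qed.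

Lemma survivor_form_le (FT PF : R) : `|fX p setT setT w| <= FT -> `|fX p U U w| <= PF ->
  `|fX p S S wA| <= w' * (4 * eta + 3 * w' + 8 * k') + FT + 2 * Dt + PF.
Proof.
move=> hFT hPF; have a1 := form_corrupt_le; have a2 := sum_pruned_le.
have a3 := form_setC w.
move: a1 a2 hFT hPF; rewrite a3 !ler_norml => /andP[? ?] /andP[? ?] /andP[? ?] /andP[? ?].
by apply/andP; split; lra.
Qed.

End Corruption.

(** * Errors of the estimators in terms of centred sums *)

Section Estimators.
Variables (R : realType) (n : nat) (p : R).
Hypothesis p01 : 0 <= p <= 1.
Implicit Types (G : sgraph n) (S : {set 'I_n}).
Local Notation W := (@W R n p).

Lemma deg_induced G S v : v \in S ->
  deg (induced (edges G) S) v = (\sum_(u in S) adj (enc G) v u)%N.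
Proof.
move=> vS; rewrite degE; last by apply: induced_all2; exact: edgesP.
rewrite -sum1_card big_mkcond [RHS]big_mkcond; apply: eq_bigr => u _.
rewrite !inE adj_enc subUset !sub1set vS /= eq_sym.
by case: (u \in S); case: (v != u) => //=; case: (_ \in _); rewrite ?andbF.
Qed.

Lemma deg_induced0 G S v : v \notin S -> deg (induced (edges G) S) v = 0%N.
Proof.
move=> vS; apply/eqP; rewrite cards_eq0; apply/eqP/setP => e; rewrite !inE.
apply/negP => /andP[/andP[_ eS] ve]; by rewrite (subsetP eS) in vS.
Qed.

Lemma sum_W_row G S v : v \in S ->
  \sum_(u in S) W (enc G) v u = (deg (induced (edges G) S) v)%:R - (#|S|%:R - 1) * p.
Proof.
move=> vS; rewrite deg_induced // natr_sum.
have -> : (#|S|%:R - 1) * p = \sum_(u in S) (p - (u == v)%:R * p).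
  rewrite sumrB sumr_const -(mulr_natl p) (bigD1 v) //= eqxx mul1r big1 ?addr0; first by ring.
  by move=> u /andP[_ /negbTE ->]; rewrite mul0r.
rewrite -sumrB; apply: eq_bigr => u uS; rewrite /W eq_sym; case: eqP => [->|_].
  by rewrite {1}/adj eqxx /= mul1r subrr subr0.
by rewrite mul0r subr0.
Qed.

Lemma induced_form G S : fX p S S (enc G)
  = 2 * #|induced (edges G) S|%:R - #|S|%:R * (#|S|%:R - 1) * p.
Proof.
have e : (2 * #|induced (edges G) S|)%:R = \sum_(v in S) (deg (induced (edges G) S) v)%:R :> R.
  rewrite -sum_deg; last by apply: induced_all2; exact: edgesP.
  rewrite natr_sum (bigID (mem S)) /= [X in _ + X]big1 ?addr0 // => v vS.
  by rewrite deg_induced0.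
rewrite natrM in e; rewrite e /fX formE.
transitivity (\sum_(v in S) ((deg (induced (edges G) S) v)%:R - (#|S|%:R - 1) * p)).
  rewrite [RHS]big_mkcond; apply: eq_bigr => v _; rewrite /ind.
  case: (boolP (v \in S)) => vS; rewrite /= ?mul1r ?mul0r // -sum_W_row // /mulv.
  by rewrite [RHS]big_mkcond; apply: eq_bigr => u _; case: (u \in S); rewrite /= ?mulr1 ?mulr0.
by rewrite sumrB sumr_const -(mulr_natl ((#|S|%:R - 1) * p)); ring.
Qed.

Lemma mean_error G S : (2 <= #|S|)%N ->
  `|mean_estimate R (edges G) S - p| = `|fX p S S (enc G)| / (#|S|%:R * (#|S|%:R - 1)).
Proof.
move=> m2; rewrite induced_form /mean_estimate.
have m2' : 2 <= #|S|%:R :> R by rewrite (ler_nat R 2).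
have eC : 2 * 'C(#|S|, 2)%:R = #|S|%:R * (#|S|%:R - 1) :> R.
  rewrite -(natrM R 2) mul_bin_left /= bin1.
  by rewrite natrM mulrC natrB 1?ltnW.
have mp : 0 < #|S|%:R * (#|S|%:R - 1) :> R by apply: mulr_gt0; lra.
have Cp : 0 < 'C(#|S|, 2)%:R :> R by lra.
rewrite -[X in _ = _ / X](gtr0_norm mp) -normfV -normrM; congr `|_|; rewrite -eC.
by move: Cp; move: ('C(_, 2)%:R : R) (#|induced _ _|%:R : R) => a x Cp; field; rewrite gt_eqF.
Qed.

Lemma median_range (s : seq nat) (lo hi : R) : (0 < size s)%N ->
    (forall x, x \in s -> lo <= x%:R <= hi) -> lo <= median R s <= hi.
Proof.
move=> s0 hs; rewrite /median; set t := sort leq s.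
have st : size t = size s by rewrite size_sort.
have nt i : (i < size s)%N -> lo <= (nth 0%N t i)%:R <= hi.
  by move=> hi'; apply: hs; rewrite -(mem_sort leq); apply: mem_nth; rewrite st.
have /andP[a1 a2] := nt ((size t).-1 %/ 2)%N ltac:(by rewrite st; lia).
have /andP[b1 b2] := nt (size t %/ 2)%N ltac:(by rewrite st; lia).
by apply/andP; split; lra.
Qed.

Lemma median_error G S (del : R) : (2 <= #|S|)%N ->
    (forall v, v \in S -> `|\sum_(u in S) W (enc G) v u| <= del) ->
  `|median_estimate R (edges G) S - p| <= del / (#|S|%:R - 1).
Proof.
move=> m2 hdel; rewrite /median_estimate.
have m2' : 2 <= #|S|%:R :> R by rewrite (ler_nat R 2).
have em : #|S|.-1%:R = #|S|%:R - 1 :> R by rewrite -subn1 natrB 1?ltnW.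
set s := [seq _ | v <- enum S].
have /andP[h1 h2] : (#|S|%:R - 1) * p - del <= median R s <= (#|S|%:R - 1) * p + del.
  apply: median_range; first by rewrite size_map -cardE ltnW.
  move=> x /mapP[v]; rewrite mem_enum => vS ->; have := hdel v vS.
  by rewrite sum_W_row // ler_norml => /andP[? ?]; apply/andP; split; lra.
have mp : 0 < #|S|%:R - 1 :> R by lra.
rewrite em ler_pdivlMr // -[X in _ * X](gtr0_norm mp) -normrM mulrBl divfK ?gt_eqF //.
by rewrite ler_norml; apply/andP; split; lra.
Qed.

End Estimators.

(** The mixed term [w sqrt(n log n)] is split by [2 w s <= w^2 + s^2]; with [w <= k] and [4 k <= n]
    everything becomes linear in [N L] and [k w]. *)
Lemma error_arith (R : realType) (N L k w s C0 F FT D P eta : R) :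
    2 <= N -> 1 / 2 <= L -> 0 <= w -> w <= k -> 4 * k <= N -> 0 <= s -> s ^+ 2 = N * L ->
    0 <= C0 -> eta = 60 * s -> F = 5 * N + 6 * N * (1 + (6 * L + 3 * L)) ->
    FT = 6 * N * (1 + (6 * L + 1)) ->
    D = 3 * F + 2 * k + 4 * k * w + 8 * w * (eta + w) ->
    P = C0 * (N * L + k * (w + 1)) + 2 * (D + w * eta) + FT + 6 * k * w ->
  w * (4 * eta + 3 * w + 8 * k) + FT + 2 * D + P <= (2 * C0 + 3000) * (N * L + k * w).
Proof.
move=> N2 L2 w0 wk kN s0 s2 C00 -> -> -> -> ->.
have ws : 2 * (w * s) <= w * w + N * L by have := sqr_ge0 (w - s); rewrite -s2; lra.
have ww : w * w <= k * w by apply: ler_wpM2r.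
have NL : N <= 2 * (N * L) by have h : N * (1 / 2) <= N * L by [apply: ler_wpM2l; lra]; lra.
have kw0 : 0 <= k * w by apply: mulr_ge0; lra.
have c1 : C0 * k <= C0 * (N * L) by apply: ler_wpM2l => //; lra.
have c2 : 0 <= C0 * (k * w) by apply: mulr_ge0.
lra.
Qed.

Lemma card_survivors (n k : nat) (X : {set 'I_n}) (R : realType) : (2 <= n)%N -> (4 * k < n)%N ->
    #|X| = (2 * k)%N ->
  [/\ (2 <= #|~: X|)%N, n%:R / 4 <= #|~: X|%:R - 1 :> R
    & n%:R ^+ 2 / 8 <= #|~: X|%:R * (#|~: X|%:R - 1) :> R].
Proof.
move=> n2 k4 cX; have e : (#|~: X| = n - 2 * k)%N by rewrite cardsCs setCK cX card_ord.
set m := #|~: X| in e *.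
have m2 : (2 <= m)%N by lia.
have nm : (n <= 2 * m)%N by lia.
have m2' : 2 <= m%:R :> R by rewrite (ler_nat R 2).
have nm' : n%:R <= 2 * m%:R :> R by rewrite -(natrM R 2) ler_nat.
have h : n%:R / 4 <= m%:R - 1 :> R by lra.
split=> //.
have h1 : n%:R / 2 * (n%:R / 4) <= m%:R * (m%:R - 1) :> R.
  by apply: ler_pM => //; [apply: divr_ge0|apply: divr_ge0|lra].
by apply: le_trans h1; rewrite expr2; lra.
Qed.

Lemma median_arith (R : realType) (s w k x : R) : 0 <= k -> w <= k -> k <= x ->
  60 * s + w + 2 * k <= 60 * x + 60 * s.
Proof. by move=> *; lra. Qed.

Lemma constant_bounds (R : realType) : [/\ 0 <= 900 * 900 * 2 * (16 * 12 ^+ 4) :> R,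
  0 <= 2 * (900 * 900 * 2 * (16 * 12 ^+ 4)) + 3000 :> R
  & 240 <= 8 * (2 * (900 * 900 * 2 * (16 * 12 ^+ 4)) + 3000) :> R].
Proof. by split; lra. Qed.

(** * Assembling the estimates *)

Section Main.
Variables (R : realType) (n : nat) (p gamma c : R).
Variables (A : sgraph n -> sgraph n) (T L : sgraph n -> {set 'I_n}).
Hypotheses (n2 : (2 <= n)%N) (p01 : 0 <= p <= 1) (c1 : 1 <= c)
  (gc0 : 0 < gamma * c) (gc4 : gamma * c < 1 / 4)
  (hA : omniscient_adversary gamma A) (hP : pruning_rule gamma c T L).
Local Notation N := (@GRing.natmul R 1 n).
Local Notation Ln := (ln (@GRing.natmul R 1 n)).
Local Notation K := ((16 * 12 ^+ 4) : R).
Local Notation pe := (@pe R n p).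
Local Notation k := (prune_size n gamma c).
Local Notation ww := (Num.truncn (gamma * N)).
Local Notation m0 := (Num.truncn (n.-1%:R * p)).

Let g0 : 0 < gamma. Proof. by move: gc0; rewrite pmulr_lgt0 //; apply: lt_le_trans c1. Qed.
Let N2 : 2 <= N. Proof. exact: natr_ge2. Qed.
Let Np : 0 < N. Proof. by rewrite ltr0n; apply: leq_trans n2. Qed.

Lemma prune_facts : [/\ k%:R <= c * gamma * N, ww%:R <= gamma * N, (ww <= k)%N & (4 * k < n)%N].
Proof.
have x0 : 0 <= c * gamma * N by rewrite mulr_ge0 // mulrC ltW.
have y0 : 0 <= gamma * N by rewrite mulr_ge0 // ltW.
have hk : k%:R <= c * gamma * N by have := truncn_le (c * gamma * N); rewrite x0.
have hw : ww%:R <= gamma * N by have := truncn_le (gamma * N); rewrite y0.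
split=> //.
  rewrite /prune_size truncn_ge_nat //; apply: le_trans hw _.
  by rewrite -mulrA ler_peMl.
rewrite -(ltr_nat R) (natrM R 4).
have : c * gamma * N < 1 / 4 * N by rewrite ltr_pM2r // mulrC.
lra.
Qed.

Definition event (w : {set ('I_n * 'I_n)}) :=
  [/\ forall v, `|dt p w v| <= 60 * Num.sqrt (N * Ln),
      `|fX p setT setT w| <= 6 * N * (1 + (6 * Ln + 1)),
      forall i : 'I_n.+1, `|\sum_v clip R m0 i (dg w v)|
        <= 5 * N + 6 * N * (1 + (6 * Ln + 3 * Ln))
    & forall (dA : 'I_n -> nat) (B X Y : {set 'I_n}) (D FT eta : R),
    (#|B| <= ww)%N -> (forall v, (dA v < n)%N) ->
    (forall v, v \notin B -> (dA v <= dg w v + ww)%N /\ (dg w v <= dA v + ww)%N) ->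
    #|X| = k -> #|Y| = k -> [disjoint X & Y] ->
    top (fun v => (dA v)%:R : R) X -> top (fun v => - (dA v)%:R : R) Y ->
    `|\sum_(v in X :|: Y) dt p w v| <= D -> `|fX p setT setT w| <= FT -> 0 <= eta ->
    (forall v, `|dt p w v| <= eta) ->
  `|fX p (X :|: Y) (X :|: Y) w|
    <= 900 * 900 * 2 * K * (N * Ln + k%:R * (ww%:R + 1)) + 2 * (D + ww%:R * eta) + FT
       + 6 * k%:R * ww%:R].

Lemma m0_bounds : m0%:R <= n.-1%:R * p /\ n.-1%:R * p < m0%:R + 1.
Proof.
have /andP[p0 _] := p01; have x0 : 0 <= n.-1%:R * p by apply: mulr_ge0.
have := truncn_itv x0 => /andP[h1 h2]; split=> //.
by rewrite natr1.
Qed.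

Lemma whp_event : whp pe (expR (6 * Ln) / 2 / 2 / 2 / 2) event.
Proof.
have [hk hw hwk k4] := prune_facts; have [m0l m0u] := m0_bounds.
have n0 : (0 < n)%N by apply: leq_trans n2.
have e0 := expR_ge0 (6 * Ln).
have a1 := whp_deg_eta p01 n2.
have a2 := @whp_total R n p p01 (6 * Ln) 1 n0 (two_le_expR (lexx 1)).
have a3 := whp_clip p01 (6 * Ln) n0 m0l m0u (double_succ_le_expR R n2).
have a4 := whp_pruned_form p01 n2 (ltnW k4) hwk (lexx K).
have b1 := whp_and a1 a2.
have a3' := whp_le (ltac:(lra) : expR (6 * Ln) / 2 <= expR (6 * Ln)) (fun _ h => h) a3.
have b2 := whp_and b1 a3'.
have b2' := whp_le (ltac:(lra) : expR (6 * Ln) / 2 / 2 / 2 <= expR (6 * Ln) / 2 / 2) (fun _ h => h) b2.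
by apply: whp_le (lexx _) _ (whp_and b2' a4) => w [[[h1 h2] h3] h4].
Qed.

Local Notation C := (8 * (2 * (900 * 900 * 2 * K) + 3000) : R).

Lemma event_estimates G : event (enc G) ->
  (`|prune_then_mean R T L (A G) - p| <= C * (c * gamma ^+ 2 + Ln / N)) &&
  (`|prune_then_median R T L (A G) - p| <= C * (c * gamma + Num.sqrt (Ln / N))).
Proof.
move=> [e1 e2 e3 e4].
have [hk hw hwk k4] := prune_facts; have [m0l m0u] := m0_bounds.
have n0 : (0 < n)%N by apply: leq_trans n2.
have L2 := ln_nat_ge R n2.
have L0 : 0 <= Ln by apply: le_trans L2; rewrite divr_ge0.
have [B [hB hE]] := hA G.
have hB' : (#|B| <= ww)%N by rewrite truncn_ge_nat // mulr_ge0 // ltW.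
pose wA := enc (A G).
have hadj u v : u \notin B -> v \notin B -> adj wA u v = adj (enc G) u v.
  move=> uB vB; rewrite !adj_enc hE // -setI_eq0; apply/eqP/setP => x; rewrite !inE.
  by apply/negP => /andP[/orP[/eqP ->|/eqP ->]]; apply/negP.
have [cT cL dTL tT tL] := hP (A G); have [cTs cLs dTLs tTs tLs] := hP G.
have tT' u v : u \in T (A G) -> v \notin T (A G) -> (dg wA v <= dg wA u)%N.
  by rewrite !dg_enc; exact: tT.
have tL' u v : u \in L (A G) -> v \notin L (A G) -> (dg wA u <= dg wA v)%N.
  by rewrite !dg_enc; exact: tL.
have tTs' u v : u \in T G -> v \notin T G -> (dg (enc G) v <= dg (enc G) u)%N.
  by rewrite !dg_enc; exact: tTs.
have tLs' u v : u \in L G -> v \notin L G -> (dg (enc G) u <= dg (enc G) v)%N.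
  by rewrite !dg_enc; exact: tLs.
set s := Num.sqrt (N * Ln) in e1.
have s0 : 0 <= s by apply: sqrtr_ge0.
have NL0 : 0 <= N * Ln by apply: mulr_ge0.
have s2 : s ^+ 2 = N * Ln by rewrite sqr_sqrtr.
set eta := 60 * s in e1.
have eta0 : 0 <= eta by apply: mulr_ge0.
set F := 5 * N + _ in e3; set FT := 6 * N * _ in e2.
have dn v : (dg wA v < n)%N by apply: dg_lt.
have hdA v : v \notin B -> (dg wA v <= dg (enc G) v + ww)%N /\ (dg (enc G) v <= dg wA v + ww)%N.
  by move=> vB; apply: (dg_corrupt (B := B)).
have hD : `|\sum_(v in T (A G) :|: L (A G)) dt p (enc G) v| <= Dt k ww eta F.
  by apply sum_pruned_le with (m0 := m0) (wA := wA) (B := B) (Ts := T G) (Ls := L G).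
have topT : top (fun v => (dg wA v)%:R : R) (T (A G)).
  by move=> u v uT vT; rewrite ler_nat; exact: tT'.
have topL : top (fun v => - (dg wA v)%:R : R) (L (A G)).
  by move=> u v uT vT; rewrite lerN2 ler_nat; exact: tL'.
have hPF := e4 (dg wA) B (T (A G)) (L (A G)) _ _ _ hB' dn hdA cT cL dTL topT topL hD e2 eta0 e1.
have hS : `|fX p (~: (T (A G) :|: L (A G))) (~: (T (A G) :|: L (A G))) wA|
   <= ww%:R * (4 * eta + 3 * ww%:R + 8 * k%:R) + FT + 2 * Dt k ww eta F
     + (900 * 900 * 2 * K * (N * Ln + k%:R * (ww%:R + 1)) + 2 * (Dt k ww eta F + ww%:R * eta) + FT
       + 6 * k%:R * ww%:R).
  by apply survivor_form_le with (w := enc G) (m0 := m0) (B := B) (Ts := T G) (Ls := L G).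
have kN : 4 * k%:R <= N by rewrite -(natrM R 4) ler_nat ltnW.
have wk' : ww%:R <= k%:R :> R by rewrite ler_nat.
have [C00 C0 C240] := constant_bounds R.
have arith := error_arith N2 L2 (ler0n R ww) wk' kN s0 s2 C00 erefl erefl erefl erefl erefl.
have {}hS := le_trans hS arith.
have cU : #|T (A G) :|: L (A G)| = (2 * k)%N.
  by rewrite cardsU (disjoint_setI0 dTL) cards0 subn0 cT cL mul2n addnn.
have [m2 hm hmm] := card_survivors R n2 k4 cU.
rewrite /prune_then_mean /prune_then_median /pruned.
set S := ~: _ in hS m2 hm hmm *.
have kw : k%:R * ww%:R <= c * gamma ^+ 2 * N ^+ 2.
  have -> : c * gamma ^+ 2 * N ^+ 2 = c * gamma * N * (gamma * N) by ring.
  by apply: ler_pM.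
have LN : N * Ln = Ln / N * N ^+ 2 by field; rewrite gt_eqF.
have N20 : 0 < N ^+ 2 / 8 by rewrite divr_gt0 // exprn_gt0.
apply/andP; split.
  rewrite (mean_error p) // -/wA.
  have mp : 0 < #|S|%:R * (#|S|%:R - 1) :> R by apply: lt_le_trans hmm.
  rewrite ler_pdivrMr //; apply: le_trans hS _.
  (* At least half of the vertices survive, so the denominator is at least [N^2 / 8]; hence the [8]
     in [C]. *)
  apply: (@le_trans _ _ (C * (c * gamma ^+ 2 + Ln / N) * (N ^+ 2 / 8))); last first.
    apply: ler_wpM2l => //; apply: mulr_ge0; first by apply: mulr_ge0.
    apply: addr_ge0; last exact: divr_ge0.
    by apply: mulr_ge0; [exact: le_trans ler01 c1|exact: sqr_ge0].
  rewrite (_ : C * _ * _ = (2 * (900 * 900 * 2 * K) + 3000) * (c * gamma ^+ 2 * N ^+ 2 + N * Ln)).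
    by apply: ler_wpM2l => //; rewrite addrC lerD2r.
  rewrite LN; move: (2 * (900 * 900 * 2 * K) + 3000) (c * gamma ^+ 2) (Ln / N) => x y z.
  by field.
have hrow v : v \in S -> `|\sum_(u in S) W p wA v u| <= eta + ww%:R + 2 * k%:R.
  rewrite inE => vU; apply: sum_pruned_row => //.
  by apply dt_survivor with (k := k) (w := enc G) (B := B) (T := T (A G)) (Lo := L (A G)).
have hmed : `|median_estimate R (edges (A G)) S - p| <= (eta + ww%:R + 2 * k%:R) / (#|S|%:R - 1).
  exact: median_error.
apply: le_trans hmed _.
have sN : Num.sqrt (Ln / N) = s / N.
  rewrite -[RHS]ger0_norm ?divr_ge0 // -sqrtr_sqr exprMn s2; congr Num.sqrt.
  by field; rewrite gt_eqF.
have mp : 0 < #|S|%:R - 1 :> R by apply: lt_le_trans hm; rewrite divr_gt0.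
rewrite ler_pdivrMr // sN.
have cg0 : 0 <= c * gamma by rewrite mulrC ltW.
have x0 : 0 <= c * gamma + s / N by apply: addr_ge0 => //; apply: divr_ge0.
(* The row error is at most [60 (k + s)] up to rounding, and [|S| - 1 >= N / 4], so
   [240 = 4 * 60]. *)
apply: (@le_trans _ _ (240 * (c * gamma + s / N) * (N / 4))); last first.
  apply: ler_pM => //; [by apply: mulr_ge0|by apply: divr_ge0|exact: ler_wpM2r].
have -> : 240 * (c * gamma + s / N) * (N / 4) = 60 * (c * gamma * N) + 60 * s.
  by field; rewrite gt_eqF.
exact: median_arith.
Qed.

End Main.

Theorem theorem3p3 (R : realType) :
  exists C : R, 0 < C /\
  forall (n : nat) (p gamma c : R)
         (A : sgraph n -> sgraph n) (T L : sgraph n -> {set 'I_n}),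
    (0 < n)%N ->
    0 <= p <= 1 ->
    1 <= c ->
    0 < gamma * c < 1 / 4 ->
    omniscient_adversary gamma A ->
    pruning_rule gamma c T L ->
    (forall G : sgraph n,
       #|pruned T L (A G)| = (2 * prune_size n gamma c)%N) /\
    1 - n%:R ^- 2 <=
      Pr_gnp p (fun G : sgraph n =>
        (`|prune_then_mean R T L (A G) - p|
           <= C * (c * gamma ^+ 2 + ln n%:R / n%:R)) &&
        (`|prune_then_median R T L (A G) - p|
           <= C * (c * gamma + Num.sqrt (ln n%:R / n%:R)))).
Proof.
exists (8 * (2 * (900 * 900 * 2 * (16 * 12 ^+ 4)) + 3000)); split; first by lra.
move=> n p gamma c A T L n0 p01 c1 /andP[gc0 gc4] hA hP; split.
  move=> G; have [cT cL dTL _ _] := hP (A G).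
  by rewrite /pruned cardsU (disjoint_setI0 dTL) cards0 subn0 cT cL mul2n addnn.
set ev := (fun G => _ && _).
have /andP[p0 p1] := p01.
(* The event is transported to sets of pairs by quantifying over the graphs encoded by [w];
   injectivity of [enc] leaves at most one. *)
have PrE : Pr_gnp p ev = Ex (@pe R n p) (fun w => [forall G, (enc G == w) ==> ev G]%:R).
  rewrite Ex_gnp /Pr_gnp big_mkcond; apply: eq_bigr => G _.
  have -> : [forall G', (enc G' == enc G) ==> ev G'] = ev G.
    apply/forallP/idP => [/(_ G)|h G']; first by rewrite eqxx.
    by apply/implyP => /eqP /enc_inj ->.
  by case: (ev G); rewrite /= ?mulr1 ?mulr0.
(* For [n = 1] the claimed probability is [0]. *)
case: (ltnP 1 n) => n2; last first.
  have n1 : n = 1%N by apply/eqP; rewrite eqn_leq n2 n0.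
  have -> : n%:R = 1 :> R by rewrite n1.
  rewrite expr1n invr1 subrr; apply: sumr_ge0 => G _; apply: prodr_ge0 => e _.
  by case: ifP => // _; rewrite subr_ge0.
rewrite PrE; have hw := whp_event n2 p01 c1 gc0 gc4.
set T16 := expR _ / 2 / 2 / 2 / 2 in hw.
have N2 := natr_ge2 R n2.
(* The four halvings leave a failure probability of at most [16 / n^6], and [n >= 2] makes this at
   most [n^-2]. *)
have eT : T16 = n%:R ^+ 6 / 16 by rewrite /T16 (expR_mul_ln R n2 6); field.
have N4 : 2 * 2 * (2 * 2) <= n%:R * n%:R * (n%:R * n%:R) :> R.
  by apply: ler_pM => //; try exact: mulr_ge0; apply: ler_pM.
have hT : n%:R ^+ 2 <= T16.
  rewrite eT ler_pdivlMr // (_ : n%:R ^+ 6 = n%:R ^+ 2 * (n%:R * n%:R * (n%:R * n%:R))); last by ring.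
  by apply: ler_wpM2l; [exact: sqr_ge0|lra].
have N20 : 0 < n%:R ^+ 2 :> R by rewrite exprn_gt0 // ltr0n.
have T0 : 0 < T16 by apply: lt_le_trans hT.
have main := whp_Ex (pe01 p01) T0 hw
  (ev := fun w => [forall G, (enc G == w) ==> ev G]).
apply: le_trans (main _).
  by rewrite lerD2l lerN2 lef_pV2 ?posrE.
move=> w hev; apply/forallP => G; apply/implyP => /eqP e; rewrite -e in hev.
exact: (event_estimates n2 p01 c1 gc0 gc4 hA hP hev).
Qed.
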